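(* Let $k$ be a perfect field of characteristic $p\ge3$, $m=\frac{p-1}2$, and $\lambda\in W_2(k)$ with $\lambda\not\equiv0,1\pmod p$. Let $\varphi_{\lambda,p}:\mathbb P^1\to\mathbb P^1$ be the self-map induced by the Higgs-de Rham flow on the moduli space of graded semistable logarithmic Higgs bundles of rank 2 and degree 1 on $(\mathbb P^1_k,\{0,1,\lambda,\infty\})$, identified with $\mathbb P^1$ by sending a Higgs bundle to the zero of its Higgs field. Put $$\delta_n=\frac{\lambda^p(1-a^p)-(\lambda^p-a^p)\lambda^n}{n}\qquad(1\le n\le p-1),$$ let $A$ be the $m\times(m+1)$ matrix with $(i,j)$-entry $\delta_{m-i+j}$ ($1\le i\le m$, $1\le j\le m+1$), and let $A_{m+1}$ (resp. $A_p$) be the $m\times m$ matrix obtained from $A$ by removing the first (resp. last) column. Then $$\varphi_{\lambda,p}(a)=\frac{a^p}{\lambda^{p-1}}\cdot\left(\frac{\det(A_{m+1})}{\det(A_p)}\right)^2.$$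
   Context: In the formula $\lambda$ stands for its reduction in $k$. Let $X_2=\mathbb P^1_{W_2(k)}$, $D=\{0,1,\lambda,\infty\}$, with reduction $(X_1,\overline D)$. Every graded semistable logarithmic Higgs bundle of rank 2 and degree 1 on $(X_1,\overline D)$ is of the form $(\mathcal O(1)\oplus\mathcal O,\theta)$ with $0\ne\theta:\mathcal O(1)\to\mathcal O\otimes\Omega^1_{X_1}(\log\overline D)$; the cokernel of $\theta$ is supported at one point $a$, the zero of the Higgs field, and $a$ determines the Higgs bundle up to isomorphism. The logarithmic inverse Cartier transform $C_1^{-1}$ (for the lifting $(X_2,D)$): on affine opens $U_i$ of $X_2$ with logarithmic Frobenius liftings $\Phi_i$ (respecting $D$), take $V_i=F^*(E|_{\overline U_i})$ ($F$ the absolute Frobenius), $\nabla_i=\mathrm d+\frac{\mathrm d\Phi_i}p(F^*\theta)$, glued by $\exp(h_{ij}(F^*\theta))$, $h_{ij}(F^*\mathrm dt)=\frac{\Phi_i(t)-\Phi_j(t)}p$. For a graded semistable logarithmic Higgs bundle $(E,\theta)=(\mathcal O(1)\oplus\mathcal O,\theta)$ with $\theta\ne0$ on $(X_1,\overline D)$, $V$ (where $(V,\nabla)=C_1^{-1}(E,\theta)$) is isomorphic to $\mathcal O(m)\oplus\mathcal O(m+1)$, and $\mathrm{Gr}(V,\nabla)=(V/\mathcal O(m+1)\oplus\mathcal O(m+1),\mathrm{Gr}\nabla)$ is taken with respect to the filtration $0\subset\mathcal O(m+1)\subset V$. The self-map is $\varphi_{\lambda,p}:(E,\theta)\mapsto\mathrm{Gr}(V,\nabla)\otimes\mathcal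 O(\frac{1-p}2)$, i.e. $\varphi_{\lambda,p}(a)$ is the zero of the Higgs field of $\mathrm{Gr}(C_1^{-1}(E,\theta))$. *)

(* Defs.v *)
From HB Require Import structures.
From mathcomp Require Import all_boot all_order all_algebra.
From mathcomp Require Import boolp classical_sets.
From mathcomp Require Import ring.

Set Implicit Arguments.
Unset Strict Implicit.
Unset Printing Implicit Defensive.

Import GRing.Theory.
Local Open Scope ring_scope.
Local Open Scope quotient_scope.

(* cf. the Witt polynomials: p * wcarry x y = (x + y)^p - x^p - y^p *)
Definition wcarry (R : comNzRingType) (p : nat) (x y : R) : R :=
  \sum_(1 <= i < p) ('C(p, i) %/ p)%:R * x ^+ i * y ^+ (p - i).

Section WCarry.
Variable p : nat.
Hypothesis pp : prime p.

Lemma wcarryE (R : comNzRingType) (x y : R) :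
  wcarry p x y *+ p = (x + y) ^+ p - x ^+ p - y ^+ p.
Proof.
have p0 := prime_gt0 pp.
have -> : (x + y) ^+ p = \sum_(0 <= i < p.+1) (y ^+ (p - i) * x ^+ i) *+ 'C(p, i).
  by rewrite big_mkord addrC exprDn.
rewrite big_nat_recr //= big_ltn // subnn !expr0 mul1r binn mulr1n subn0 bin0.
rewrite mulr1 mulr1n; set s := \sum_(1 <= i < p) _.
have -> : y ^+ p + s + x ^+ p - x ^+ p - y ^+ p = s by ring.
rewrite /wcarry -sumrMnl; apply: eq_big_nat => i /andP[i0 ip].
have dvd : (p %| 'C(p, i))%N by apply: prime_dvd_bin => //; rewrite i0.
rewrite -[in RHS](divnK dvd) mulrnA; congr (_ *+ p).
by rewrite -[RHS]mulr_natl -mulrA (mulrC (x ^+ _)).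
Qed.

Lemma wcarryC (R : comNzRingType) : commutative (@wcarry R p).
Proof.
move=> x y; rewrite /wcarry big_nat_rev /=; apply: eq_big_nat => i /andP[i0 ip].
rewrite add1n subSS subKn ?bin_sub ?(ltnW ip) // mulrAC; congr (_ * _ * _).
Qed.

Lemma wcarry_morph (R S : comNzRingType) (f : {rmorphism R -> S}) x y :
  f (wcarry p x y) = wcarry p (f x) (f y).
Proof.
rewrite rmorph_sum /=; apply: eq_bigr => i _.
by rewrite !rmorphM /= !rmorphXn /= rmorph_nat.
Qed.

Lemma wcarryM (R : comNzRingType) (a x y : R) :
  wcarry p (a * x) (a * y) = a ^+ p * wcarry p x y.
Proof.
rewrite /wcarry mulr_sumr; apply: eq_big_nat => i /andP[i0 ip].
rewrite !exprMn -[in a ^+ p](subnKC (ltnW ip)) exprD; ring.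
Qed.

Lemma wcarry_x0 (R : comNzRingType) (x : R) : wcarry p x 0 = 0.
Proof.
rewrite /wcarry big_nat big1 // => i /andP[i0 ip].
by rewrite expr0n subn_eq0 leqNgt ip mulr0.
Qed.

Lemma wcarryA (R : comNzRingType) (x y z : R) :
  wcarry p x y + wcarry p (x + y) z = wcarry p y z + wcarry p x (y + z).
Proof.
pose P1 := {poly int}; pose P2 := {poly P1}; pose P3 := {poly P2}.
pose f1 : {rmorphism P1 -> R} := horner_morph (fun a : int => mulrC x a%:~R).
pose f2 : {rmorphism P2 -> R} := horner_morph (fun a : P1 => mulrC y (f1 a)).
pose f3 : {rmorphism P3 -> R} := horner_morph (fun a : P2 => mulrC z (f2 a)).
pose X : P3 := (('X : P1)%:P)%:P; pose Y : P3 := ('X : P2)%:P; pose Z : P3 := 'X.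
have f3X : f3 X = x by rewrite /= horner_morphC /= horner_morphC /= horner_morphX.
have f3Y : f3 Y = y by rewrite /= horner_morphC /= horner_morphX.
have f3Z : f3 Z = z by rewrite /= horner_morphX.
suff E : wcarry p X Y + wcarry p (X + Y) Z = wcarry p Y Z + wcarry p X (Y + Z).
  by move: (congr1 f3 E); rewrite !rmorphD !wcarry_morph !rmorphD f3X f3Y f3Z.
have pN0 : (p%:R : P3) != 0.
  rewrite -!polyC_natr !polyC_eq0 Num.Theory.pnatr_eq0.
  by rewrite -lt0n prime_gt0.
apply: (mulfI pN0); rewrite !mulrDr !mulr_natl !wcarryE //.
have -> : X + (Y + Z) = X + Y + Z by rewrite addrA.
move: (X ^+ p) (Y ^+ p) (Z ^+ p) ((X + Y) ^+ p) ((Y + Z) ^+ p).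
by move: ((X + Y + Z) ^+ p) => *; ring.
Qed.

End WCarry.

(* Witt vectors of length 2: the ghost components are x0 and x0^p + p x1. *)
Definition W2 (p : nat) (k : fieldType) (charkp : p \in [pchar k]) : Type :=
  (k * k)%type.

Section Witt.
Variables (p : nat) (k : fieldType) (charkp : p \in [pchar k]).
Let pp : prime p := pcharf_prime charkp.
Local Notation W := (W2 charkp).
Local Notation c := (@wcarry k p).

HB.instance Definition _ := Choice.copy W (k * k)%type.

Implicit Types x y z : W.

Definition Wzero : W := (0, 0).
Definition Wone : W := (1, 0).
Definition Wadd x y : W := (x.1 + y.1, x.2 + y.2 - c x.1 y.1).
Definition Wopp x : W := (- x.1, - x.2 + c x.1 (- x.1)).
Definition Wmul x y : W :=
  (x.1 * y.1, x.1 ^+ p * y.2 + x.2 * y.1 ^+ p).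

Lemma WaddA : associative Wadd.
Proof.
move=> x y z; rewrite /Wadd /= addrA; congr (_, _).
have := wcarryA pp x.1 y.1 z.1.
set a := c x.1 y.1; set b := c _ z.1; set d := c y.1 _; set e := c x.1 _.
by move=> E; transitivity (x.2 + y.2 + z.2 - (d + e)); [ring | rewrite -E; ring].
Qed.

Lemma WaddC : commutative Wadd.
Proof. by move=> x y; rewrite /Wadd (wcarryC) addrC (addrC x.2). Qed.

Lemma Wadd0 : left_id Wzero Wadd.
Proof.
by case=> x0 x1; rewrite /Wadd /= wcarryC wcarry_x0 // subr0 !add0r.
Qed.

Lemma WaddN : left_inverse Wzero Wopp Wadd.
Proof.
move=> x; rewrite /Wadd /= addNr (wcarryC p (- _)); congr (_, _); ring.
Qed.

HB.instance Definition _ := GRing.isZmodule.Build W WaddA WaddC Wadd0 WaddN.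

Lemma WmulA : associative Wmul.
Proof. by move=> x y z; rewrite /Wmul /= !exprMn; congr (_, _); ring. Qed.

Lemma WmulC : commutative Wmul.
Proof. by move=> x y; rewrite /Wmul /=; congr (_, _); ring. Qed.

Lemma Wmul1 : left_id Wone Wmul.
Proof.
by case=> x0 x1; rewrite /Wmul /= mul1r expr1n mul1r mul0r addr0.
Qed.

Lemma WmulDl : left_distributive Wmul Wadd.
Proof.
move=> x y z; rewrite /Wmul /Wadd /= mulrDl; congr (_, _).
have -> : c (x.1 * z.1) (y.1 * z.1) = z.1 ^+ p * c x.1 y.1.
  by rewrite -wcarryM // !(mulrC z.1).
have := rmorphD (pFrobenius_aut charkp) x.1 y.1; rewrite /= !pFrobenius_autE => ->.
ring.
Qed.

Lemma Wone_neq0 : Wone != Wzero.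
Proof. by rewrite /Wone /Wzero xpair_eqE oner_eq0. Qed.

HB.instance Definition _ := GRing.Zmodule_isComNzRing.Build W
  WmulA WmulC Wmul1 WmulDl Wone_neq0.

Definition Wres (x : W) : k := x.1.

Lemma Wres_zmod_morphism : zmod_morphism Wres.
Proof. by []. Qed.
Lemma Wres_monoid_morphism : monoid_morphism Wres.
Proof. by []. Qed.
HB.instance Definition _ :=
  GRing.isZmodMorphism.Build W k Wres Wres_zmod_morphism.
HB.instance Definition _ :=
  GRing.isMonoidMorphism.Build W k Wres Wres_monoid_morphism.

End Witt.

Section Localization.
Variables (R : comNzRingType) (S : mulrClosed R).

Record prefrac := Prefrac { prefrac_val :> R * R; _ : prefrac_val.2 \in S }.
HB.instance Definition _ := [isSub for prefrac_val].
HB.instance Definition _ := [Choice of prefrac by <:].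

Implicit Types x y z : prefrac.

Lemma prefrac_den x : x.2 \in S. Proof. by case: x. Qed.
Hint Resolve prefrac_den : core.

Definition loc_eqv x y : bool :=
  `[< exists2 u, u \in S & u * (x.1 * y.2 - y.1 * x.2) = 0 >].

Lemma loc_eqv_refl : reflexive loc_eqv.
Proof. by move=> x; apply/asboolP; exists 1; rewrite ?rpred1 // subrr mulr0. Qed.

Lemma loc_eqv_sym : symmetric loc_eqv.
Proof.
suff H x y : loc_eqv x y -> loc_eqv y x by move=> x y; apply/idP/idP; exact: H.
by move=> /asboolP[u uS e]; apply/asboolP; exists u => //; rewrite -opprB mulrN e oppr0.
Qed.

Lemma loc_eqv_trans : transitive loc_eqv.
Proof.
move=> y x z /asboolP[u uS e] /asboolP[v vS f]; apply/asboolP.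
exists (u * v * y.2); first by rewrite !rpredM.
transitivity (v * z.2 * (u * (x.1 * y.2 - y.1 * x.2))
              + u * x.2 * (v * (y.1 * z.2 - z.1 * y.2))); first by ring.
by rewrite e f !mulr0 addr0.
Qed.

Canonical loc_equiv := EquivRel loc_eqv loc_eqv_refl loc_eqv_sym loc_eqv_trans.

Definition loc := {eq_quot loc_eqv}.
HB.instance Definition _ : EqQuotient _ loc_eqv loc := EqQuotient.on loc.
HB.instance Definition _ := Choice.on loc.

Lemma prefrac_denM x y : x.2 * y.2 \in S.
Proof. by rewrite rpredM. Qed.

Definition loc_add_rep x y : prefrac :=
  @Prefrac (x.1 * y.2 + y.1 * x.2, x.2 * y.2) (prefrac_denM x y).
Definition loc_opp_rep x : prefrac := @Prefrac (- x.1, x.2) (prefrac_den x).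
Definition loc_mul_rep x y : prefrac :=
  @Prefrac (x.1 * y.1, x.2 * y.2) (prefrac_denM x y).
Definition loc_of_rep (a : R) : prefrac := @Prefrac (a, 1) (rpred1 S).

Lemma locP x y : reflect (exists2 u, u \in S & u * (x.1 * y.2 - y.1 * x.2) = 0)
  (\pi_loc x == \pi_loc y).
Proof. by rewrite eqmodE; apply: asboolP. Qed.

Lemma loc_reprP x : exists2 u, u \in S &
  u * ((repr (\pi_loc x)).1 * x.2 - x.1 * (repr (\pi_loc x)).2) = 0.
Proof. by apply/locP; rewrite reprK. Qed.

Definition loc_add (a b : loc) : loc := \pi_loc (loc_add_rep (repr a) (repr b)).
Definition loc_opp (a : loc) : loc := \pi_loc (loc_opp_rep (repr a)).
Definition loc_mul (a b : loc) : loc := \pi_loc (loc_mul_rep (repr a) (repr b)).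
Definition loc_of (a : R) : loc := \pi_loc (loc_of_rep a).

Lemma loc_addE x y : loc_add (\pi_loc x) (\pi_loc y) = \pi_loc (loc_add_rep x y).
Proof.
apply/eqP/locP; have [u uS e] := loc_reprP x; have [v vS f] := loc_reprP y.
move: (repr (\pi_loc x)) (repr (\pi_loc y)) e f => x' y' e f /=.
exists (u * v); first exact: rpredM.
transitivity (v * y.2 * y'.2 * (u * (x'.1 * x.2 - x.1 * x'.2))
            + u * x.2 * x'.2 * (v * (y'.1 * y.2 - y.1 * y'.2))); first by ring.
by rewrite e f !mulr0 addr0.
Qed.

Lemma loc_oppE x : loc_opp (\pi_loc x) = \pi_loc (loc_opp_rep x).
Proof.
apply/eqP/locP; have [u uS e] := loc_reprP x; move: (repr _) e => x' e /=.
by exists u => //; transitivity (- (u * (x'.1 * x.2 - x.1 * x'.2))); [ring | rewrite e oppr0].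
Qed.

Lemma loc_mulE x y : loc_mul (\pi_loc x) (\pi_loc y) = \pi_loc (loc_mul_rep x y).
Proof.
apply/eqP/locP; have [u uS e] := loc_reprP x; have [v vS f] := loc_reprP y.
move: (repr (\pi_loc x)) (repr (\pi_loc y)) e f => x' y' e f /=.
exists (u * v); first exact: rpredM.
transitivity (v * y'.1 * y.2 * (u * (x'.1 * x.2 - x.1 * x'.2))
            + u * x.1 * x'.2 * (v * (y'.1 * y.2 - y.1 * y'.2))); first by ring.
by rewrite e f !mulr0 addr0.
Qed.

Local Lemma loc_eq x y : x.1 * y.2 = y.1 * x.2 -> \pi_loc x = \pi_loc y.
Proof. by move=> e; apply/eqP/locP; exists 1; rewrite ?rpred1 // e subrr mulr0. Qed.

Lemma loc_addA : associative loc_add.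
Proof.
elim/quotW=> x; elim/quotW=> y; elim/quotW=> z.
rewrite (loc_addE y z) (loc_addE x y) (loc_addE x) (loc_addE _ z).
by apply: loc_eq => /=; ring.
Qed.
Lemma loc_addC : commutative loc_add.
Proof.
elim/quotW=> x; elim/quotW=> y; rewrite (loc_addE x y) (loc_addE y x).
by apply: loc_eq => /=; ring.
Qed.
Lemma loc_add0 : left_id (loc_of 0) loc_add.
Proof. by elim/quotW=> x; rewrite loc_addE; apply: loc_eq => /=; ring. Qed.
Lemma loc_addN : left_inverse (loc_of 0) loc_opp loc_add.
Proof.
by elim/quotW=> x; rewrite loc_oppE loc_addE; apply: loc_eq => /=; ring.
Qed.
HB.instance Definition _ :=
  GRing.isZmodule.Build loc loc_addA loc_addC loc_add0 loc_addN.

Lemma loc_mulA : associative loc_mul.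
Proof.
elim/quotW=> x; elim/quotW=> y; elim/quotW=> z.
rewrite (loc_mulE y z) (loc_mulE x y) (loc_mulE x) (loc_mulE _ z).
by apply: loc_eq => /=; ring.
Qed.
Lemma loc_mulC : commutative loc_mul.
Proof.
elim/quotW=> x; elim/quotW=> y; rewrite (loc_mulE x y) (loc_mulE y x).
by apply: loc_eq => /=; ring.
Qed.
Lemma loc_mul1 : left_id (loc_of 1) loc_mul.
Proof. by elim/quotW=> x; rewrite loc_mulE; apply: loc_eq => /=; ring. Qed.
Lemma loc_mulDl : left_distributive loc_mul loc_add.
Proof.
elim/quotW=> x; elim/quotW=> y; elim/quotW=> z.
rewrite (loc_addE x y) (loc_mulE x z) (loc_mulE y z) (loc_mulE _ z).
by rewrite (loc_addE (loc_mul_rep x z)); apply: loc_eq => /=; ring.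
Qed.
HB.instance Definition _ :=
  GRing.Zmodule_isComPzRing.Build loc loc_mulA loc_mulC loc_mul1 loc_mulDl.

(* a / b, meaningful for b \in S *)
Definition loc_frac (a b : R) : loc := \pi_loc (insubd (loc_of_rep 0) (a, b)).

Lemma loc_of_zmod_morphism : zmod_morphism loc_of.
Proof.
move=> a b; have -> : loc_of a - loc_of b = loc_add (loc_of a) (loc_opp (loc_of b)).
  by [].
by rewrite loc_oppE loc_addE; apply: loc_eq => /=; ring.
Qed.
Lemma loc_of_monoid_morphism : monoid_morphism loc_of.
Proof.
split=> // a b; have -> : loc_of a * loc_of b = loc_mul (loc_of a) (loc_of b) by [].
by rewrite loc_mulE; apply: loc_eq => /=; ring.
Qed.
HB.instance Definition _ :=
  GRing.isZmodMorphism.Build R loc loc_of loc_of_zmod_morphism.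
HB.instance Definition _ :=
  GRing.isMonoidMorphism.Build R loc loc_of loc_of_monoid_morphism.

End Localization.

Section Curve.
Variable k : fieldType.
Local Notation K := {fraction {poly k}}.
Local Notation "q %:F" := (tofrac q).
Local Notation t := ('X%:F : K).

(* Closed points of P^1_k: Some q is the zero locus of the monic irreducible
   polynomial q, and None is the point at infinity. *)
Definition closed_point (x : option {poly k}) : Prop :=
  if x is Some q then q \is monic /\ irreducible_poly q else True.

Definition rat_point (a : option k) : option {poly k} :=
  omap (fun c => 'X - c%:P) a.

(* membership in the local ring O_{P^1, x}, inside the function field k(t) *)
Definition regular (x : option {poly k}) (f : K) : Prop :=
  if x is Some q then exists a b : {poly k}, ~~ (q %| b) /\ f = a%:F / b%:F
  else exists a b : {poly k}, [/\ b != 0, (size a <= size b)%N & f = a%:F / b%:F].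

(* A subsheaf of a constant sheaf is given by its stalks. *)

(* O(n) := O(n * infinity) *)
Definition O_ (n : nat) (x : option {poly k}) (f : K) : Prop :=
  regular x (if x is Some _ then f else f / t ^+ n).

(* w stands for the rational form w dt; at infinity d(1/t) = - dt / t^2 *)
Definition Omega (x : option {poly k}) (w : K) : Prop :=
  regular x (if x is Some _ then w else w * t ^+ 2).

Definition Omega_log (D : seq (option {poly k})) (x : option {poly k}) (w : K) :
  Prop :=
  Omega x (if x \in D then (if x is Some q then q%:F else t^-1) * w else w).

(* stalks of the absolute Frobenius pullback of a line bundle L inside k(t);
   L_x is free of rank one, so that no sums are needed *)
Definition Frob_pull (p : nat) (L : option {poly k} -> K -> Prop)
    (x : option {poly k}) (g : K) : Prop :=
  exists c f, [/\ regular x c, L x f & g = c * f ^+ p].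

(* (O(1) + O, theta) with theta : O(1) -> O (x) Omega(log D), f |-> th f dt *)
Definition log_Higgs_field (D : seq (option {poly k})) (th : K) : Prop :=
  th != 0 /\
  forall x f, closed_point x -> O_ 1 x f -> Omega_log D x (th * f).

(* coker(theta) is supported exactly at a *)
Definition Higgs_zero (D : seq (option {poly k})) (th : K) (a : option k) : Prop :=
  forall x, closed_point x ->
    (forall w, Omega_log D x w -> exists2 f, O_ 1 x f & w = th * f)
    <-> x <> rat_point a.

(* the derivation d/dt of k(t) *)
Definition fderiv (f : K) : K :=
  let: (a, b) := frac (repr f) in (a^`() * b - a * b^`())%:F / (b ^+ 2)%:F.

(* the self-map of P^1 defined by a rational function *)
Definition ratmap (f : K) (a : option k) : option k :=
  let: (n, d) := frac (repr f) in
  let g := gcdp n d in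
  let n := n %/ g in
  let d := d %/ g in
  match a with
  | Some c => if root d c then None else Some (n.[c] / d.[c])
  | None => if (size d < size n)%N then None
            else Some (n`_(size d).-1 / lead_coef d)
  end.

End Curve.

Section InverseCartier.
Variables (p : nat) (k : fieldType) (charkp : p \in [pchar k]).
Local Notation W := (W2 charkp).
Local Notation K := {fraction {poly k}}.
Local Notation "q %:F" := (tofrac q).

Definition poly_res (q : {poly W}) : {poly k} := map_poly (@Wres p k charkp) q.

Definition nz_mod_p : {pred {poly W}} := fun q => poly_res q != 0.

Lemma nz_mod_p_mulr_closed : mulr_closed nz_mod_p.
Proof.
split=> [|x y]; rewrite !unfold_in /poly_res ?rmorph1 ?oner_eq0 // => x0 y0.
by rewrite rmorphM mulf_neq0.
Qed.
HB.instance Definition _ :=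
  GRing.isMulClosed.Build {poly W} nz_mod_p nz_mod_p_mulr_closed.

(* the local ring of P^1_{W_2(k)} at the generic point of its special fibre *)
Definition K2 := loc nz_mod_p.
HB.instance Definition _ := GRing.ComPzRing.on K2.

Definition K2_frac (a b : {poly W}) : K2 := loc_frac nz_mod_p a b.

(* reduction modulo p *)
Definition K2_res (f : K2) : K :=
  let: (a, b) := prefrac_val (repr f) in (poly_res a)%:F / (poly_res b)%:F.

(* the derivation d/dt over W_2(k) *)
Definition K2_deriv (f : K2) : K2 :=
  let: (a, b) := prefrac_val (repr f) in
  K2_frac (a^`() * b - a * b^`()) (b ^+ 2).

(* p K2 is isomorphic to K2 / p K2 = k(t), by p y |-> (y mod p) *)
Definition div_by_p (f : K2) : K :=
  xget 0 [set c | exists2 y : K2, f = y *+ p & c = K2_res y].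

(* Membership in the local ring of P^1_{W_2(k)} at x; at infinity the
   denominator must have invertible leading coefficient. *)
Definition K2_regular (x : option {poly k}) (f : K2) : Prop :=
  if x is Some q then exists a b : {poly W}, ~~ (q %| poly_res b) /\ f = K2_frac a b
  else exists a b : {poly W}, [/\ Wres (lead_coef b) != 0, (size a <= size b)%N
                     & f = K2_frac a b].

Variable lam : W.

(* the sections 0, 1, lam, infinity of P^1 over W_2(k) *)
Definition D2 : seq (option W) := [:: Some 0; Some 1; Some lam; None].

Definition reduction (d : option W) : option {poly k} :=
  rat_point (omap (@Wres p k charkp) d).

Definition D1 : seq (option {poly k}) := [seq reduction d | d <- D2].

(* local equation of a section of P^1 over W_2(k) *)
Definition local_eq (d : option W) : K2 :=
  if d is Some c then K2_frac ('X - c%:P) 1 else K2_frac 1 'X.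

(* Z is the finite set of closed points outside of an affine open subset U. An
   endomorphism of U that lifts the Frobenius is the identity on the underlying
   space, hence an endomorphism of the sheaf of local rings inside K2; it is
   automatically semilinear over W_2(k). *)
Definition log_Frobenius_lift (Z : seq (option {poly k}))
    (Phi : {rmorphism K2 -> K2}) : Prop :=
  [/\ forall f, K2_res (Phi f) = K2_res f ^+ p,
      forall x f, closed_point x -> x \notin Z ->
        K2_regular x f -> K2_regular x (Phi f)
    & forall d, d \in D2 -> reduction d \notin Z ->
        exists u v, [/\ K2_regular (reduction d) u, K2_regular (reduction d) v,
                        u * v = 1 & Phi (local_eq d) = u * local_eq d ^+ p]].

Definition log_Frobenius_cover (n : nat) (Z : 'I_n -> seq (option {poly k}))
    (Phi : 'I_n -> {rmorphism K2 -> K2}) : Prop :=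
  [/\ forall i, Z i != [::] /\ {in Z i, forall x, closed_point x},
      forall x, closed_point x -> exists i, x \notin Z i
    & forall i, log_Frobenius_lift (Z i) (Phi i)].

Section Glue.
Variables (n : nat) (Z : 'I_n -> seq (option {poly k})).
Variable Phi : 'I_n -> {rmorphism K2 -> K2}.
Variable th : K.
Local Notation t2 := (K2_frac 'X 1).

(* F^* theta = Frob_theta (x) F^* dt on F^*(O(1) + O) *)
Definition Frob_theta : 'M[K]_2 := th ^+ p *: delta_mx 1 0.

(* h_ij (F^* dt) *)
Definition Frob_diff (i j : 'I_n) : K := div_by_p (Phi i t2 - Phi j t2).

(* exp (h_ij (F^* theta)); Frob_theta has square zero *)
Definition gluing (i j : 'I_n) : 'M[K]_2 := 1%:M + Frob_diff i j *: Frob_theta.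

(* Stalk at x of the bundle V underlying C_1^{-1}(O(1) + O, theta): families of
   local sections of V_i = F^*(O(1) + O) on U_i that correspond to each other
   under the isomorphisms V_i -> V_j. *)
Definition V_ (x : option {poly k}) (s : 'I_n -> 'cV[K]_2) : Prop :=
  (forall i j, s j = gluing i j *m s i) /\
  (forall i, x \notin Z i ->
     Frob_pull p (@O_ k 1) x (s i 0 0) /\ Frob_pull p (@O_ k 0) x (s i 1 0)).

(* contraction with d/dt of the connection, on V_i; (dPhi_i / p)(F^* dt) is
   d(Phi_i t) / p *)
Definition nabla (s : 'I_n -> 'cV[K]_2) (i : 'I_n) : 'cV[K]_2 :=
  map_mx (@fderiv k) (s i)
  + div_by_p (K2_deriv (Phi i t2)) *: (Frob_theta *m s i).

Definition comb (v w : 'I_n -> 'cV[K]_2) (f g : K) (i : 'I_n) : 'cV[K]_2 :=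
  f *: v i + g *: w i.

(* (f, g) |-> f v + g w is an isomorphism O(m + 1) + O(m) -> V *)
Definition splitting (m : nat) (v w : 'I_n -> 'cV[K]_2) : Prop :=
  (forall f g, comb v w f g =1 (fun=> 0) -> f = 0 /\ g = 0) /\
  (forall x s, closed_point x ->
     V_ x s <-> exists f g, [/\ O_ m.+1 x f, O_ m x g & s =1 comb v w f g]).

(* Gr(nabla) : O(m + 1) -> (V / O(m + 1)) (x) Omega(log D), read through
   V / O(m + 1) = O(m), is f |-> th' f dt. As m = (p - 1) / 2, this is also the
   Higgs field of Gr(V, nabla) (x) O((1 - p) / 2) = (O(1) + O, th'). *)
Definition graded_Higgs_field (th' : K) : Prop :=
  exists v w, splitting p.-1./2 v w /\
    forall f, exists g, nabla (comb v w f 0) =1 comb v w g (th' * f).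

End Glue.

(* graph of the self-map of P^1 induced by the Higgs-de Rham flow *)
Definition HdR_selfmap (a b : option k) : Prop :=
  exists (th th' : K) (n : nat) (Z : 'I_n -> seq (option {poly k}))
         (Phi : 'I_n -> {rmorphism K2 -> K2}),
    [/\ log_Higgs_field D1 th /\ Higgs_zero D1 th a,
        log_Frobenius_cover Z Phi,
        graded_Higgs_field Z Phi th th'
      & log_Higgs_field D1 th' /\ Higgs_zero D1 th' b].

End InverseCartier.

(* delta_n, a rational function of the variable a *)
Definition delta (p : nat) (k : fieldType) (l : k) (n : nat) : {fraction {poly k}} :=
  let a : {fraction {poly k}} := tofrac 'X in
  let l : {fraction {poly k}} := tofrac l%:P in
  (l ^+ p * (1 - a ^+ p) - (l ^+ p - a ^+ p) * l ^+ n) / n%:R.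

(* Main.v *)
(* The trivialization of V attached to t |-> t^p differs from that of a logarithmic lift
   Phi by the gap (Phi t - t^p) / p, and near a point c of D the gap of Phi agrees with
   that of t |-> (t - c)^p + sigma(c) up to a multiple of (t - c)^p. Hence a global section
   of V(-n) is a pair (f, h / ((t - 1) (t - lambda))^p) of polynomials f, h of bounded
   degree, subject to one congruence modulo (t - 1)^p and one modulo (t - lambda)^p.
   Eliminating h leaves the vanishing of some coefficients of S f, where S combines the two
   gap polynomials. For n = m + 1 this is the linear system A f = 0 in the m + 1
   coefficients of f; its kernel is a line, spanned by the signed maximal minors of A.
   With L = theta t (t - 1) (t - lambda), the numerator t (f h' - f' h) + L^p f^2 of the
   second fundamental form is divisible by ((t - 1) (t - lambda))^(p-1); the remaining
   linear factor is read off from the extreme coefficients of f, and vanishes at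
   a^p f_0^2 / (lambda^(p-1) f_m^2). *)
Require Import Defs.
From HB Require Import structures.
From mathcomp Require Import all_boot all_order all_algebra perm.
From mathcomp Require Import boolp classical_sets.
From mathcomp Require Import zify ring.

Set Implicit Arguments.
Unset Strict Implicit.
Unset Printing Implicit Defensive.

Import GRing.Theory.
Local Open Scope quotient_scope.
Local Open Scope ring_scope.

(* [lia] slows down with the number of hypotheses that it has to discard, and does
   not identify sizes of the same polynomial read through different coercions. *)
Ltac nat_lia :=
  repeat match goal with
  | H : ?P |- _ =>
    lazymatch type of P with
    | Prop =>
      lazymatch P with
      | is_true (leq _ _) => fail
      | is_true (andb _ _) => fail
      | is_true (negb _) => fail
      | @eq nat _ _ => fail
      | _ => clear H
      end
    end
  end;
  repeat match goal with
  | H : ?P |- _ => lazymatch type of P with Prop => revert H end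
  end;
  repeat match goal with
  | |- context [@size ?T (@polyseq ?R ?q)] =>
    let x := fresh "sz" in set x := (@size T (@polyseq R q)); move: x => x
  end; lia.

(** The self-map is defined through arbitrary covers and lifts, the formula through none. The gluing
    cocycle is the coboundary of the gaps, so at the generic point there is one frame common to all
    charts, in which the connection form is [t^(p-1) th^p dt] whatever the lifts are. A cover then
    enters only through local conditions on two rational functions, and these amount to the same
    congruences for every cover. Beyond its reduction, lambda occurs only in the constant terms of
    the gap polynomials, which do not reach the coefficients entering A.

    The quotient of minors can be evaluated at a point only if the minors do not make numerator and
    denominator vanish together there, and V splits as required only if the kernel of A is a line
    with a complementary section of V(-m). Neither is formal linear algebra. Both rest on two facts:
    the second fundamental form of a nonzero section is nonzero, as a derivative in characteristic p
    has no component along t^(p-1); and two sections with opposite end coefficients zero would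
    violate a parity of degrees. Homogeneous coordinates [a0, a1] put infinity on the same footing
    as the other points. *)

Lemma coefM_top (k : nzRingType) (f h : {poly k}) a b : (size f <= a.+1)%N -> (size h <= b.+1)%N ->
  (f * h)`_(a + b) = f`_a * h`_b.
Proof.
move=> fa hb; have ab : (a < (a + b).+1)%N by rewrite ltnS leq_addr.
rewrite coefM (bigD1 (Ordinal ab)) //= addKn big1 ?addr0 // => i ia.
have [ltia | leai] := ltnP i a.
  by rewrite [h`__]nth_default ?mulr0 // (leq_trans hb) //; nat_lia.
rewrite nth_default ?mul0r // (leq_trans fa) // ltn_neqAle leai andbT.
by apply: contra ia => /eqP e; apply/eqP/val_inj.
Qed.

Lemma mulmx_lift (k : fieldType) m (A : 'M[k]_(m, m.+1)) (c : 'I_m.+1) (u : 'cV_m) :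
  A *m (\col_j (if unlift c j is Some j' then u j' 0 else 0)) = col' c A *m u.
Proof.
apply/matrixP => i j; rewrite !mxE (bigD1_ord c) //= mxE unlift_none mulr0 add0r.
by apply: eq_bigr => j' _; rewrite !mxE liftK ord1.
Qed.

(** Repeating row i on top of A gives a square matrix with two equal rows; entry i of the product is
    the expansion of its determinant along the top row. *)
Lemma mul_minors (k : fieldType) m (A : 'M[k]_(m, m.+1)) : A *m (\col_j ((-1) ^+ j * \det (col' j A))) = 0.
Proof.
apply/matrixP => i j; rewrite mxE mxE.
pose B : 'M[k]_m.+1 := \matrix_(r, c) if unlift ord0 r is Some r' then A r' c else A i c.
have : \det B = 0.
  apply: (determinant_alternate (i1 := ord0) (i2 := lift ord0 i)) => // c.
  by rewrite !mxE unlift_none liftK.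
rewrite (expand_det_row _ ord0) => E; rewrite -[RHS]E; apply: eq_bigr => c _.
rewrite !mxE unlift_none /cofactor add0n; congr (_ * (_ * \det _)).
by apply/matrixP => r s; rewrite !mxE liftK.
Qed.

(** * Gap polynomials in characteristic p *)

Section Pchar.
Variables (p : nat) (k : fieldType) (charkp : p \in [pchar k]).
Let pp : prime p := pcharf_prime charkp.
Implicit Types (c x y : k) (P Q : {poly k}).

Lemma pchar_odd : (3 <= p)%N -> odd p.
Proof. by have [-> //|//] := even_prime pp. Qed.

Lemma pchar_half : (3 <= p)%N -> p = p.-1./2.*2.+1.
Proof.
by move=> /pchar_odd op; have := odd_double_half p; rewrite op; lia.
Qed.

Lemma pchar_pnat : [pchar {poly k}].-nat p.
Proof. by rewrite (eq_pnat _ (pchar_poly k)) pnatE. Qed.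

Lemma natr_lt_neq0 n : (0 < n < p)%N -> n%:R != 0 :> k.
Proof. by case/andP=> n0 np; rewrite -(dvdn_pcharf charkp) gtnNdvd. Qed.

Lemma XsubC_expp c : ('X - c%:P) ^+ p = 'X^p - (c ^+ p)%:P.
Proof.
by rewrite exprDn_pchar ?pchar_pnat // exprNn_pchar ?pchar_pnat // rmorphXn.
Qed.

Lemma deriv_expp P : (P ^+ p)^`() = 0.
Proof.
by rewrite deriv_exp -mulr_natr (pcharf0 (etrans (pchar_poly k p) charkp)) mulr0.
Qed.

Lemma derivXp : ('X^p : {poly k})^`() = 0.
Proof. exact: deriv_expp. Qed.

Lemma XsubC_exp_pred c :
  \sum_(i < p.-1.+1) 'X^(p.-1 - i) * (c ^+ i)%:P = ('X - c%:P) ^+ p.-1.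
Proof.
have p0 := prime_gt0 pp.
have cN0 : 'X - c%:P != 0 by rewrite polyXsubC_eq0.
apply: (mulfI cN0); rewrite -exprS !prednK // XsubC_expp rmorphXn /= subrXX.
by congr (_ * _); apply: eq_bigr => i _; rewrite rmorphXn.
Qed.

(* [((t - c)^p + sigma(c) - t^p) / p] modulo [p], where [sigma(c) = c^p + p d]:
   the discrepancy between the Frobenius lifts [t |-> t^p] and
   [t |-> (t - c)^p + sigma(c)]. *)
Definition Frob_gap c d : {poly k} :=
  \sum_(1 <= j < p) (c ^+ (p - j) / j%:R) *: 'X^j + d%:P.

Lemma coef_Frob_gap c d j :
  (0 < j < p)%N -> (Frob_gap c d)`_j = c ^+ (p - j) / j%:R.
Proof.
move=> /andP[j0 jp]; rewrite /Frob_gap coefD coefC gtn_eqF // addr0 coef_sum.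
rewrite (bigD1_seq j) /= ?iota_uniq ?mem_index_iota ?j0 //.
rewrite coefZ coefXn eqxx mulr1 big1 ?addr0 // => i ij.
by rewrite coefZ coefXn eq_sym (negbTE ij) mulr0.
Qed.

Lemma size_Frob_gap c d : (size (Frob_gap c d) <= p)%N.
Proof.
have p0 := prime_gt0 pp.
apply/leq_sizeP => j jp; rewrite /Frob_gap coefD coefC gtn_eqF ?(leq_trans p0) //.
rewrite addr0 coef_sum big_nat big1 // => i /andP[_ ip].
by rewrite coefZ coefXn gtn_eqF ?mulr0 // (leq_trans ip).
Qed.

Lemma Frob_gap0 : Frob_gap 0 0 = 0.
Proof.
rewrite /Frob_gap addr0 big_nat big1 // => j /andP[_ jp].
by rewrite expr0n subn_eq0 leqNgt jp mul0r scale0r.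
Qed.

(** Dividing the derivative of (t - c)^p + sigma(c) by p gives t^(p-1) + G' = (t - c)^(p-1), where G
    is the gap; the identity is this one multiplied by t = c + (t - c). *)
Lemma deriv_Frob_gap c d :
  'X * (Frob_gap c d)^`() + 'X^p = c *: ('X - c%:P) ^+ p.-1 + ('X - c%:P) ^+ p.
Proof.
have p0 := prime_gt0 pp.
rewrite /Frob_gap derivD derivC addr0 raddf_sum /= mulr_sumr.
rewrite XsubC_expp -XsubC_exp_pred scaler_sumr [RHS]addrCA [LHS]addrC; congr (_ + _).
rewrite big_ord_recr /= subnn expr0 mul1r.
rewrite -mul_polyC -rmorphM /= -exprS prednK // addrK.
rewrite -[p in LHS](prednK p0) big_add1 /= big_mkord (reindex_inj rev_ord_inj) /=.
apply: eq_bigr => i _.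
have ip : (0 < p.-1 - i < p)%N by have := ltn_ord i; lia.
have -> : (p.-1 - i.+1).+1 = (p.-1 - i)%N by have := ltn_ord i; lia.
rewrite derivZ derivXn -scalerAr mulrnAr -exprS.
have -> : (p.-1.+1 - (p.-1 - i) = i.+1)%N by have := ltn_ord i; lia.
rewrite -scaler_nat scalerA divfK ?natr_lt_neq0 //.
rewrite prednK; last by case/andP: ip.
by rewrite [_ * _%:P]mulrC mul_polyC scalerA exprS.
Qed.

End Pchar.

(** * Global sections and the linear system *)

Section Sections.
Variables (p : nat) (k : fieldType) (charkp : p \in [pchar k]).
Hypothesis p_ge3 : (3 <= p)%N.
Let pp : prime p := pcharf_prime charkp.
Variables (l d1 dl al0 al1 : k).
Hypotheses (l_neq0 : l != 0) (l_neq1 : l != 1).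
Hypothesis al_neq0 : (al0 != 0) || (al1 != 0).
Implicit Types f h Q : {poly k}.

Let m := p.-1./2.
Let p2m : p = m.*2.+1 := pchar_half charkp p_ge3.

Local Notation G1 := (Frob_gap p 1 d1).
Local Notation Gl := (Frob_gap p l dl).
Local Notation T1 := (('X - 1%:P) ^+ p : {poly k}).
Local Notation Tl := (('X - l%:P) ^+ p : {poly k}).

(* the p-th power of the numerator [a1 t - a0] of the Higgs field, [al_i = a_i^p] *)
Definition Lp : {poly k} := al1 *: 'X^p - al0%:P.

(* In the coordinates of the chart [t |-> t^p], a global section of V(-n) is
   [(f, h / ((t - 1)^p (t - l)^p))]; the two divisibilities express regularity at
   1 and l, the size bounds the order at infinity. *)
Definition Vsect n f h := [/\ (size f + n <= p.+1)%N, (size h + n <= p.*2.+1)%N,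
  T1 %| 'X^p * h - Lp * G1 * f & Tl %| 'X^p * h - Lp * Gl * f].

Lemma deriv_Lp : Lp^`() = 0.
Proof. by rewrite derivB derivC derivZ (derivXp charkp) scaler0 subr0. Qed.

Lemma T1E : T1 = 'X^p - 1.
Proof. by rewrite XsubC_expp // expr1n. Qed.
Lemma TlE : Tl = 'X^p - (l ^+ p)%:P.
Proof. exact: XsubC_expp. Qed.

Lemma lp_neq1 : l ^+ p != 1.
Proof.
apply: contra l_neq1 => /eqP e; apply/eqP/(fmorph_inj (pFrobenius_aut charkp)).
by rewrite /= !pFrobenius_autE expr1n.
Qed.

Lemma coprime_T : coprimep T1 Tl.
Proof.
apply: coprimep_expl; apply: coprimep_expr; rewrite coprimep_XsubC rootE hornerXsubC.
by rewrite subr_eq0.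
Qed.

Lemma coprime_XT (c : k) n : c != 0 -> coprimep (('X - c%:P) ^+ n) 'X^p.
Proof.
move=> c0; apply: coprimep_expl; apply: coprimep_expr.
by rewrite coprimep_sym coprimep_XsubC rootE hornerX.
Qed.

(* Modulo (t - 1)^p (t - l)^p the congruences of [Vsect] say that h = t^p [Sgap] f up to
   terms of low degree, so that [Sgap * f] gives the top coefficients of h. *)
Definition be1 := (al1 - al0) / (1 - l ^+ p).
Definition bel := (al1 * l ^+ p - al0) / (l ^+ p * (l ^+ p - 1)).
Definition Sgap : {poly k} := be1 *: G1 + bel *: Gl.

(** The homogenization of [delta], with [al0 = a0^p] and [al1 = a1^p], so that the point at infinity
    is allowed. *)
Definition Hdelta n : k :=
  (l ^+ p * (al1 - al0) - (al1 * l ^+ p - al0) * l ^+ n) / n%:R.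

(** The origin of delta_n: the gap at c has the coefficient c^n / (p - n) = - c^n / n at t^(p-n),
    and [Sgap] combines those for c = 1 and c = l. *)
Lemma coef_Sgap n : (0 < n < p)%N ->
  Sgap`_(p - n) = (l ^+ p * (l ^+ p - 1))^-1 * Hdelta n.
Proof.
move=> n0; have jp : (0 < p - n < p)%N by nat_lia.
have lp1 := lp_neq1; have lp0 : l ^+ p != 0 by rewrite expf_neq0.
rewrite coefD !coefZ !coef_Frob_gap // subKn; last by nat_lia.
have -> : (p - n)%:R = - n%:R :> k.
  by rewrite natrB; [rewrite (pcharf0 charkp) sub0r | nat_lia].
rewrite expr1n /be1 /bel /Hdelta.
have nN0 : n%:R != 0 :> k by apply: natr_lt_neq0 charkp _ _.
have h1 : l ^+ p - 1 != 0 by rewrite subr_eq0.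
have h2 : 1 - l ^+ p != 0 by rewrite subr_eq0 eq_sym.
by field; rewrite h1 h2 lp0 oppr_eq0 nN0.
Qed.

Lemma size_Sgap : (size Sgap <= p)%N.
Proof.
rewrite (leq_trans (size_polyD _ _)) // geq_max.
by rewrite !(leq_trans (size_scale_leq _ _)) ?size_Frob_gap.
Qed.

(** Here [T + x] stands for t^p, [T + c] for the other pole polynomial and [a *: T + d] for [Lp]:
    modulo [T] each of them is a constant. *)
Lemma dvdp_congr (T G f u : {poly k}) (x c b a d : k) : x * c * b = d ->
  T %| (T + x%:P) * ((T + c%:P) * (b *: G) * f + T * u) - (a *: T + d%:P) * G * f.
Proof.
move=> <-; apply/dvdpP.
exists ((T + c%:P) * (b *: G) * f + (T + x%:P) * u + (x * b) *: (G * f) - a *: (G * f)).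
by rewrite -!mul_polyC !rmorphM /=; ring.
Qed.

(** The Chinese remainder solution of the two congruences of [Vsect], up to the free multiple [Q] of
    the product of the moduli. With s = t^p, the constants [be1] and [bel] are the residues of [Lp]
    / (s (s - 1) (s - l^p)) at s = 1 and s = l^p. *)
Definition sect_num f Q : {poly k} :=
  Tl * (be1 *: G1) * f + T1 * (bel *: Gl) * f - Q * (T1 * Tl).

(** After expanding [T1 = t^p - 1] and [Tl = t^p - l^p], only t^p [Sgap] f and t^(2p) Q reach the
    degrees from 2p - n on. *)
Lemma coef_sect_num n f Q j : (size f + n <= p.+1)%N -> (n <= p)%N ->
    (size Q <= p - n)%N -> (p.*2 - n <= j)%N ->
  (sect_num f Q)`_j = (Sgap * f)`_(j - p) - (if (j < p.*2)%N then 0 else Q`_(j - p.*2)).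
Proof.
move=> fn np szQ nj; have p0 : (0 < p)%N by nat_lia.
pose B : {poly k} := (l ^+ p * be1) *: G1 + bel *: Gl.
have -> : sect_num f Q = 'X^p * (Sgap * f) - B * f - Q * ('X^p * 'X^p)
               + (1 + l ^+ p) *: ('X^p * Q) - l ^+ p *: Q.
  rewrite /sect_num T1E TlE /B /Sgap -!mul_polyC !(rmorphM, rmorphD, rmorph1) /=; ring.
have szB : (size (B * f)%R <= p.*2 - n)%N.
  have : (size B <= p)%N.
    rewrite (leq_trans (size_polyD _ _)) // geq_max.
    by rewrite !(leq_trans (size_scale_leq _ _)) ?size_Frob_gap.
  by have := size_polyMleq B f; nat_lia.
rewrite !(coefD, coefB, coefZ) -exprD !coefN coefMXn !(coefXnM, coefZ).
rewrite (nth_default _ (leq_trans szB nj)) subr0.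
rewrite [Q`_j]nth_default; last by apply: leq_trans szQ _; nat_lia.
rewrite [Q`_(j - p)]nth_default; last by apply: leq_trans szQ _; nat_lia.
have -> : (j < p)%N = false by nat_lia.
by rewrite !mulr0 addr0 subr0 addnn.
Qed.

Lemma sect_num_congr f Q :
  T1 %| 'X^p * sect_num f Q - Lp * G1 * f /\ Tl %| 'X^p * sect_num f Q - Lp * Gl * f.
Proof.
have lp1 := lp_neq1; have lp0 : l ^+ p != 0 by rewrite expf_neq0.
split.
- have -> : 'X^p = T1 + 1%:P by rewrite T1E subrK.
  have -> : Lp = al1 *: T1 + (al1 - al0)%:P.
    by rewrite /Lp T1E -!mul_polyC !rmorphB /=; ring.
  have -> : sect_num f Q = (T1 + (1 - l ^+ p)%:P) * (be1 *: G1) * f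
                + T1 * (bel *: Gl * f - Q * Tl).
    by rewrite /sect_num T1E TlE rmorphB /=; ring.
  apply: dvdp_congr; rewrite mul1r mulrC divfK //.
  by rewrite subr_eq0 eq_sym.
- have -> : 'X^p = Tl + (l ^+ p)%:P by rewrite TlE subrK.
  have -> : Lp = al1 *: Tl + (al1 * l ^+ p - al0)%:P.
    by rewrite /Lp TlE -!mul_polyC !(rmorphB, rmorphM) /=; ring.
  have -> : sect_num f Q = (Tl + (l ^+ p - 1)%:P) * (bel *: Gl) * f
                + Tl * (be1 *: G1 * f - Q * T1).
    by rewrite /sect_num T1E TlE rmorphB /=; ring.
  apply: dvdp_congr; rewrite mulrC divfK //.
  by rewrite mulf_neq0 // subr_eq0.
Qed.

Lemma Vsect_exists n f : (n <= p)%N -> (size f + n <= p.+1)%N ->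
    (forall i, (0 < i < n)%N -> (Sgap * f)`_(p - i) = 0) ->
  exists h, Vsect n f h.
Proof.
(* This [Q] cancels the coefficients of degree 2p and more. Those still above the degree bound 2p -
   n have degree 2p - i with 0 < i < n, and the hypothesis kills them. *)
move=> np fn Sf0; pose Q := drop_poly p (Sgap * f).
have szQ : (size Q <= p - n)%N.
  by rewrite size_drop_poly; have := size_polyMleq Sgap f; have := size_Sgap; nat_lia.
have [c1 cl] := sect_num_congr f Q.
exists (sect_num f Q); split=> //.
suff : (size (sect_num f Q) <= p.*2.+1 - n)%N by nat_lia.
apply/leq_sizeP => j nj; rewrite (coef_sect_num fn) //; last by nat_lia.
case: ltnP => jp; last first.
  rewrite coef_drop_poly; have -> : (j - p.*2 + p = j - p)%N by nat_lia.
  by rewrite subrr.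
have -> : (j - p = p - (p.*2 - j))%N by nat_lia.
by rewrite Sf0 ?subr0 //; nat_lia.
Qed.

Lemma dvdp_TT (u : {poly k}) : T1 %| 'X^p * u -> Tl %| 'X^p * u -> T1 * Tl %| u.
Proof.
rewrite !Gauss_dvdpr ?coprime_XT // ?oner_neq0 // => u1 ul.
by rewrite Gauss_dvdp ?coprime_T // u1.
Qed.

Lemma size_TTM (u : {poly k}) : u != 0 -> size (u * (T1 * Tl)) = (size u + p.*2)%N.
Proof.
move=> u0; rewrite !size_Mmonic // ?mulf_neq0 ?monic_neq0 //;
  rewrite ?rpredM ?rpredX ?monicXsubC // !size_exp_XsubC; nat_lia.
Qed.

(** The congruences determine h modulo [T1 * Tl], so h is some [sect_num f Q]. The size of h bounds
    that of [Q], whose lower terms then stay below the coefficients in question. *)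
Lemma Vsect_coef n f h i : (n <= p)%N -> Vsect n f h -> (0 < i <= n)%N ->
  h`_(p.*2 - i) = (Sgap * f)`_(p - i).
Proof.
move=> np [fn hn c1 cl] i0; have p0 : (0 < p)%N by nat_lia.
have [e1 el] := sect_num_congr f 0.
have /dvdpP[Q hQ] : T1 * Tl %| sect_num f 0 - h.
  apply: dvdp_TT; [have := dvdp_sub e1 c1 | have := dvdp_sub el cl];
    congr (is_true (_ %| _)); ring.
have hE : h = sect_num f Q.
  by rewrite -[LHS](subKr (sect_num f 0)) hQ /sect_num mul0r subr0.
have szQ : (size Q <= p - n)%N.
  have [->|Q0] := eqVneq Q 0; first by rewrite size_poly0.
  have : (size (sect_num f 0 - h)%R <= p * 3 - n)%N.
    rewrite (leq_trans (size_polyD _ _)) // size_polyN geq_max.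
    have hn' : (size h <= p * 3 - n)%N by nat_lia.
    apply/andP; split; last exact: hn'.
    have sz (c : k) (q : {poly k}) : (size q <= p)%N -> (size (('X - c%:P) ^+ p * q * f)%R <= p * 3 - n)%N.
      move=> qp; have := size_polyMleq (('X - c%:P) ^+ p * q) f.
      have := size_polyMleq (('X - c%:P) ^+ p) q; rewrite size_exp_XsubC; nat_lia.
    rewrite /sect_num mul0r subr0 (leq_trans (size_polyD _ _)) // geq_max.
    by rewrite !sz // (leq_trans (size_scale_leq _ _)) ?size_Frob_gap.
  by rewrite hQ size_TTM //; nat_lia.
rewrite hE (coef_sect_num fn) //; last by nat_lia.
have -> : (p.*2 - i < p.*2)%N by nat_lia.
by rewrite subr0; congr nth; nat_lia.
Qed.

(** Modulo either pole polynomial, h and h' are the same multiple of f and f'. The quotient is a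
    section of det V twisted by -n - n', that is of O(p - n - n'): it vanishes for n + n' = p + 1
    and is constant for n + n' = p. *)
Lemma wedge_dvdp n f h n' f' h' : Vsect n f h -> Vsect n' f' h' ->
  T1 * Tl %| f * h' - f' * h.
Proof.
move=> [_ _ c1 cl] [_ _ c1' cl'].
have E G : 'X^p * (f * h' - f' * h) =
    f * ('X^p * h' - Lp * G * f') - f' * ('X^p * h - Lp * G * f) by ring.
by apply: dvdp_TT; [rewrite (E G1) | rewrite (E Gl)]; rewrite dvdp_sub // dvdp_mull.
Qed.

Lemma size_wedge n f h n' f' h' : Vsect n f h -> Vsect n' f' h' ->
  (size (f * h' - f' * h)%R + (n + n') <= p * 3 + 1)%N.
Proof.
move=> [fn hn _ _] [fn' hn' _ _].
have := size_polyD (f * h') (- (f' * h)); rewrite size_polyN.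
have := size_polyMleq f h'; have := size_polyMleq f' h; nat_lia.
Qed.

Lemma wedge_eq0 n f h n' f' h' : Vsect n f h -> Vsect n' f' h' -> (n + n' = p.+1)%N ->
  f * h' = f' * h.
Proof.
move=> V V' nn; have /dvdpP[u hu] := wedge_dvdp V V'.
apply/eqP; rewrite -subr_eq0 hu; have [-> | u0] := eqVneq u 0; first by rewrite mul0r.
have := size_wedge V V'; rewrite hu size_TTM //.
by have : (0 < size u)%N by [rewrite size_poly_gt0]; nat_lia.
Qed.

Lemma wedge_const n f h n' f' h' : Vsect n f h -> Vsect n' f' h' -> (n + n' = p)%N ->
  exists e, f * h' - f' * h = e *: (T1 * Tl).
Proof.
move=> V V' nn; have /dvdpP[u hu] := wedge_dvdp V V'.
have [u0 | u0] := eqVneq u 0; first by exists 0; rewrite hu u0 mul0r scale0r.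
exists u`_0; rewrite hu -mul_polyC -size1_polyC //.
by have := size_wedge V V'; rewrite hu size_TTM //; nat_lia.
Qed.

(* [t ((t - 1) (t - l))^p] times the second fundamental form of [f, h] *)
Definition Omega_num f h : {poly k} := 'X * (f * h^`() - f^`() * h) + Lp * f ^+ 2.

(** The connection has only a logarithmic pole at c. Differentiating the congruence, where t^p, [Lp]
    and (t - c)^p are constants for the derivation, the undifferentiated gap cancels in the wedge.
    There remain a multiple of (t - c)^p and [Lp] f^2 (t G' + t^p), to which [deriv_Frob_gap]
    applies. *)
Lemma Omega_dvdp c d f h : c != 0 -> ('X - c%:P) ^+ p %| 'X^p * h - Lp * Frob_gap p c d * f ->
  ('X - c%:P) ^+ p.-1 %| Omega_num f h.
Proof.
move=> c0 /dvdpP[u hu].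
have h1 : 'X^p * h = Lp * Frob_gap p c d * f + u * ('X - c%:P) ^+ p by rewrite -hu addrC subrK.
rewrite -(Gauss_dvdpr _ (coprime_XT p.-1 c0)).
have h2 : 'X^p * h^`() = Lp * (Frob_gap p c d)^`() * f + Lp * Frob_gap p c d * f^`()
                         + u^`() * ('X - c%:P) ^+ p.
  have := congr1 (@deriv k) h1.
  rewrite derivM (derivXp charkp) mul0r add0r derivD derivM [(Lp * _)^`()]derivM.
  by rewrite deriv_Lp mul0r add0r derivM (deriv_expp charkp) mulr0 addr0.
have p0 : (0 < p)%N by nat_lia.
have h3 := deriv_Frob_gap charkp c d.
set Y := ('X - c%:P) ^+ p.-1 in h3 *.
have TE : ('X - c%:P) ^+ p = Y * ('X - c%:P) by rewrite -exprSr prednK.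
apply/dvdpP; exists (Lp * f ^+ 2 * (c%:P + ('X - c%:P)) + 'X * ('X - c%:P) * (f * u^`() - f^`() * u)).
transitivity ('X * (f * ('X^p * h^`()) - f^`() * ('X^p * h)) + 'X^p * Lp * f ^+ 2).
  by rewrite /Omega_num; ring.
transitivity (Lp * f ^+ 2 * ('X * (Frob_gap p c d)^`() + 'X^p)
              + 'X * ('X - c%:P) ^+ p * (f * u^`() - f^`() * u)).
  by rewrite h1 h2; ring.
by rewrite h3 -mul_polyC TE; ring.
Qed.

Lemma Omega_numE f h : Vsect m.+1 f h ->
  Omega_num f h = (('X - 1%:P) * ('X - l%:P)) ^+ p.-1 *
     ((al1 * f`_m ^+ 2) *: 'X - (al0 * f`_0 ^+ 2 / l ^+ p.-1)%:P).
Proof.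
move=> [fm hm c1 cl]; have p0 : (0 < p)%N by nat_lia.
have D1 := Omega_dvdp (oner_neq0 _) c1; have Dl := Omega_dvdp l_neq0 cl.
have cop : coprimep (('X - 1%:P) ^+ p.-1) (('X - l%:P) ^+ p.-1).
  apply: coprimep_expl; apply: coprimep_expr; rewrite coprimep_XsubC rootE hornerXsubC.
  by rewrite subr_eq0.
have : ('X - 1%:P) ^+ p.-1 * ('X - l%:P) ^+ p.-1 %| Omega_num f h.
  by rewrite Gauss_dvdp // D1.
rewrite -exprMn => /dvdpP[R]; rewrite mulrC; set Y := _ ^+ p.-1 => hR.
have mY : Y \is monic by rewrite rpredX ?rpredM ?monicXsubC.
have szY : size Y = p.*2.-1.
  by rewrite /Y exprMn size_Mmonic ?expf_neq0 ?polyXsubC_eq0 ?rpredX ?monicXsubC //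
    !size_exp_XsubC; nat_lia.
have szf : (size f <= m.+1)%N by nat_lia.
have szh : (size h <= (p.*2 - m.+1).+1)%N by nat_lia.
have szf' : (size f^`() <= m.-1.+1)%N.
  by apply/leq_sizeP => j mj; rewrite coef_deriv nth_default ?mul0rn //; nat_lia.
have szh' : (size h^`() <= (p.*2 - m.+2).+1)%N.
  by apply/leq_sizeP => j mj; rewrite coef_deriv nth_default ?mul0rn //; nat_lia.
have szL : (size Lp <= p.+1)%N.
  rewrite (leq_trans (size_polyD _ _)) // geq_max size_polyN.
  by rewrite (leq_trans (size_scale_leq _ _)) ?size_polyXn // (leq_trans (size_polyC_leq1 _)).
have top : (Omega_num f h)`_(p.*2.-1) = al1 * f`_m ^+ 2.
  rewrite /Omega_num coefD coefXM coefB.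
  have -> : (p.*2.-1 == 0)%N = false by nat_lia.
  have -> : (p.*2.-1.-1 = m + (p.*2 - m.+2))%N by nat_lia.
  rewrite coefM_top //.
  have -> : (m + (p.*2 - m.+2) = m.-1 + (p.*2 - m.+1))%N by nat_lia.
  rewrite coefM_top // !coef_deriv.
  have -> : ((p.*2 - m.+2).+1 = p.*2 - m.+1)%N by nat_lia.
  have -> : (m.-1.+1 = m)%N by nat_lia.
  have -> : (p.*2.-1 = p + (m + m))%N by nat_lia.
  rewrite coefM_top //; last first.
    by rewrite expr2; have := size_polyMleq f f; nat_lia.
  rewrite expr2 coefM_top // !coefB coefZ coefXn eqxx coefC.
  have -> : (p == 0)%N = false by nat_lia.
  (* The top degrees m of f and m + p of h agree modulo p, so the Wronskian part loses its top
     coefficient and only [Lp] f^2 contributes. *)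
  have -> : (p.*2 - m.+1 = m + p)%N by nat_lia.
  rewrite subr0 mulr1 -mulr_natl natrD (pcharf0 charkp) addr0; ring.
have szO : (size (Omega_num f h) <= p.*2)%N.
  rewrite (leq_trans (size_polyD _ _)) // geq_max; apply/andP; split; last first.
    rewrite (leq_trans (size_polyMleq _ _)) // expr2.
    by have := size_polyMleq f f; nat_lia.
  rewrite mulrC (leq_trans (size_polyMleq _ _)) // size_polyX addn2 /=.
  have : (size (f * h^`() - f^`() * h)%R <= p.*2.-1)%N; last by nat_lia.
  rewrite (leq_trans (size_polyD _ _)) // size_polyN geq_max.
  by apply/andP; split; rewrite (leq_trans (size_polyMleq _ _)) //; nat_lia.
have szR : (size R <= 2)%N.
  have [->|R0] := eqVneq R 0; first by rewrite size_poly0.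
  by move: szO; rewrite hR size_monicM // szY; nat_lia.
rewrite hR; congr (_ * _); apply/polyP => i.
rewrite coefB coefZ coefX coefC; case: i => [|[|i]] /=.
- rewrite mulr0 sub0r.
  (* The denominator l^(p-1) of the formula is the value at 0 of ((t - 1) (t - l))^(p-1). *)
  have lN : l ^+ p.-1 != 0 by rewrite expf_neq0.
  have YE : Y.[0] = l ^+ p.-1.
    by rewrite /Y horner_exp hornerM !hornerXsubC !sub0r mulN1r opprK.
  have OE : (Omega_num f h).[0] = - (al0 * f`_0 ^+ 2).
    have LE : Lp.[0] = - al0.
      rewrite /Lp hornerD hornerN hornerC hornerZ hornerXn expr0n.
      have -> : (p == 0)%N = false by nat_lia.
      by rewrite mulr0 sub0r.
    rewrite hornerD hornerM hornerX mul0r add0r hornerM LE.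
    by rewrite horner_exp horner_coef0 mulNr.
  move: OE; rewrite hR hornerM YE horner_coef0 => OE.
  by apply: (mulfI lN); rewrite OE mulrN; congr (- _); rewrite [RHS]mulrC divfK.
- rewrite mulr1 subr0 -top hR.
  have -> : (p.*2.-1 = p.*2.-2 + 1)%N by nat_lia.
  rewrite coefM_top ?szY //; last by nat_lia.
  by have := monicP mY; rewrite lead_coefE szY => ->; rewrite mul1r.
- by rewrite mulr0 subr0 nth_default // (leq_trans szR).
Qed.

Lemma Lp_neq0 : Lp != 0.
Proof.
have p0 : (0 < p)%N by nat_lia.
apply: contraTneq al_neq0 => L0; rewrite negb_or !negbK.
have := congr1 (fun q : {poly k} => q`_p) L0; have := congr1 (fun q : {poly k} => q`_0) L0.
rewrite !(coefB, coefZ, coefC, coefXn, coef0) /= eqxx mulr1 (gtn_eqF p0) eq_sym (gtn_eqF p0).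
by rewrite mulr0 sub0r subr0 => /eqP; rewrite oppr_eq0 => -> ->; rewrite eqxx.
Qed.

(* [(h / f)' = - t^(p-1) Lp] up to p-th powers is impossible since derivatives have no
   component along [t^(p-1)]. *)
Lemma Omega_num_neq0 f h : f != 0 -> Omega_num f h != 0.
Proof.
(* [g] is h / f times f^p. As f^p is a constant for the derivation, the relation for (h / f)'
   becomes one between polynomials. *)
move=> f0; apply/eqP => O0; pose g := h * f ^+ p.-1.
have p0 : (0 < p)%N by nat_lia.
have E : 'X * g^`() = - (Lp * f ^+ p).
  have -> : g^`() = f ^+ p.-2 * (f * h^`() - f^`() * h).
    have pE : f ^+ p.-1 = f * f ^+ p.-2 by rewrite -exprS prednK //; nat_lia.
    rewrite /g derivM deriv_exp -mulr_natr.
    have -> : (p.-1)%:R = -1 :> {poly k}.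
      rewrite -subn1 natrB // (_ : p%:R = 0) ?sub0r //.
      exact: (pcharf0 (etrans (pchar_poly k p) charkp)).
    rewrite pE; ring.
  have -> : f ^+ p = f ^+ p.-2 * f ^+ 2 by rewrite -exprD; congr (_ ^+ _); nat_lia.
  move: O0; rewrite /Omega_num => /(congr1 (fun q => f ^+ p.-2 * q)); rewrite mulr0 => O0.
  apply/eqP; rewrite -subr_eq0 opprK; apply/eqP; rewrite -[RHS]O0; ring.
suff /eqP : Lp * f ^+ p = 0 by rewrite mulf_eq0 (negbTE Lp_neq0) expf_eq0 (negbTE f0) andbF.
apply/polyP => n; rewrite coef0.
(* In degrees divisible by p the coefficient of t g' is a multiple of p. In the other degrees [Lp]
   f^p has no coefficient, since its derivative is 0. *)
have [pn | pn] := boolP (p %| n)%N.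
  have := congr1 (fun q : {poly k} => q`_n) E; rewrite /= coefN coefXM => e.
  apply/eqP; rewrite -oppr_eq0 -e coef_deriv; case: n pn {e} => //= n pn.
  by rewrite -mulr_natr; move: pn; rewrite (dvdn_pcharf charkp) => /eqP ->; rewrite mulr0.
have /(congr1 (fun q : {poly k} => q`_n.-1)) : (Lp * f ^+ p)^`() = 0.
  by rewrite derivM deriv_Lp mul0r add0r (deriv_expp charkp) mulr0.
rewrite /= coef_deriv coef0; case: n pn => //= [|n]; first by rewrite dvdn0.
rewrite (dvdn_pcharf charkp) => nN0 E'; apply/eqP; move/eqP: E'.
by rewrite -mulr_natr mulf_eq0 (negbTE nN0) orbF.
Qed.

Lemma Vsect_ends f h : Vsect m.+1 f h -> f != 0 -> (al1 * f`_m != 0) || (al0 * f`_0 != 0).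
Proof.
move=> V f0; apply: contraTT (Omega_num_neq0 h f0); rewrite negb_or !negbK.
move=> /andP[/eqP a1 /eqP a0].
by rewrite (Omega_numE V) !expr2 !mulrA a1 a0 !mul0r scale0r polyC0 subrr mulr0.
Qed.

(* The two sections are proportional, [f2 = r f1], so that [r^2] would be the quotient of
   a constant and a multiple of [t]. *)
Lemma Vsect_disjoint_ends f1 h1 f2 h2 : Vsect m.+1 f1 h1 -> Vsect m.+1 f2 h2 ->
  f1`_m = 0 -> f2`_0 = 0 -> (f1 == 0) || (f2 == 0).
Proof.
move=> V1 V2 f1m f20; apply/norP => -[n1 n2].
have W : f1 * h2 = f2 * h1 by apply: wedge_eq0 V1 V2 _; nat_lia.
have W' : f1^`() * h2 + f1 * h2^`() = f2^`() * h1 + f2 * h1^`().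
  by rewrite -!derivM W.
have E : f1 ^+ 2 * Omega_num f2 h2 = f2 ^+ 2 * Omega_num f1 h1.
  have e1 : f1 * h2^`() = f2^`() * h1 + f2 * h1^`() - f1^`() * h2 by rewrite -W' addrC addKr.
  rewrite /Omega_num.
  transitivity ('X * (f1 * f2 * (f1 * h2^`()) - f1 * f2^`() * (f1 * h2)) + Lp * f1 ^+ 2 * f2 ^+ 2).
    by ring.
  rewrite e1.
  transitivity ('X * (f2 * f1 * f2 * h1^`() - f1^`() * f2 * (f1 * h2)
     + f1 * f2^`() * (f2 * h1) - f1 * f2^`() * (f1 * h2)) + Lp * f1 ^+ 2 * f2 ^+ 2).
    by ring.
  by rewrite W; ring.
move: E; rewrite (Omega_numE V1) (Omega_numE V2) f1m f20.
rewrite !expr0n /= !mulr0 mul0r scale0r polyC0 subr0 sub0r mulrCA [in RHS]mulrCA.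
have YN : (('X - 1%:P) * ('X - l%:P)) ^+ p.-1 != 0.
  by rewrite expf_neq0 // mulf_neq0 ?polyXsubC_eq0.
move=> /(mulfI YN).
have := Vsect_ends V1 n1; rewrite f1m mulr0 eqxx /= mulf_eq0 negb_or => /andP[a0 f10].
have := Vsect_ends V2 n2; rewrite f20 mulr0 eqxx orbF mulf_eq0 negb_or => /andP[a1 f2m].
set c := _ / _; have c0 : - c != 0.
  by rewrite oppr_eq0 /c mulf_neq0 ?invr_eq0 ?mulf_neq0 ?expf_neq0.
(* Up to nonzero constants the relation reads t f1^2 = f2^2: an odd degree against an even one. *)
move=> /(congr1 (fun q : {poly k} => size q)).
rewrite -scalerAr size_scale; last by rewrite mulf_neq0 ?expf_neq0.
rewrite size_mulX ?expf_neq0 // -polyCN mulrC mul_polyC size_scale //.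
rewrite !expr2 !size_mul //.
have : (0 < size f1)%N by rewrite size_poly_gt0.
have : (0 < size f2)%N by rewrite size_poly_gt0.
case: (size f2) => // b _; case: (size f1) => // a _.
by move=> /(congr1 odd); rewrite !addSn !addnS /= !addnn !negbK !odd_double.
Qed.

(** * The kernel of the linear system and a complementary section *)

Let cS := (l ^+ p * (l ^+ p - 1))^-1.
Lemma cS_neq0 : cS != 0.
Proof.
by rewrite invr_eq0 mulf_neq0 ?expf_neq0 // subr_eq0 lp_neq1.
Qed.

(** For i + N <= p only coefficients of [Sgap] of positive degree occur. The constant one is the
    place of [d1] and [dl]; thus the system depends on lambda through its reduction. *)
Lemma coef_SgapM f N i : (size f <= N)%N -> (0 < i)%N -> (i + N <= p)%N ->
  (Sgap * f)`_(p - i) = cS * \sum_(j < N) f`_j * Hdelta (i + j).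
Proof.
move=> fN i0 iN; rewrite coefMr.
have NE : (p - i).+1 = (N + ((p - i).+1 - N))%N by nat_lia.
rewrite NE big_split_ord /= addrC big1 ?add0r => [|j _]; last first.
  by rewrite [f`__]nth_default ?mulr0 // (leq_trans fN) // leq_addr.
rewrite mulr_sumr; apply: eq_bigr => j _; have jN := ltn_ord j.
have -> : (p - i - j = p - (i + j))%N by nat_lia.
by rewrite coef_Sgap; [rewrite -/cS; ring | nat_lia].
Qed.

Definition Hmx : 'M[k]_(m, m.+1) :=
  \matrix_(i < m, j < m.+1) Hdelta (m - i.+1 + j.+1).

(** Row i carries the condition at t^(p - (m - i)), so the conditions run from m down to 1; column j
    belongs to the coefficient of t^j in f. *)
Lemma Hmx_mul (v : 'cV_m.+1) i :
  (Hmx *m v) i 0 = cS^-1 * (Sgap * rVpoly v^T)`_(p - (m - i)).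
Proof.
have im := ltn_ord i.
rewrite (@coef_SgapM _ m.+1); [|exact: size_poly|nat_lia|nat_lia].
rewrite mulKf ?cS_neq0 // mxE; apply: eq_bigr => j _.
rewrite coef_rVpoly_ord !mxE mulrC; congr (_ * Hdelta _); nat_lia.
Qed.

Lemma Vsect_kerP (v : 'cV_m.+1) :
  Hmx *m v = 0 <-> exists h, Vsect m.+1 (rVpoly v^T) h.
Proof.
split=> [vK | [h V]].
  apply: Vsect_exists => [||i im]; [nat_lia|by have := size_poly m.+1
    (fun j => if insub j is Some i then v^T 0 i else 0); rewrite -/(rVpoly _); nat_lia|].
  have io : (m - i < m)%N by nat_lia.
  have /(congr1 (fun M : 'cV_m => M (Ordinal io) 0)) := vK.
  rewrite /= Hmx_mul mxE /= => /eqP; rewrite mulf_eq0 invr_eq0 (negbTE cS_neq0) /=.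
  have -> : (m - (m - i) = i)%N by nat_lia.
  by move/eqP.
apply/matrixP => i j; rewrite ord1 Hmx_mul mxE; have im := ltn_ord i.
rewrite -(Vsect_coef _ V); [|nat_lia|nat_lia].
case: V => _ hm _ _; rewrite nth_default ?mulr0 //; nat_lia.
Qed.

Lemma rVpoly_col_eq0 (v : 'cV[k]_m.+1) : (rVpoly v^T == 0) = (v == 0).
Proof.
apply/eqP/eqP => [v0|->]; last by rewrite trmx0 raddf0.
by rewrite -[v]trmxK -[v^T]rVpolyK v0 raddf0 trmx0.
Qed.

Lemma coef_rVpoly_max (v : 'cV[k]_m.+1) : (rVpoly v^T)`_m = v ord_max 0.
Proof. by have := coef_rVpoly_ord v^T ord_max; rewrite mxE. Qed.

Lemma coef_rVpoly_0 (v : 'cV[k]_m.+1) : (rVpoly v^T)`_0 = v 0 0.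
Proof. by have := coef_rVpoly_ord v^T ord0; rewrite mxE. Qed.

Lemma Hmx_ker_ends (v : 'cV_m.+1) : Hmx *m v = 0 -> v != 0 ->
  (al1 * v ord_max 0 != 0) || (al0 * v 0 0 != 0).
Proof.
move=> /Vsect_kerP[h V]; rewrite -rVpoly_col_eq0 => /(Vsect_ends V).
by rewrite coef_rVpoly_max coef_rVpoly_0.
Qed.

Lemma Hmx_ker_disjoint (v w : 'cV_m.+1) : Hmx *m v = 0 -> Hmx *m w = 0 ->
  v ord_max 0 = 0 -> w 0 0 = 0 -> (v == 0) || (w == 0).
Proof.
move=> /Vsect_kerP[h V] /Vsect_kerP[h' V'] vm w0.
rewrite -!rVpoly_col_eq0; apply: Vsect_disjoint_ends V V' _ _.
  by rewrite coef_rVpoly_max.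
by rewrite coef_rVpoly_0.
Qed.

(** A multiple of one kernel vector is subtracted from another to kill an end coordinate. By
    [Hmx_ker_disjoint], two kernel vectors vanishing at opposite ends cannot both be nonzero. *)
Lemma Hmx_ker_line (v w : 'cV_m.+1) : Hmx *m v = 0 -> v != 0 -> Hmx *m w = 0 ->
  exists c, w = c *: v.
Proof.
move=> vK v0 wK.
have K c (u u' : 'cV[k]_m.+1) : Hmx *m u = 0 -> Hmx *m u' = 0 -> Hmx *m (u - c *: u') = 0.
  by move=> uK u'K; rewrite mulmxBr -scalemxAr uK u'K scaler0 subrr.
have [vm | vm] := eqVneq (v ord_max 0) 0.
  have v00 : v 0 0 != 0.
    by have := Hmx_ker_ends vK v0; rewrite vm mulr0 eqxx /= mulf_eq0 negb_or => /andP[].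
  exists (w 0 0 / v 0 0).
  have := Hmx_ker_disjoint vK (K (w 0 0 / v 0 0) _ _ wK vK) vm.
  rewrite (negbTE v0) /= subr_eq0 => H; apply/eqP/H.
  by rewrite !mxE divfK // subrr.
exists (w ord_max 0 / v ord_max 0).
set u := w - (w ord_max 0 / v ord_max 0) *: v.
have um : u ord_max 0 = 0 by rewrite !mxE divfK // subrr.
have uK : Hmx *m u = 0 by apply: K.
suff : u == 0 by rewrite subr_eq0 => /eqP.
move: u um uK => u um uK.
apply: contraT => u0.
have u00 : u 0 0 != 0.
  by have := Hmx_ker_ends uK u0; rewrite um mulr0 eqxx /= mulf_eq0 negb_or => /andP[].
have := Hmx_ker_disjoint uK (K (v 0 0 / u 0 0) _ _ vK uK) um.
rewrite (negbTE u0) /= => H.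
have /(congr1 (fun M : 'cV_m.+1 => M ord_max 0)) : v - (v 0 0 / u 0 0) *: u = 0.
  by apply/eqP/H; rewrite !mxE divfK // subrr.
by rewrite !mxE um mulr0 subr0 => /eqP; rewrite (negbTE vm).
Qed.

(** A kernel vector of the minor, extended by 0 at c, lies on the line of v, on which only 0 has
    vanishing coordinate c. *)
Lemma col'_Hmx_unit (c : 'I_m.+1) (v : 'cV_m.+1) : Hmx *m v = 0 -> v c 0 != 0 ->
  col' c Hmx \in unitmx.
Proof.
move=> vK vc; have v0 : v != 0 by apply: contraNneq vc => ->; rewrite mxE.
rewrite -unitmx_tr -row_free_unit -kermx_eq0; apply: contraT => /rowV0Pn[u].
rewrite sub_kermx => /eqP uK u0.
have {}uK : col' c Hmx *m u^T = 0 by apply: trmx_inj; rewrite trmx_mul trmxK uK trmx0.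
have := uK; rewrite -mulmx_lift; set w := \col_j _ => wK.
have [a wE] := Hmx_ker_line vK v0 wK.
have /eqP := congr1 (fun M : 'cV_m.+1 => M c 0) wE.
rewrite !mxE unlift_none eq_sym mulf_eq0 (negbTE vc) orbF => /eqP a0.
case/eqP: u0; apply/matrixP => i j; rewrite ord1.
have := congr1 (fun M : 'cV_m.+1 => M (lift c j) 0) wE.
by rewrite a0 scale0r !mxE liftK mxE.
Qed.

(** The signed minors lie on the line of v, and squaring removes the signs. They are not all zero,
    since v has a nonzero end coordinate and the corresponding minor is invertible. *)
Lemma Hmx_minors (v : 'cV_m.+1) : Hmx *m v = 0 -> v != 0 -> exists2 nu, nu != 0 &
  forall c, \det (col' c Hmx) ^+ 2 = nu * v c 0 ^+ 2.
Proof.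
move=> vK v0; have [a aE] := Hmx_ker_line vK v0 (mul_minors Hmx).
have dE c : \det (col' c Hmx) ^+ 2 = a ^+ 2 * v c 0 ^+ 2.
  have := congr1 (fun M : 'cV_m.+1 => M c 0) aE; rewrite !mxE => /(congr1 (fun x => x ^+ 2)).
  by rewrite !exprMn -exprM mulnC exprM sqrrN expr1n expr1n mul1r.
exists (a ^+ 2) => //; apply: contraTneq isT => a0.
have : exists c, v c 0 != 0.
  have [/eqP|] := boolP (v 0 0 == 0); last by exists 0.
  move=> v00; exists ord_max; have := Hmx_ker_ends vK v0.
  by rewrite v00 mulr0 eqxx orbF mulf_eq0 negb_or => /andP[].
case=> c vc; have := col'_Hmx_unit vK vc; rewrite unitmxE unitfE.
by move=> d0; have := dE c; rewrite a0 mul0r => /eqP; rewrite expf_eq0 (negbTE d0).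
Qed.

Lemma Hmx_ker_exists : exists2 v : 'cV_m.+1, v != 0 & Hmx *m v = 0.
Proof.
have : ~~ row_free Hmx^T.
  by rewrite /row_free neq_ltn (leq_ltn_trans (rank_leq_col _)).
rewrite -kermx_eq0 => /rowV0Pn[u]; rewrite sub_kermx => /eqP uK u0.
exists u^T; first by rewrite trmx_eq0.
by apply: trmx_inj; rewrite trmx_mul trmxK uK trmx0.
Qed.

Lemma wedge_lead n n' f h f' h' e : Vsect n f h -> Vsect n' f' h' ->
  f * h' - f' * h = e *: (T1 * Tl) ->
  e = (f * h')`_p.*2 - (f' * h)`_p.*2.
Proof.
move=> V V' E; rewrite -coefB E coefZ.
have : T1 * Tl \is monic by rewrite rpredM ?rpredX ?monicXsubC.
rewrite monicE lead_coefE -[T1 * Tl]mul1r size_TTM ?oner_neq0 // size_poly1 mul1r add1n /=.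
by move/eqP ->; rewrite mulr1.
Qed.

(** This gives the splitting O(m+1) + O(m) of V. The wedge is a constant, read off at t^(2p) from
    the top coefficients; [Vsect_coef] expresses those of h and hw through [Sgap], so that the task
    is to find fw making that expression nonzero. *)
Lemma Vsect_complement f h : Vsect m.+1 f h -> f != 0 ->
  exists fw hw e, [/\ Vsect m fw hw, e != 0 & f * hw - fw * h = e *: (T1 * Tl)].
Proof.
move=> V f0; have m0 : (0 < m)%N by nat_lia.
have [szf szh _ _] := V.
pose v : 'cV_m.+1 := (poly_rV f)^T.
have fE : f = rVpoly v^T by rewrite trmxK poly_rV_K //; nat_lia.
have vK : Hmx *m v = 0 by apply/Vsect_kerP; exists h; rewrite -fE.
have [fw [szw Sw e0]] : exists fw : {poly k}, [/\ (size fw <= m.+2)%N,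
   forall i, (0 < i < m)%N -> (Sgap * fw)`_(p - i) = 0 &
   f`_m * (Sgap * fw)`_(p - m) - fw`_m.+1 * (Sgap * f)`_(p - m.+1) != 0].
  have [fm|fm] := eqVneq f`_m 0; last first.
    (* If f_m is nonzero, fw of degree at most m suffices. The system is solved for the first unit
       vector, because row 0, at t^(p-m), is the one condition of V(-m-1) that V(-m) drops. *)
    have U : col' ord_max Hmx \in unitmx.
      by apply: (col'_Hmx_unit vK); rewrite -coef_rVpoly_max -fE.
    pose w : 'cV[k]_m := invmx (col' ord_max Hmx) *m delta_mx (Ordinal m0) 0.
    have := mulmx_lift Hmx ord_max w; rewrite mulKVmx //.
    set W := \col_j _ => HW.
    have Sw i (im : (i < m)%N) : (Sgap * rVpoly W^T)`_(p - (m - i)) = cS * (i == 0)%:R.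
      have := congr1 (fun M : 'cV_m => M (Ordinal im) 0) HW; rewrite /= Hmx_mul mxE andbT => <-.
      by rewrite mulVKf ?cS_neq0.
    have szW : (size (rVpoly W^T) <= m.+1)%N by exact: size_poly.
    exists (rVpoly W^T); split; first by nat_lia.
      move=> i im; have := Sw (m - i)%N; have -> : (m - (m - i) = i)%N by nat_lia.
      move=> -> //; last by nat_lia.
      by have -> : (m - i == 0)%N = false; [nat_lia | rewrite mulr0].
    rewrite [(rVpoly _)`_m.+1]nth_default // mul0r subr0 mulf_neq0 //.
    by have := Sw _ m0; rewrite subn0 => ->; rewrite mulr1 cS_neq0.
  have f00 : f`_0 != 0.
    by have := Vsect_ends V f0; rewrite fm mulr0 eqxx /= mulf_eq0 negb_or => /andP[].
  (* If f_m = 0, only the coefficient of t^(m+1) in fw matters for the wedge. It is set to 1, and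
     terms of degree 1 to m are chosen to cancel its contribution to the system. *)
  have U : col' ord0 Hmx \in unitmx.
    by apply: (col'_Hmx_unit vK); rewrite -coef_rVpoly_0 -fE.
  pose y : 'cV[k]_m := \col_(i < m) (cS^-1 * (Sgap * 'X^(m.+1))`_(p - (m - i))).
  pose w : 'cV[k]_m := - (invmx (col' ord0 Hmx) *m y).
  have := mulmx_lift Hmx ord0 w; rewrite mulmxN mulKVmx //.
  set W := \col_j _ => HW.
  have szW : (size (rVpoly W^T) <= m.+1)%N by exact: size_poly.
  exists ('X^(m.+1) + rVpoly W^T); split.
  - rewrite (leq_trans (size_polyD _ _)) // size_polyXn geq_max leqnn; nat_lia.
  - move=> i im; have io : (m - i < m)%N by nat_lia.
    have := congr1 (fun M : 'cV_m => M (Ordinal io) 0) HW; rewrite /= Hmx_mul !mxE /=.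
    have -> : (m - (m - i) = i)%N by nat_lia.
    rewrite mulrDr coefD => E; apply: (mulfI (x := cS^-1)); first by rewrite invr_eq0 cS_neq0.
    by rewrite mulrDr E subrr mulr0.
  rewrite fm mul0r sub0r oppr_eq0 coefD coefXn eqxx [(rVpoly _)`__]nth_default // addr0 mul1r.
  (* Were this coefficient zero, t f would give a section of V(-m-1) with vanishing constant term,
     while f has f_m = 0, against [Vsect_disjoint_ends]. *)
  apply/eqP => S0.
  have szf' : (size f <= m)%N.
    apply/leq_sizeP => j; rewrite leq_eqVlt => /orP[/eqP <- //|mj].
    by rewrite nth_default //; nat_lia.
  have [h2 V2] : exists h2, Vsect m.+1 ('X * f) h2.
    apply: Vsect_exists => [||i im]; first by nat_lia.
      by rewrite mulrC size_mulX //; nat_lia.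
    rewrite mulrCA coefXM; have -> : (p - i == 0)%N = false by nat_lia.
    have -> : ((p - i).-1 = p - i.+1)%N by nat_lia.
    have [->|im'] := eqVneq i m; first exact: S0.
    rewrite -(Vsect_coef _ V); [|nat_lia|nat_lia].
    rewrite nth_default //; nat_lia.
  have := Vsect_disjoint_ends V V2 fm; rewrite coefXM eqxx => /(_ erefl).
  by rewrite mulf_eq0 polyX_eq0 (negbTE f0).
have [hw Vw] : exists hw, Vsect m fw hw.
  by apply: Vsect_exists => //; nat_lia.
have [e eE] := wedge_const V Vw ltac:(nat_lia).
exists fw, hw, e; split=> //.
rewrite (wedge_lead V Vw eE).
have [_ szhw _ _] := Vw.
have -> : (p.*2 = m + (p.*2 - m))%N by nat_lia.
rewrite (@coefM_top _ f hw); [|nat_lia|nat_lia].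
have -> : (m + (p.*2 - m) = m.+1 + (p.*2 - m.+1))%N by nat_lia.
rewrite (@coefM_top _ fw h); [|nat_lia|nat_lia].
rewrite (Vsect_coef _ V); [|nat_lia|nat_lia].
by rewrite (Vsect_coef _ Vw); [|nat_lia|nat_lia].
Qed.

End Sections.

(** * The function field *)

Lemma frac_reprE (R : idomainType) (f : {fraction R}) :
  f = tofrac (frac (repr f)).1 / tofrac (frac (repr f)).2.
Proof.
rewrite -[LHS]reprK; case: (repr f) => -[n d] /= d0; unlock FracField.tofrac.
set x := mkRatio _.
rewrite -[X in _ = _ * X]FracField.pi_inv -[RHS]FracField.pi_mul.
rewrite /FracField.mulf /FracField.invf /= !numden_Ratio ?oner_neq0 //.
by rewrite mulr1 mul1r -[in LHS](Ratio_numden x).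
Qed.

Section FieldIdentities.
Variable F : fieldType.
Implicit Types a b n d : F.

Lemma quotient_ruleM a a' b b' n n' d d' : b != 0 -> d != 0 ->
  ((a' * n + a * n') * (b * d) - a * n * (b' * d + b * d')) / (b * d) ^+ 2 =
  (a' * b - a * b') / b ^+ 2 * (n / d) + a / b * ((n' * d - n * d') / d ^+ 2).
Proof. by move=> b0 d0; field; rewrite b0 d0. Qed.

Lemma quotient_ruleD a a' b b' n n' d d' : b != 0 -> d != 0 ->
  ((a' * d + a * d' + (n' * b + n * b')) * (b * d)
    - (a * d + n * b) * (b' * d + b * d')) / (b * d) ^+ 2 =
  (a' * b - a * b') / b ^+ 2 + (n' * d - n * d') / d ^+ 2.
Proof. by move=> b0 d0; field; rewrite b0 d0. Qed.

Lemma power_rule_step (x y z c : F) : y * (x * z) + x * (c * z * y) = (c + 1) * (x * z) * y.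
Proof. by ring. Qed.

End FieldIdentities.

Section FunctionField.
Variable k : fieldType.
Local Notation K := {fraction {poly k}}.
Local Notation "q %:F" := (tofrac q).
Implicit Types (P Q a b n d : {poly k}) (f g : K) (x : option {poly k}).

Lemma fracP f : exists n d, d != 0 /\ f = n%:F / d%:F.
Proof.
exists (frac (repr f)).1, (frac (repr f)).2; split; last exact: frac_reprE.
exact: denom_ratioP.
Qed.

Lemma eq_frac a b n d : b != 0 -> d != 0 ->
  (a%:F / b%:F == n%:F / d%:F :> K) = (a * d == n * b).
Proof. by move=> b0 d0; rewrite eqr_div ?tofrac_eq0 // -!tofracM tofrac_eq. Qed.

Lemma frac_coprime f : exists n d, [/\ d != 0, coprimep n d & f = n%:F / d%:F].
Proof.
have [n [d [d0 ->]]] := fracP f; set g := gcdp n d.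
have g0 : g != 0 by rewrite gcdp_eq0 (negbTE d0) andbF.
have dE : d %/ g * g = d by rewrite divpK // dvdp_gcdr.
have d'0 : d %/ g != 0 by apply: contraNneq d0 => e; rewrite -dE e mul0r.
exists (n %/ g), (d %/ g); split=> //.
  by rewrite coprimep_div_gcd // d0 orbT.
apply/eqP; rewrite eq_frac // -{1}[n](divpK (dvdp_gcdl n d)) -/g -mulrA.
by rewrite [g * _]mulrC dE.
Qed.

Lemma fderiv_frac a b : b != 0 ->
  fderiv (a%:F / b%:F) = (a^`() * b - a * b^`())%:F / (b ^+ 2)%:F.
Proof.
move=> b0; rewrite /fderiv; have := frac_reprE (a%:F / b%:F).
case: (repr _) => -[n d] /= d0 /eqP; rewrite (eq_frac _ _ b0 d0) => /eqP E.
apply/eqP; rewrite eq_frac ?expf_neq0 //; apply/eqP.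
have E' : a^`() * d + a * d^`() = n^`() * b + n * b^`() by rewrite -!derivM E.
have e1 : n^`() * b = a^`() * d + a * d^`() - n * b^`() by rewrite E' addrK.
transitivity ((n^`() * b) * d * b - n * b * b * d^`()); first by ring.
rewrite e1; transitivity (a^`() * b * d ^+ 2 + (a * d) * b * d^`()
  - (n * b) * b^`() * d - n * b * b * d^`()); first by ring.
by rewrite -E; ring.
Qed.

Lemma fderiv_poly P : fderiv P%:F = P^`()%:F.
Proof.
rewrite -[P%:F]divr1 -tofrac1 fderiv_frac ?oner_neq0 //.
by rewrite derivC mulr0 subr0 mulr1 expr1n tofrac1 divr1.
Qed.

Lemma fderivM f g : fderiv (f * g) = fderiv f * g + f * fderiv g.
Proof.
have [a [b [b0 ->]]] := fracP f; have [n [d [d0 ->]]] := fracP g.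
rewrite mulf_div -!tofracM !fderiv_frac ?mulf_neq0 // !derivM.
rewrite !(tofracM, tofracB, tofracD, tofracXn).
by apply: quotient_ruleM; rewrite tofrac_eq0.
Qed.

Lemma fderivD f g : fderiv (f + g) = fderiv f + fderiv g.
Proof.
have [a [b [b0 ->]]] := fracP f; have [n [d [d0 ->]]] := fracP g.
rewrite addf_div ?tofrac_eq0 // -!tofracM -tofracD !fderiv_frac ?mulf_neq0 //.
rewrite !(derivM, derivD) !(tofracM, tofracB, tofracD, tofracXn).
by apply: quotient_ruleD; rewrite tofrac_eq0.
Qed.

Lemma fderivN f : fderiv (- f) = - fderiv f.
Proof.
have [a [b [b0 ->]]] := fracP f.
by rewrite -mulNr -tofracN !fderiv_frac // derivN !mulNr -opprD tofracN mulNr.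
Qed.

Lemma fderiv_exp f (i : nat) : fderiv (f ^+ i) = i%:R * f ^+ i.-1 * fderiv f.
Proof.
elim: i => [|i IH].
  by rewrite expr0 -tofrac1 fderiv_poly derivC tofrac0 !mul0r.
rewrite exprS fderivM IH; case: i {IH} => [|i] /=.
  by rewrite expr0 mul0r mul0r mulr0 addr0 mulr1 !mul1r.
by rewrite exprS power_rule_step natr1.
Qed.

Lemma fderiv_expp p f : p \in [pchar k] -> fderiv (f ^+ p) = 0.
Proof.
move=> charkp; rewrite fderiv_exp.
have -> : p%:R = 0 :> K.
  by rewrite -tofrac1 -tofracMn (pcharf0 (etrans (pchar_poly k p) charkp)) tofrac0.
by rewrite !mul0r.
Qed.

Section FinitePoint.
Variable q : {poly k}.
Hypothesis q_irr : irreducible_poly q.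

Lemma irr_dvdp_mul a b : (q %| a * b) = (q %| a) || (q %| b).
Proof.
have [qa | qa] := boolP (q %| a); first by rewrite dvdp_mulr.
by rewrite Gauss_dvdpr // irreducible_poly_coprime.
Qed.

Lemma irr_dvdp_exp a (n : nat) : q %| a ^+ n -> q %| a.
Proof.
elim: n => [|n IH]; last by rewrite exprS irr_dvdp_mul => /orP[|/IH].
by rewrite expr0 dvdp1 => /eqP s1; case: q_irr; rewrite s1.
Qed.

Lemma irr_ndvd1 : ~~ (q %| 1).
Proof. by rewrite dvdp1; apply/eqP => s1; case: q_irr; rewrite s1. Qed.

Lemma regular_frac a b : ~~ (q %| b) -> regular (Some q) (a%:F / b%:F).
Proof. by exists a, b. Qed.

Lemma regular_poly a : regular (Some q) a%:F.
Proof. by exists a, 1; split; [exact: irr_ndvd1 | rewrite tofrac1 divr1]. Qed.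

Lemma ndvd_neq0 b : ~~ (q %| b) -> b != 0.
Proof. by apply: contraNneq => ->; rewrite dvdp0. Qed.

Lemma regular_fracP a b : b != 0 -> coprimep a b ->
  regular (Some q) (a%:F / b%:F) <-> ~~ (q %| b).
Proof.
move=> b0 ab; split=> [|qb]; last by exists a, b.
case=> n [d [qd /eqP]]; rewrite (eq_frac _ _ b0 (ndvd_neq0 qd)) => /eqP E.
apply: contra qd => qb; have : q %| a * d by rewrite E dvdp_mull.
rewrite irr_dvdp_mul => /orP[qa|//].
have : q %| gcdp a b by rewrite dvdp_gcd qa.
move: ab; rewrite /coprimep => /eqP s1 qg.
by have := dvdp_leq _ qg; case: q_irr; rewrite -size_poly_eq0 s1; case: (size q) => [|[]] //= ? ? _ /(_ isT).
Qed.

Lemma regular_dvdp a (n : nat) f : regular (Some q) f -> a%:F = (q ^+ n)%:F * f -> q ^+ n %| a.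
Proof.
case=> u [v [qv ->]]; rewrite mulrA -tofracM -[a%:F]divr1 -tofrac1 => /eqP.
rewrite (eq_frac _ _ (oner_neq0 _) (ndvd_neq0 qv)) mulr1 => /eqP E.
rewrite -(@Gauss_dvdpl _ _ v) ?E ?dvdp_mulr //.
by apply: coprimep_expl; rewrite irreducible_poly_coprime.
Qed.

End FinitePoint.

Lemma regularNone_frac a b : b != 0 ->
  regular None (a%:F / b%:F) <-> (size a <= size b)%N.
Proof.
move=> b0; split=> [[n [d [d0 nd /eqP]]]|ab]; last by exists a, b.
rewrite (eq_frac _ _ b0 d0) => /eqP E.
have [->|a0] := eqVneq a 0; first by rewrite size_poly0.
have n0 : n != 0.
  by apply: contraNneq a0 => n0; move/eqP: E; rewrite n0 mul0r mulf_eq0 (negbTE d0) orbF.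
have := congr1 (fun q : {poly k} => size q) E; rewrite /= !size_mul //.
have : (0 < size n)%N by rewrite size_poly_gt0.
have : (0 < size b)%N by rewrite size_poly_gt0.
nat_lia.
Qed.

Lemma regularD x f g : closed_point x -> regular x f -> regular x g -> regular x (f + g).
Proof.
case: x => [q [_ qi]|_].
  case=> [a [b [qb ->]]] [n [d [qd ->]]].
  exists (a * d + n * b), (b * d); split; first by rewrite irr_dvdp_mul // negb_or qb.
  by rewrite addf_div ?tofrac_eq0 ?(ndvd_neq0 qb) ?(ndvd_neq0 qd) // tofracD !tofracM.
case=> [a [b [b0 ab ->]]] [n [d [d0 nd ->]]].
exists (a * d + n * b), (b * d); split; first by rewrite mulf_neq0.
  rewrite (leq_trans (size_polyD _ _)) // geq_max (size_mul b0 d0).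
  by have := size_polyMleq a d; have := size_polyMleq n b; move=> h1 h2; apply/andP; split; nat_lia.
by rewrite addf_div ?tofrac_eq0 // tofracD !tofracM.
Qed.

Lemma regularM x f g : closed_point x -> regular x f -> regular x g -> regular x (f * g).
Proof.
case: x => [q [_ qi]|_].
  case=> [a [b [qb ->]]] [n [d [qd ->]]].
  exists (a * n), (b * d); split; first by rewrite irr_dvdp_mul // negb_or qb.
  by rewrite mulf_div !tofracM.
case=> [a [b [b0 ab ->]]] [n [d [d0 nd ->]]].
exists (a * n), (b * d); split; first by rewrite mulf_neq0.
  by rewrite (size_mul b0 d0); have := size_polyMleq a n; nat_lia.
by rewrite mulf_div !tofracM.
Qed.

Lemma regularC x (c : k) : closed_point x -> regular x c%:P%:F.
Proof.
case: x => [q [_ qi]|_]; first exact: regular_poly.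
by exists c%:P, 1; rewrite oner_neq0 tofrac1 divr1 size_poly1 size_polyC_leq1.
Qed.

Lemma regular0 x : closed_point x -> regular x 0.
Proof. by move=> /(@regularC _ 0); rewrite polyC0 tofrac0. Qed.

Lemma regular1 x : closed_point x -> regular x 1.
Proof. by move=> /(@regularC _ 1); rewrite polyC1 tofrac1. Qed.

Lemma regularN x f : closed_point x -> regular x f -> regular x (- f).
Proof.
move=> cx rf; rewrite -mulN1r; apply: regularM => //.
by have := @regularC x (- 1) cx; rewrite polyCN polyC1 tofracN tofrac1.
Qed.

Lemma regularB x f g : closed_point x -> regular x f -> regular x g -> regular x (f - g).
Proof. by move=> cx rf rg; apply: regularD => //; apply: regularN. Qed.

Lemma regularX x f (n : nat) : closed_point x -> regular x f -> regular x (f ^+ n).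
Proof.
move=> cx rf; elim: n => [|n IH]; first by rewrite expr0; apply: regular1.
by rewrite exprS; apply: regularM.
Qed.

Lemma closed_rat_point (c : option k) : closed_point (rat_point c).
Proof. by case: c => //= c; split; [exact: monicXsubC | exact: irredp_XsubC]. Qed.

Lemma irr_factor d : (1 < size d)%N ->
  exists q, [/\ q \is monic, irreducible_poly q & q %| d].
Proof.
have [N] := ubnP (size d); elim: N d => // N IH d dN d1.
have d0 : d != 0 by rewrite -size_poly_eq0; case: (size d) d1.
have [[q [q1 qd qn]]|H] := pselect (exists q : {poly k}, [/\ (1 < size q)%N, q %| d & (size q < size d)%N]).
  have [|//|r [rm ri rq]] := IH q; first by apply: leq_trans qn _.
  by exists r; split=> //; apply: dvdp_trans qd.
exists ((lead_coef d)^-1 *: d); have l0 : lead_coef d != 0 by rewrite lead_coef_eq0.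
split; first by rewrite monicE lead_coefZ mulVf.
- split; first by rewrite size_scale ?invr_eq0.
  move=> q q1; rewrite dvdpZr ?invr_eq0 // => qd.
  rewrite (@eqp_trans _ d) //; last by rewrite eqp_sym eqp_scale ?invr_eq0.
  rewrite -dvdp_size_eqp // eqn_leq dvdp_leq //= leqNgt; apply/negP => lt.
  apply: H; exists q; split=> //.
  have : q != 0 by apply: contraTneq qd => ->; rewrite dvd0p.
  by rewrite -size_poly_eq0; case: (size q) q1 => [|[]].
- by rewrite dvdpZl ?invr_eq0.
Qed.

Lemma regular_finite_poly f :
  (forall q, closed_point (Some q) -> regular (Some q) f) -> exists P, f = P%:F.
Proof.
move=> rf; have [n [d [d0 nd fE]]] := frac_coprime f.
have [d1|d1] := ltnP 1 (size d).
  have [q [qm qi qd]] := irr_factor d1.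
  by have := rf q (conj qm qi); rewrite fE regular_fracP // qd.
have dE := size1_polyC d1; set c := d`_0 in dE.
have c0 : c != 0 by apply: contraNneq d0 => e; rewrite dE e polyC0.
exists (n * (c^-1)%:P); rewrite fE dE tofracM; congr (_ * _).
apply: (mulfI (x := c%:P%:F)); first by rewrite tofrac_eq0 polyC_eq0.
rewrite divff ?tofrac_eq0 ?polyC_eq0 //.
by rewrite -tofracM -polyCM divff ?polyC1 ?tofrac1.
Qed.

(** [ratmap] reduces the fraction chosen by [repr]. Any other representation differs from the
    reduced one by a common factor [u], and can be evaluated wherever it is not 0/0. *)
Lemma ratmap_lowest n d : d != 0 -> exists n1 d1 u, [/\ u != 0, n = n1 * u, d = d1 * u,
  coprimep n1 d1 & forall x : option k, ratmap (n%:F / d%:F) x = match x with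
  | Some c => if root d1 c then None else Some (n1.[c] / d1.[c])
  | None => if (size d1 < size n1)%N then None
            else Some (n1`_(size d1).-1 / lead_coef d1)
  end].
Proof.
move=> d0; rewrite /ratmap; have := frac_reprE (n%:F / d%:F).
case: (repr _) => -[a b] /= b0 /eqP; rewrite (eq_frac _ _ d0 b0) => /eqP E.
set g := gcdp a b; have g0 : g != 0 by rewrite gcdp_eq0 (negbTE b0) andbF.
have bE : b %/ g * g = b by rewrite divpK // dvdp_gcdr.
have aE : a %/ g * g = a by rewrite divpK // dvdp_gcdl.
have cop : coprimep (a %/ g) (b %/ g) by rewrite coprimep_div_gcd // b0 orbT.
have E' : n * (b %/ g) = a %/ g * d.
  by apply: (mulIf g0); rewrite -mulrA bE E -{1}aE mulrAC.
have /dvdpP[u dE] : b %/ g %| d.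
  by rewrite -(@Gauss_dvdpr _ d (a %/ g) (b %/ g)) 1?coprimep_sym // -E' dvdp_mull.
have b'0 : b %/ g != 0 by apply: contraNneq b0 => e; rewrite -bE e mul0r.
exists (a %/ g), (b %/ g), u; split=> //.
- by apply: contraNneq d0 => e; rewrite dE e mul0r.
- by apply: (mulIf b'0); rewrite E' dE mulrA.
- by rewrite dE mulrC.
Qed.

Lemma ratmap_Some n d c : d != 0 -> (n.[c] != 0) || (d.[c] != 0) ->
  ratmap (n%:F / d%:F) (Some c) = if d.[c] == 0 then None else Some (n.[c] / d.[c]).
Proof.
move=> d0 nz; have [n1 [d1 [u [u0 nE dE cop ->]]]] /= := ratmap_lowest n d0.
have uc : u.[c] != 0.
  by apply: contraTneq nz => e; rewrite nE dE !hornerM e !mulr0 eqxx.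
rewrite rootE nE dE !hornerM mulf_eq0 (negbTE uc) orbF; case: eqP => // _.
by rewrite -mulf_div divff // mulr1.
Qed.

Lemma ratmap_None n d : d != 0 -> (size d < size n)%N -> ratmap (n%:F / d%:F) None = None.
Proof.
move=> d0 dn; have [n1 [d1 [u [u0 nE dE cop ->]]]] /= := ratmap_lowest n d0.
have d10 : d1 != 0 by apply: contraNneq d0 => e; rewrite dE e mul0r.
have n10 : n1 != 0.
  by apply: contraTneq dn => e; rewrite nE e mul0r size_poly0.
move: dn; rewrite nE dE !size_mul // => dn.
have : (0 < size u)%N by rewrite size_poly_gt0.
have : (0 < size d1)%N by rewrite size_poly_gt0.
by move=> h1 h2; have -> : (size d1 < size n1)%N by nat_lia.
Qed.

End FunctionField.

(** * The lift modulo p^2 *)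

Section WittVectors.
Variables (p : nat) (k : fieldType) (charkp : p \in [pchar k]).
Let pp : prime p := pcharf_prime charkp.
Local Notation W := (W2 charkp).
Implicit Types x y : W.

(** The ghost component of n is n^p + p z. The witness z is an integer because p cannot be divided
    out in k. *)
Lemma W2_natr n : exists z : int, n%:R = (n%:R, z%:~R) :> W /\ p%:R * z = n%:R - n%:R ^+ p.
Proof.
have p0 := prime_gt0 pp.
elim: n => [|n [z [nE zE]]].
  by exists 0; split; rewrite ?mulr0 // expr0n gtn_eqF // subrr.
exists (z - wcarry p n%:R 1); split; last first.
  rewrite mulrBr zE mulr_natl (wcarryE pp) expr1n -natr1; ring.
rewrite -natr1 nE; congr (_, _); rewrite /= ?natr1 // addr0 rmorphB /= wcarry_morph.
by rewrite rmorph1 rmorph_nat.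
Qed.

Lemma W2_pchar : p%:R = (0, 1) :> W.
Proof.
have p0 := prime_gt0 pp.
have [z [-> zE]] := W2_natr p; congr (_, _); first exact: (pcharf0 charkp).
have pN0 : p%:R != 0 :> int by rewrite Num.Theory.pnatr_eq0 gtn_eqF.
have -> : z = 1 - p%:R ^+ p.-1.
  by apply: (mulfI pN0); rewrite zE mulrBr mulr1 -exprS prednK.
rewrite rmorphB /= rmorph1 rmorphXn /= rmorph_nat (pcharf0 charkp).
by rewrite expr0n gtn_eqF ?subr0 //; have := prime_gt1 pp; case: (p) => [|[]].
Qed.

(** Multiplication by p is Frobenius followed by Verschiebung. *)
Lemma W2_mulrp x : x *+ p = (0, x.1 ^+ p).
Proof.
have p0 := prime_gt0 pp.
rewrite -mulr_natr W2_pchar; congr (_, _); rewrite /= ?mulr0 //.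
by rewrite expr0n gtn_eqF // mulr0 addr0 mulr1.
Qed.

Lemma W2_mulrp_eq0 x : (x *+ p == 0) = (Wres x == 0).
Proof.
rewrite W2_mulrp /Wres; apply/eqP/eqP => [[/eqP]|->].
  by rewrite expf_eq0 => /andP[_ /eqP].
by rewrite expr0n gtn_eqF ?prime_gt0.
Qed.

Lemma W2_exp x n : x ^+ n = (x.1 ^+ n, n%:R * x.1 ^+ (p * n.-1) * x.2).
Proof.
elim: n => [|n IH]; first by rewrite expr0 mul0r mul0r.
rewrite exprS IH; congr (_, _); rewrite /= ?exprS //.
case: n {IH} => [|n] /=; first by rewrite !expr0 expr1n muln0 expr0 !mul0r mulr0 add0r !mulr1 mul1r.
by rewrite -[n.+2%:R]natr1 -exprM (mulnC n.+1) mulnS exprD; ring.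
Qed.

Lemma W2_expp x : x ^+ p = (x.1 ^+ p, 0).
Proof. by rewrite W2_exp (pcharf0 charkp) !mul0r. Qed.

Definition W2_Frob x : W := (x.1 ^+ p, x.2 ^+ p).

Lemma W2_Frob_zmod_morphism : zmod_morphism W2_Frob.
Proof.
have FD (a b : k) : (a + b) ^+ p = a ^+ p + b ^+ p.
  by have := rmorphD (pFrobenius_aut charkp) a b; rewrite /= !pFrobenius_autE.
have FN (a : k) : (- a) ^+ p = - a ^+ p.
  by have := rmorphN (pFrobenius_aut charkp) a; rewrite /= !pFrobenius_autE.
have FC (a b : k) : wcarry p a b ^+ p = wcarry p (a ^+ p) (b ^+ p).
  by have := wcarry_morph p (pFrobenius_aut charkp) a b; rewrite /= !pFrobenius_autE.
have D x y : W2_Frob (x + y) = W2_Frob x + W2_Frob y.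
  by congr (_, _); rewrite /= ?FD // FN FC.
move=> x y; rewrite D; congr (_ + _); apply/eqP; rewrite -subr_eq0 opprK -D addNr.
by rewrite /W2_Frob /= expr0n gtn_eqF ?prime_gt0.
Qed.

Lemma W2_Frob_monoid_morphism : monoid_morphism W2_Frob.
Proof.
have FD (a b : k) : (a + b) ^+ p = a ^+ p + b ^+ p.
  by have := rmorphD (pFrobenius_aut charkp) a b; rewrite /= !pFrobenius_autE.
split; first by rewrite /W2_Frob /= expr1n expr0n gtn_eqF ?prime_gt0.
by move=> x y; congr (_, _); rewrite /= ?FD !exprMn ?FD // -!exprM.
Qed.

HB.instance Definition _ := GRing.isZmodMorphism.Build W W W2_Frob W2_Frob_zmod_morphism.
HB.instance Definition _ := GRing.isMonoidMorphism.Build W W W2_Frob W2_Frob_monoid_morphism.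

Lemma Wres_Frob x : Wres (W2_Frob x) = Wres x ^+ p.
Proof. by []. Qed.

(** This is where the parameter [d] of [Frob_gap] comes from: sigma(c) - c^p is p times a lift of
    [c.2]. *)
Lemma W2_FrobE x : W2_Frob x = x ^+ p + ((x.2, 0) : W) *+ p.
Proof.
rewrite W2_mulrp W2_expp; congr (_, _); rewrite /= ?addr0 // add0r.
by rewrite wcarry_x0 // subr0.
Qed.

Section Polynomials.
Implicit Types q r : {poly W}.
Local Notation res := (@poly_res p k charkp).

HB.instance Definition _ := GRing.RMorphism.copy res (map_poly (@Wres p k charkp)).

Lemma coef_poly_res q i : (res q)`_i = Wres q`_i.
Proof. exact: coef_map. Qed.

Lemma poly_resX : res 'X = 'X.
Proof. exact: map_polyX. Qed.

Lemma poly_resC c : res c%:P = (Wres c)%:P.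
Proof. exact: map_polyC. Qed.

Lemma poly_res_deriv q : res q^`() = (res q)^`().
Proof. by rewrite deriv_map. Qed.

Lemma poly_mulrp_eq0 q : (q *+ p == 0) = (res q == 0).
Proof.
apply/eqP/eqP => e; apply/polyP => i.
  rewrite coef_poly_res coef0; apply/eqP; rewrite -W2_mulrp_eq0 -coefMn e coef0.
  exact: eqxx.
by rewrite coefMn coef0; apply/eqP; rewrite W2_mulrp_eq0 -coef_poly_res e coef0.
Qed.

Hypothesis k_perfect : forall x : k, exists y : k, y ^+ p = x.

(** Perfectness gives (0, b) = p (b^(1/p), 0) coefficientwise. The size bound serves regularity at
    infinity. *)
Lemma poly_res_eq0 q : res q = 0 -> exists2 r, q = r *+ p & (size r <= size q)%N.
Proof.
move=> q0; have [s sE] := boolp.choice k_perfect.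
pose r : {poly W} := \poly_(i < size q) ((s (q`_i).2, 0) : W).
exists r; last exact: size_poly.
apply/polyP => i; rewrite coefMn coef_poly W2_mulrp.
have := congr1 (fun u : {poly k} => u`_i) q0; rewrite /= coef_poly_res coef0 /Wres.
case: ltnP => [_|iq]; first by case: (q`_i) => a b /= ->; rewrite sE.
by rewrite nth_default //= => _; rewrite expr0n gtn_eqF ?prime_gt0.
Qed.

End Polynomials.

End WittVectors.

Section GenericPoint.
Variables (p : nat) (k : fieldType) (charkp : p \in [pchar k]).
Let pp : prime p := pcharf_prime charkp.
Local Notation W := (W2 charkp).
Local Notation K := {fraction {poly k}}.
Local Notation K2 := (K2 charkp).
Local Notation "q %:F" := (tofrac q).
Local Notation res := (@poly_res p k charkp).
Local Notation nzp := (Defs_nz_mod_p__canonical__GRing_MulClosed charkp).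
Implicit Types (a b c d : {poly W}) (y z : K2).

Lemma K2_frac_pi a b (b0 : b \in nzp) :
  K2_frac a b = \pi_(loc nzp) (@Prefrac _ nzp (a, b) b0) :> K2.
Proof. by rewrite /K2_frac /loc_frac /insubd insubT. Qed.

Lemma K2_fracP z : exists a b, res b != 0 /\ z = K2_frac a b.
Proof.
elim/quotW: z => -[[a b] /= b0]; exists a, b; split=> //.
by rewrite (@K2_frac_pi a b b0).
Qed.

Lemma K2_frac_eq a b c d : res b != 0 -> res d != 0 ->
  K2_frac a b = K2_frac c d <-> exists2 u, res u != 0 & u * (a * d - c * b) = 0.
Proof.
move=> b0 d0; rewrite (@K2_frac_pi a b b0) (@K2_frac_pi c d d0).
split=> [/eqP/locP[u u0 e]|[u u0 e]]; first by exists u.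
by apply/eqP/locP; exists u.
Qed.

Lemma K2_frac_cross a b c d : res b != 0 -> res d != 0 -> a * d = c * b ->
  K2_frac a b = K2_frac c d.
Proof.
move=> b0 d0 e; apply/K2_frac_eq => //; exists 1; last by rewrite e subrr mulr0.
by rewrite rmorph1 oner_neq0.
Qed.

Lemma res1_neq0 : res 1 != 0. Proof. by rewrite rmorph1 oner_neq0. Qed.

Lemma resM_neq0 b d : res b != 0 -> res d != 0 -> res (b * d) != 0.
Proof. by move=> b0 d0; rewrite rmorphM mulf_neq0. Qed.

Lemma K2_fracD a b c d : res b != 0 -> res d != 0 ->
  K2_frac a b + K2_frac c d = K2_frac (a * d + c * b) (b * d).
Proof.
move=> b0 d0; rewrite (@K2_frac_pi a b b0) (@K2_frac_pi c d d0).
rewrite (@K2_frac_pi _ _ (resM_neq0 b0 d0)) -[LHS]/(loc_add _ _) loc_addE.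
by congr (\pi_ _ _); apply: val_inj.
Qed.

Lemma K2_fracM a b c d : res b != 0 -> res d != 0 ->
  K2_frac a b * K2_frac c d = K2_frac (a * c) (b * d).
Proof.
move=> b0 d0; rewrite (@K2_frac_pi a b b0) (@K2_frac_pi c d d0).
rewrite (@K2_frac_pi _ _ (resM_neq0 b0 d0)) -[LHS]/(loc_mul _ _) loc_mulE.
by congr (\pi_ _ _); apply: val_inj.
Qed.

Lemma K2_frac0 : K2_frac 0 1 = 0 :> K2.
Proof.
rewrite (@K2_frac_pi 0 1 res1_neq0) -[RHS]/(loc_of nzp 0) /loc_of.
by congr (\pi_ _ _); apply: val_inj.
Qed.

Lemma K2_frac1 : K2_frac 1 1 = 1 :> K2.
Proof.
rewrite (@K2_frac_pi 1 1 res1_neq0) -[RHS]/(loc_of nzp 1) /loc_of.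
by congr (\pi_ _ _); apply: val_inj.
Qed.

Lemma K2_fracN a b : res b != 0 -> - K2_frac a b = K2_frac (- a) b.
Proof.
move=> b0; apply: (addrI (K2_frac a b)); rewrite subrr K2_fracD // -K2_frac0.
apply: K2_frac_cross; rewrite ?resM_neq0 ?res1_neq0 //; ring.
Qed.

Lemma K2_fracZ a b n : res b != 0 -> K2_frac a b *+ n = K2_frac (a *+ n) b.
Proof.
move=> b0; elim: n => [|n IH].
  rewrite mulr0n -K2_frac0; apply: K2_frac_cross; rewrite ?res1_neq0 //; ring.
rewrite mulrS IH K2_fracD //; apply: K2_frac_cross; rewrite ?resM_neq0 //.
by rewrite mulrS; ring.
Qed.

Lemma K2_fracB a b c d : res b != 0 -> res d != 0 ->
  K2_frac a b - K2_frac c d = K2_frac (a * d - c * b) (b * d).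
Proof. by move=> b0 d0; rewrite K2_fracN // K2_fracD // mulNr. Qed.

Lemma K2_res_frac a b : res b != 0 -> K2_res (K2_frac a b) = (res a)%:F / (res b)%:F.
Proof.
move=> b0; rewrite /K2_res; have := reprK (K2_frac a b).
case: (repr _) => -[c d] /= d0; rewrite -(@K2_frac_pi c d d0) => /K2_frac_eq[//|//|u u0].
move=> /(congr1 res); rewrite rmorphM rmorphB !rmorphM rmorph0.
move=> /eqP; rewrite mulf_eq0 (negbTE u0) subr_eq0 => /eqP e.
by apply/eqP; rewrite (eq_frac _ _ d0 b0) e.
Qed.

Lemma K2_res_zmod_morphism : zmod_morphism (@K2_res p k charkp).
Proof.
move=> y z; have [a [b [b0 ->]]] := K2_fracP y; have [c [d [d0 ->]]] := K2_fracP z.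
rewrite K2_fracB // !K2_res_frac ?resM_neq0 //.
rewrite rmorphB !rmorphM /= tofracB !tofracM -[in RHS]mulNr addf_div ?tofrac_eq0 //.
by rewrite mulNr.
Qed.

Lemma K2_res_monoid_morphism : monoid_morphism (@K2_res p k charkp).
Proof.
split.
  rewrite -K2_frac1 K2_res_frac ?res1_neq0 //.
  by rewrite rmorph1 tofrac1 divr1.
move=> y z; have [a [b [b0 ->]]] := K2_fracP y; have [c [d [d0 ->]]] := K2_fracP z.
by rewrite K2_fracM // !K2_res_frac ?resM_neq0 // !rmorphM /= mulf_div.
Qed.

HB.instance Definition _ :=
  GRing.isZmodMorphism.Build K2 K (@K2_res p k charkp) K2_res_zmod_morphism.
HB.instance Definition _ :=
  GRing.isMonoidMorphism.Build K2 K (@K2_res p k charkp) K2_res_monoid_morphism.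

Lemma K2_res_poly a : K2_res (K2_frac a 1) = (res a)%:F.
Proof. by rewrite K2_res_frac ?res1_neq0 // rmorph1 tofrac1 divr1. Qed.

Lemma K2_mulrp_eq0 z : (z *+ p = 0) -> K2_res z = 0.
Proof.
have [a [b [b0 ->]]] := K2_fracP z; rewrite K2_fracZ //.
rewrite -K2_frac0 => /(K2_frac_eq _ _ b0 res1_neq0)[u u0].
rewrite mulr1 mul0r subr0 => /eqP; rewrite mulrnAr poly_mulrp_eq0 rmorphM mulf_eq0.
by rewrite (negbTE u0) K2_res_frac // => /eqP ->; rewrite tofrac0 mul0r.
Qed.

Lemma div_by_pE z : div_by_p (z *+ p) = K2_res z.
Proof.
rewrite /div_by_p; case: xgetP => [c _ [y yE ->]|H]; last first.
  by case: (H (K2_res z)); exists z.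
apply/eqP; rewrite -subr_eq0 -rmorphB; apply/eqP/K2_mulrp_eq0.
by rewrite mulrnBl yE subrr.
Qed.

Lemma K2_deriv_frac a b : res b != 0 ->
  K2_deriv (K2_frac a b) = K2_frac (a^`() * b - a * b^`()) (b ^+ 2).
Proof.
move=> b0; rewrite /K2_deriv; have := reprK (K2_frac a b).
case: (repr _) => -[c d] /= d0; rewrite -(@K2_frac_pi c d d0) => /K2_frac_eq[//|//|u u0 e].
(* Differentiating u w = 0 gives u' w + u w' = 0; one more factor u removes the first term, leaving
   u^2 w' = 0. *)
apply/K2_frac_eq; rewrite ?rmorphXn ?expf_neq0 //; exists (u ^+ 2).
  by rewrite rmorphXn expf_neq0.
have e' : u^`() * (c * b - a * d) + u * (c^`() * b + c * b^`() - (a^`() * d + a * d^`())) = 0.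
  by rewrite -!derivM -derivB -derivM e derivC.
have e1 : u ^+ 2 * (c^`() * b + c * b^`() - (a^`() * d + a * d^`())) = 0.
  transitivity (u * 0 - u^`() * (u * (c * b - a * d))); last by rewrite e !mulr0 subr0.
  by rewrite -e'; ring.
transitivity (b * d * (u ^+ 2 * (c^`() * b + c * b^`() - (a^`() * d + a * d^`())))
   - u * (u * (c * b - a * d)) * (b * d^`() + b^`() * d)); first by ring.
by rewrite e1 e !mulr0 mul0r subr0.
Qed.

Lemma K2_deriv_mulrp z : K2_deriv (z *+ p) = K2_deriv z *+ p.
Proof.
have [a [b [b0 ->]]] := K2_fracP z.
rewrite K2_fracZ // !K2_deriv_frac // K2_fracZ ?rmorphXn ?expf_neq0 //.
by congr K2_frac; rewrite derivMn; ring.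
Qed.

Lemma K2_derivD y z : K2_deriv (y + z) = K2_deriv y + K2_deriv z.
Proof.
have [a [b [b0 ->]]] := K2_fracP y; have [c [d [d0 ->]]] := K2_fracP z.
rewrite K2_fracD // !K2_deriv_frac ?resM_neq0 // K2_fracD ?rmorphXn ?expf_neq0 //.
apply: K2_frac_cross; rewrite ?rmorphM ?rmorphXn ?mulf_neq0 ?expf_neq0 ?mulf_neq0 //.
by rewrite !(derivM, derivD); ring.
Qed.

Lemma K2_res_deriv z : K2_res (K2_deriv z) = fderiv (K2_res z).
Proof.
have [a [b [b0 ->]]] := K2_fracP z.
rewrite K2_deriv_frac // !K2_res_frac ?rmorphXn ?expf_neq0 // fderiv_frac //.
by rewrite rmorphB !rmorphM /= !poly_res_deriv.
Qed.

Hypothesis k_perfect : forall x : k, exists y : k, y ^+ p = x.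

Lemma K2_res_eq0 z : K2_res z = 0 -> exists y, z = y *+ p.
Proof.
have [a [b [b0 ->]]] := K2_fracP z; rewrite K2_res_frac // => /eqP.
rewrite mulf_eq0 invr_eq0 !tofrac_eq0 (negbTE b0) orbF => /eqP a0.
have [r aE _] := poly_res_eq0 k_perfect a0.
by exists (K2_frac r b); rewrite K2_fracZ // aE.
Qed.

(** The difference keeps the denominator of z, and its numerator is p times a polynomial of no
    larger size. At infinity the polynomial a must be constant in order to be regular. *)
Lemma K2_regular_div x a z : closed_point x -> K2_regular x z ->
  (x = None -> (size a <= 1)%N) -> K2_res (z - K2_frac a 1) = 0 ->
  exists2 y, z - K2_frac a 1 = y *+ p & regular x (K2_res y).
Proof.
case: x => [q [_ qi] /= [c [d [qd ->]]] _|_ /= [c [d [ld cd ->]]] /(_ erefl) a1].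
  have d0 : res d != 0 by apply: contraNneq qd => ->; rewrite dvdp0.
  rewrite K2_fracB ?res1_neq0 // !mulr1 K2_res_frac // => /eqP.
  rewrite mulf_eq0 invr_eq0 !tofrac_eq0 (negbTE d0) orbF => /eqP a0.
  have [r aE _] := poly_res_eq0 k_perfect a0.
  exists (K2_frac r d); first by rewrite K2_fracZ // aE.
  by rewrite K2_res_frac //; apply: regular_frac.
have d0 : res d != 0.
  by apply: contraNneq ld => e; rewrite lead_coefE -coef_poly_res e coef0.
have szd : size (res d) = size d by apply: size_poly_eq.
have sza : (size (c - a * d)%R <= size d)%N.
  rewrite (leq_trans (size_polyD _ _)) // geq_max cd size_polyN.
  by have := size_polyMleq a d; nat_lia.
rewrite K2_fracB ?res1_neq0 // !mulr1 K2_res_frac // => /eqP.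
rewrite mulf_eq0 invr_eq0 !tofrac_eq0 (negbTE d0) orbF => /eqP a0.
have [r aE szr] := poly_res_eq0 k_perfect a0.
exists (K2_frac r d); first by rewrite K2_fracZ // aE.
rewrite K2_res_frac //; apply/regularNone_frac => //.
by rewrite szd (leq_trans (size_poly _ _)) // (leq_trans szr).
Qed.

End GenericPoint.

(** * Frobenius lifts *)

Lemma exprD_sqr0 (R : comPzRingType) (e a z : R) n : e * e = 0 ->
  (a + e * z) ^+ n = a ^+ n + n%:R * a ^+ n.-1 * z * e.
Proof.
move=> e0; elim: n => [|n IH]; first by rewrite !expr0 !mul0r addr0.
rewrite exprS IH; case: n {IH} => [|n] /=.
  by rewrite !expr0 !mul0r addr0 mulr1 expr1 !mul1r mulrC.
transitivity (a ^+ n.+2 + (n.+1%:R + 1) * a ^+ n.+1 * z * e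
              + e * e * (n.+1%:R * a ^+ n * z * z)).
  by rewrite !exprS; ring.
by rewrite e0 mul0r addr0 natr1.
Qed.

Section Pchar.
Variables (p : nat) (k : fieldType) (charkp : p \in [pchar k]).
Hypothesis p_ge3 : (3 <= p)%N.
Let pp : prime p := pcharf_prime charkp.

Lemma bin_pred_pchar j : (j < p)%N -> 'C(p.-1, j)%:R = (-1) ^+ j :> k.
Proof.
have p0 := prime_gt0 pp.
elim: j => [|j IH] jp; first by rewrite bin0 expr0.
have : ('C(p.-1, j.+1) + 'C(p.-1, j))%:R = 0 :> k.
  rewrite -binS prednK //; apply/eqP; rewrite -(dvdn_pcharf charkp).
  by apply: prime_dvd_bin.
rewrite natrD IH ?(ltnW jp) // => /eqP; rewrite addr_eq0 => /eqP ->.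
by rewrite exprS mulN1r.
Qed.

Lemma bin_div_pchar i : (0 < i < p)%N -> ('C(p, i) %/ p)%:R = (-1) ^+ i.-1 / i%:R :> k.
Proof.
move=> /andP[i0 ip]; have p0 := prime_gt0 pp.
have iN0 : i%:R != 0 :> k by apply: (natr_lt_neq0 charkp); rewrite i0.
apply: (mulIf iN0); rewrite divfK // -natrM -bin_pred_pchar ?prednK ?(ltnW ip) //.
congr (_%:R); apply/eqP; rewrite -(eqn_pmul2l p0) mulnA.
rewrite [(p * (_ %/ _))%N]mulnC divnK ?prime_dvd_bin ?i0 //.
by rewrite mulnC -[in X in X == _](prednK i0) -[in X in X == _](prednK p0) -mul_bin_diag !prednK.
Qed.

Lemma wcarry_Frob_gap (c d : k) :
  wcarry p 'X (- c%:P) + d%:P = Frob_gap p c d :> {poly k}.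
Proof.
congr (_ + _); apply: eq_big_nat => i ip; have /andP[i0 ip'] := ip.
rewrite -polyC_natr bin_div_pchar // -polyCN -polyC_exp [(- c) ^+ _]exprNn.
rewrite mulrAC -polyCM mul_polyC; congr (_ *: _).
have e : (-1) ^+ i.-1 * (-1) ^+ (p - i) = 1 :> k.
  rewrite -exprD -signr_odd (_ : odd _ = false) //.
  have -> : (i.-1 + (p - i) = p.-1)%N by nat_lia.
  by have := pchar_odd charkp p_ge3; case: (p) => //= q /negbTE.
by rewrite mulrACA e mul1r mulrC.
Qed.

End Pchar.

Section FrobeniusLift.
Variables (p : nat) (k : fieldType) (charkp : p \in [pchar k]).
Hypothesis p_ge3 : (3 <= p)%N.
Let pp : prime p := pcharf_prime charkp.
Local Notation W := (W2 charkp).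
Local Notation K := {fraction {poly k}}.
Local Notation K2 := (K2 charkp).
Local Notation "q %:F" := (tofrac q).
Local Notation res := (@poly_res p k charkp).
Local Notation t2 := (K2_frac 'X 1 : K2).
Local Notation tK := ('X%:F : K).
Implicit Types (q : {poly W}) (c : W).

(** As p is odd, (t - c)^p = t^p - c^p + p [wcarry](t, -c); the remaining sigma(c) - c^p is given by
    [W2_FrobE]. *)
Lemma lift_gap c : exists q : {poly W},
  ('X - c%:P) ^+ p + (W2_Frob c)%:P - 'X^p = q *+ p /\ res q = Frob_gap p (Wres c) c.2.
Proof.
exists (wcarry p 'X (- c%:P) + ((c.2, 0) : W)%:P); split.
  rewrite mulrnDl (wcarryE pp) W2_FrobE polyCD polyCMn polyC_exp.
  rewrite exprNn -signr_odd (pchar_odd charkp p_ge3) /=; ring.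
rewrite rmorphD /= wcarry_morph /= poly_resX rmorphN /= !poly_resC.
exact: wcarry_Frob_gap.
Qed.

Lemma K2_sqrp : p%:R * p%:R = 0 :> K2.
Proof.
rewrite mulr_natr -K2_frac1 !K2_fracZ ?res1_neq0 //.
have /eqP -> : (1 : {poly W}) *+ p *+ p == 0.
  by rewrite poly_mulrp_eq0 rmorphMn rmorph1 (pcharf0 (etrans (pchar_poly k p) charkp)).
by rewrite K2_frac0.
Qed.

Lemma K2_constD c d : K2_frac (c + d)%:P 1 = K2_frac c%:P 1 + K2_frac d%:P 1 :> K2.
Proof.
rewrite K2_fracD ?res1_neq0 //; apply: K2_frac_cross; rewrite ?resM_neq0 ?res1_neq0 //.
by rewrite polyCD; ring.
Qed.

Lemma K2_polyX q n : K2_frac (q ^+ n) 1 = K2_frac q 1 ^+ n :> K2.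
Proof.
elim: n => [|n IH]; first by rewrite !expr0 K2_frac1.
rewrite !exprS -IH K2_fracM ?res1_neq0 //.
by apply: K2_frac_cross; rewrite ?resM_neq0 ?res1_neq0 ?mulr1.
Qed.

Lemma K2_polyB q q' : K2_frac (q - q') 1 = K2_frac q 1 - K2_frac q' 1 :> K2.
Proof. by rewrite K2_fracB ?res1_neq0 // !mulr1. Qed.

Lemma K2_polyD q q' : K2_frac (q + q') 1 = K2_frac q 1 + K2_frac q' 1 :> K2.
Proof. by rewrite K2_fracD ?res1_neq0 // !mulr1. Qed.

Lemma K2_res_t : K2_res t2 = tK.
Proof. by rewrite K2_res_poly poly_resX. Qed.

Lemma K2_deriv_t_exp : K2_deriv (t2 ^+ p) = K2_frac 'X^(p.-1) 1 *+ p.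
Proof.
rewrite -K2_polyX K2_deriv_frac ?res1_neq0 // derivXn derivC mulr0 subr0 mulr1.
by rewrite expr1n K2_fracZ ?res1_neq0.
Qed.

Hypothesis k_perfect : forall x : k, exists y : k, y ^+ p = x.

Section Lift.
Variable Phi : {rmorphism K2 -> K2}.
Hypothesis PhiF : forall f, K2_res (Phi f) = K2_res f ^+ p.

Lemma K2_Teichmuller (x : k) : exists z : K2,
  Phi (K2_frac ((x, 0) : W)%:P 1) = K2_frac ((x ^+ p, 0) : W)%:P 1 + p%:R * z.
Proof.
have : K2_res (Phi (K2_frac ((x, 0) : W)%:P 1) - K2_frac ((x ^+ p, 0) : W)%:P 1) = 0.
  by rewrite rmorphB /= PhiF !K2_res_poly !poly_resC /Wres /= polyC_exp tofracXn subrr.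
by move=> /(K2_res_eq0 k_perfect)[z zE]; exists z; rewrite mulr_natl -zE addrC subrK.
Qed.

(** Semilinearity is automatic. By perfectness c = y0^p + p y1 with Teichmuller elements, whose
    images are known modulo p; this determines p-th powers and multiples of p modulo p^2. *)
Lemma lift_const c : Phi (K2_frac c%:P 1) = K2_frac (W2_Frob c)%:P 1.
Proof.
have [y0 y0E] := k_perfect c.1; have [y1 y1E] := k_perfect c.2.
have cE : c = ((y0, 0) : W) ^+ p + ((y1, 0) : W) *+ p.
  rewrite W2_expp W2_mulrp /= y0E y1E; case: (c) => a b /=; congr (_, _).
    by rewrite addr0.
  by rewrite add0r wcarry_x0 // subr0.
have [z0 z0E] := K2_Teichmuller y0; have [z1 z1E] := K2_Teichmuller y1.
rewrite {1}cE K2_constD polyC_exp K2_polyX polyCMn -K2_fracZ ?res1_neq0 //.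
rewrite rmorphD rmorphXn rmorphMn z0E z1E exprD_sqr0 ?K2_sqrp //.
have pu0 (u z : K2) : p%:R * u * z * p%:R = 0 by rewrite mulrC 2!mulrA K2_sqrp !mul0r.
have pz0 (z : K2) : (p%:R * z) *+ p = 0 by rewrite -mulr_natl mulrA K2_sqrp mul0r.
rewrite pu0 addr0 mulrnDl pz0 addr0.
rewrite W2_FrobE W2_expp K2_constD; congr (_ + _).
  by rewrite -K2_polyX -polyC_exp W2_expp /= y0E.
by rewrite y1E polyCMn -K2_fracZ ?res1_neq0.
Qed.

End Lift.

End FrobeniusLift.

Lemma mul_eq1_swap (R : comPzRingType) (a u v r s : R) :
  u * v = 1 -> r * s = 1 -> a * (u * s) = 1 -> a = v * r.
Proof.
move=> uv rs aus; transitivity (a * (u * v) * (r * s)); first by rewrite uv rs !mulr1.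
by transitivity (a * (u * s) * (v * r)); [ring | rewrite aus mul1r].
Qed.

Section FrobeniusLift.
Variables (p : nat) (k : fieldType) (charkp : p \in [pchar k]).
Hypothesis p_ge3 : (3 <= p)%N.
Let pp : prime p := pcharf_prime charkp.
Local Notation W := (W2 charkp).
Local Notation K := {fraction {poly k}}.
Local Notation K2 := (K2 charkp).
Local Notation "q %:F" := (tofrac q).
Local Notation res := (@poly_res p k charkp).
Local Notation t2 := (K2_frac 'X 1 : K2).
Local Notation tK := ('X%:F : K).
Implicit Types (q : {poly W}) (c : W).
Hypothesis k_perfect : forall x : k, exists y : k, y ^+ p = x.

Lemma div_by_p_uniq (y z : K2) : y *+ p = z *+ p -> K2_res y = K2_res z.
Proof. by move=> e; rewrite -[LHS](div_by_pE (charkp := charkp)) e div_by_pE. Qed.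

Lemma Frob_diffE n (Phi : 'I_n -> {rmorphism K2 -> K2}) (i j : 'I_n) y z :
  Phi i t2 = t2 ^+ p + y *+ p -> Phi j t2 = t2 ^+ p + z *+ p ->
  Frob_diff Phi i j = K2_res y - K2_res z.
Proof.
move=> ei ej; rewrite /Frob_diff ei ej opprD addrACA subrr add0r -mulrnBl.
by rewrite div_by_pE rmorphB.
Qed.

Lemma div_deriv_lift (Phi : {rmorphism K2 -> K2}) y :
  Phi t2 = t2 ^+ p + y *+ p ->
  div_by_p (K2_deriv (Phi t2)) = tK ^+ p.-1 + fderiv (K2_res y).
Proof.
move=> ->; rewrite K2_derivD K2_deriv_t_exp K2_deriv_mulrp -mulrnDl div_by_pE rmorphD /=.
by rewrite K2_res_deriv K2_res_poly rmorphXn /= poly_resX tofracXn.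
Qed.

Lemma K2_res_XsubC c : K2_res (K2_frac ('X - c%:P) 1) = ('X - (Wres c)%:P)%:F.
Proof.
by rewrite K2_res_poly -(poly_resX charkp) -(poly_resC c) -rmorphB.
Qed.

Lemma tK_neq0 : tK != 0.
Proof. by rewrite tofrac_eq0 polyX_eq0. Qed.

(** What a logarithmic lift imposes on g = (Phi t - t^p) / p. At a point c of D only a congruence
    modulo (t - c)^p results, because the unit in Phi(t - c) = u (t - c)^p is free; at infinity g
    may have a pole of order p. *)
Definition gap_conditions (lam : W) (Z : seq (option {poly k})) (g : K) : Prop :=
  [/\ forall x : {poly k}, closed_point (Some x) -> Some x \notin Z -> regular (Some x) g,
      forall c, Some c \in D2 lam -> reduction (Some c) \notin Z ->
        exists2 r, regular (reduction (Some c)) r &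
          g = (Frob_gap p (Wres c) c.2)%:F + (('X - (Wres c)%:P) ^+ p)%:F * r
    & None \notin Z -> regular None (g / tK ^+ p)].

Variable lam : W.
Variables (Z : seq (option {poly k})) (Phi : {rmorphism K2 -> K2}).
Hypothesis PhiL : log_Frobenius_lift lam Z Phi.

(** Reducing Phi(t - c) = u (t - c)^p shows u = 1 + p y'. With Phi(c) = sigma(c), the gap is that of
    the lift centered at c plus (t - c)^p y'. At infinity, Phi(1/t) = u t^(-p) is inverted first. *)
Lemma lift_gapP : exists y : K2, Phi t2 = t2 ^+ p + y *+ p /\
  gap_conditions lam Z (K2_res y).
Proof.
have [PhiF PhiR PhiD] := PhiL.
have [y yE] : exists y, Phi t2 - t2 ^+ p = y *+ p.
  by apply: (K2_res_eq0 k_perfect); rewrite rmorphB /= PhiF rmorphXn subrr.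
have unitE (d : option W) u : K2_res (local_eq d) != 0 ->
    Phi (local_eq d) = u * local_eq d ^+ p -> K2_res (u - K2_frac 1 1) = 0.
  move=> d0 /(congr1 (@K2_res _ _ _)); rewrite PhiF rmorphM rmorphXn /= => e.
  rewrite rmorphB /= K2_frac1 rmorph1; apply/eqP; rewrite subr_eq0; apply/eqP.
  by apply: (mulIf (expf_neq0 p d0)); rewrite -e mul1r.
have sz1 x : x = None :> option {poly k} -> (size (1%R : {poly W}) <= 1)%N by rewrite size_poly1.
exists y; split; first by rewrite -yE addrC subrK.
split.
- move=> q cq qZ.
  have rt : K2_regular (Some q) t2.
    by exists 'X, 1; split=> //; rewrite rmorph1; apply: irr_ndvd1; case: cq.
  have [||y' y'E ry'] := @K2_regular_div _ _ charkp k_perfect _ 'X^p _ cq (PhiR _ _ cq qZ rt) => //.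
    by rewrite rmorphB /= PhiF K2_res_t K2_res_poly rmorphXn /= poly_resX tofracXn subrr.
  by rewrite (@div_by_p_uniq y y') // -yE -y'E K2_polyX.
- move=> c cD cZ; have [u [v [ru rv uv e]]] := PhiD _ cD cZ.
  have d0 : K2_res (local_eq (Some c)) != 0.
    by rewrite K2_res_XsubC tofrac_eq0 polyXsubC_eq0.
  have u1 := unitE _ _ d0 e.
  have cx : closed_point (reduction (Some c)) by apply: closed_rat_point.
  have [y' y'E ry'] := K2_regular_div k_perfect cx ru (sz1 _) u1.
  exists (K2_res y'); first by [].
  have [q [qE qres]] := lift_gap p_ge3 c.
  have PhitE : Phi t2 = u * K2_frac ('X - c%:P) 1 ^+ p + K2_frac (W2_Frob c)%:P 1.
    have <- := lift_const k_perfect PhiF c; rewrite -[X in X + _]e -rmorphD.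
    by rewrite -K2_polyD subrK.
  have := @div_by_p_uniq y (K2_frac q 1 + K2_frac ('X - c%:P) 1 ^+ p * y').
  rewrite rmorphD rmorphM rmorphXn /= [K2_res (K2_frac q 1)]K2_res_poly qres K2_res_XsubC.
  rewrite tofracXn => -> //; rewrite -yE PhitE.
  have -> : u = K2_frac 1 1 + y' *+ p by rewrite -y'E addrC subrK.
  rewrite K2_frac1 mulrDl mul1r mulrnDl K2_fracZ ?res1_neq0 // -qE.
  rewrite [K2_frac (_ - 'X^p) 1]K2_polyB [K2_frac (_ + (W2_Frob c)%:P) 1]K2_polyD !K2_polyX mulrnAl [y' * _]mulrC.
  by rewrite -!addrA; congr (_ + _); rewrite addrC -addrA.
- move=> iZ; have iD : None \in D2 lam by rewrite !inE.
  have [u [v [ru rv uv e]]] := PhiD _ iD iZ.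
  have resX0 : res 'X != 0 by rewrite poly_resX polyX_eq0.
  have tt : t2 * K2_frac 1 'X = 1.
    rewrite K2_fracM ?res1_neq0 // -K2_frac1; apply: K2_frac_cross;
    by rewrite ?resM_neq0 ?res1_neq0 ?mulr1 ?mul1r.
  have ttP : t2 ^+ p * K2_frac 1 'X ^+ p = 1 by rewrite -exprMn tt expr1n.
  have vE : Phi t2 = v * t2 ^+ p.
    have P1 : Phi t2 * Phi (K2_frac 1 'X) = 1 by rewrite -rmorphM tt rmorph1.
    by apply: mul_eq1_swap uv ttP _; rewrite -P1 -e.
  have v1 : K2_res (v - K2_frac 1 1) = 0.
    have /(congr1 (@K2_res _ _ _)) := vE; rewrite PhiF rmorphM rmorphXn /= => e'.
    rewrite rmorphB /= K2_frac1 rmorph1; apply/eqP; rewrite subr_eq0; apply/eqP.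
    have t0 : K2_res t2 != 0 by rewrite K2_res_t tK_neq0.
    by apply: (mulIf (expf_neq0 p t0)); rewrite -e' mul1r.
  have [y' y'E ry'] := @K2_regular_div _ _ charkp k_perfect None 1 v I rv (sz1 _) v1.
  have -> : K2_res y = K2_res y' * tK ^+ p.
    rewrite -(K2_res_t charkp) -rmorphXn -rmorphM; apply: div_by_p_uniq.
    rewrite -yE vE -mulrnAl -y'E K2_frac1 mulrBl mul1r //.
  by rewrite mulfK ?expf_neq0 ?tK_neq0.
Qed.

End FrobeniusLift.

(** * Frobenius lifts centered at a point *)

Section StandardLift.
Variables (p : nat) (k : fieldType) (charkp : p \in [pchar k]).
Hypothesis p_ge3 : (3 <= p)%N.
Let pp : prime p := pcharf_prime charkp.
Local Notation W := (W2 charkp).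
Local Notation K := {fraction {poly k}}.
Local Notation K2 := (K2 charkp).
Local Notation "q %:F" := (tofrac q).
Local Notation res := (@poly_res p k charkp).
Local Notation t2 := (K2_frac 'X 1 : K2).
Implicit Types (a b q : {poly W}) (c : W).

Lemma K2_map_exists (psi : {rmorphism {poly W} -> {poly W}}) :
    (forall q, res (psi q) = res q ^+ p) ->
  exists Phi : {rmorphism K2 -> K2},
    forall a b, res b != 0 -> Phi (K2_frac a b) = K2_frac (psi a) (psi b).
Proof.
move=> psiF; have psi0 b : res b != 0 -> res (psi b) != 0.
  by move=> b0; rewrite psiF expf_neq0.
pose f (z : K2) : K2 := let: (a, b) := prefrac_val (repr z) in K2_frac (psi a) (psi b).
have fE a b : res b != 0 -> f (K2_frac a b) = K2_frac (psi a) (psi b).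
  move=> b0; rewrite /f; have := reprK (K2_frac a b).
  case: (repr _) => -[c d] /= d0; rewrite -(@K2_frac_pi _ _ _ c d d0).
  move=> /(K2_frac_eq _ _ d0 b0)[u u0 /(congr1 psi)].
  rewrite rmorphM rmorphB !rmorphM rmorph0 => e.
  by apply/K2_frac_eq; rewrite ?psi0 //; exists (psi u); rewrite ?psi0.
have fB : zmod_morphism f.
  move=> y z; have [a [b [b0 ->]]] := K2_fracP y; have [c [d [d0 ->]]] := K2_fracP z.
  by rewrite K2_fracB // !fE ?resM_neq0 // K2_fracB ?psi0 // rmorphB !rmorphM.
have fM : monoid_morphism f.
  split; first by rewrite -K2_frac1 fE ?res1_neq0 // rmorph1.
  move=> y z; have [a [b [b0 ->]]] := K2_fracP y; have [c [d [d0 ->]]] := K2_fracP z.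
  by rewrite K2_fracM // !fE ?resM_neq0 // K2_fracM ?psi0 // !rmorphM.
pose fZ := GRing.isZmodMorphism.Build _ _ f fB.
pose fR := GRing.isMonoidMorphism.Build _ _ f fM.
pose Phi : {rmorphism K2 -> K2} := HB.pack f fZ fR.
by exists Phi; exact: fE.
Qed.

Definition std_num c : {poly W} := ('X - c%:P) ^+ p + (W2_Frob c)%:P.

(** By [lift_const], every Frobenius lift acts on constants by [W2_Frob]. With t sent to
    [std_num c], the section t - c goes to (t - c)^p. *)
Definition std_lift c q : {poly W} := map_poly (@W2_Frob p k charkp) q \Po std_num c.

HB.instance Definition _ c :=
  GRing.RMorphism.copy (std_lift c) (comp_poly (std_num c) \o map_poly (@W2_Frob p k charkp)).

Lemma res_std_num c : res (std_num c) = 'X^p.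
Proof.
have [q [qE _]] := lift_gap p_ge3 c.
have e : std_num c = 'X^p + q *+ p by rewrite -qE addrC subrK.
rewrite e rmorphD rmorphXn /= poly_resX.
by rewrite rmorphMn -mulr_natr (pcharf0 (etrans (pchar_poly k p) charkp)) mulr0 addr0.
Qed.

Lemma std_liftX c : std_lift c 'X = std_num c.
Proof. by rewrite /std_lift map_polyX comp_polyX. Qed.

Lemma std_liftC c d : std_lift c d%:P = (W2_Frob d)%:P.
Proof. by rewrite /std_lift map_polyC comp_polyC. Qed.

Lemma res_std_lift c q : res (std_lift c q) = res q ^+ p.
Proof.
elim/poly_ind: q => [|q d IH].
  by rewrite !rmorph0 expr0n gtn_eqF ?prime_gt0.
rewrite rmorphD rmorphM /= std_liftX std_liftC !rmorphD !rmorphM /= IH res_std_num.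
rewrite !poly_resC poly_resX exprDn_pchar ?(pchar_pnat charkp) // exprMn.
by rewrite Wres_Frob polyC_exp.
Qed.

Lemma std_num0 : std_num 0 = 'X^p.
Proof. by rewrite /std_num [W2_Frob 0]rmorph0 !polyC0 subr0 addr0. Qed.

(** For c = 0 the substitution is t |-> t^p, which multiplies degrees by p when the leading
    coefficient is a unit. Hence regularity at infinity is preserved. *)
Lemma size_std_lift0 q : (size (std_lift 0%R q) <= ((size q).-1 * p).+1)%N.
Proof.
have -> : std_lift 0 q = map_poly (@W2_Frob p k charkp) q \Po 'X^p.
  by rewrite /std_lift std_num0.
rewrite (leq_trans (size_comp_poly_leq _ _)) // size_polyXn /= ltnS leq_mul2r.
by rewrite -!subn1 leq_sub2r ?orbT // size_poly.
Qed.

Lemma coef_std_lift0 q : (std_lift 0 q)`_((size q).-1 * p) = W2_Frob (lead_coef q).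
Proof.
have -> : std_lift 0 q = map_poly (@W2_Frob p k charkp) q \Po 'X^p.
  by rewrite /std_lift std_num0.
by rewrite coef_comp_poly_Xn ?prime_gt0 // dvdn_mull // mulnK ?prime_gt0 // coef_map lead_coefE.
Qed.

Lemma std_lift_exists c : exists2 Phi : {rmorphism K2 -> K2},
  exists2 y, Phi t2 = t2 ^+ p + y *+ p & K2_res y = (Frob_gap p (Wres c) c.2)%:F &
  [/\ forall z, K2_res (Phi z) = K2_res z ^+ p,
      forall x : {poly k}, closed_point (Some x) -> forall z,
        K2_regular (Some x) z -> K2_regular (Some x) (Phi z),
      Phi (K2_frac ('X - c%:P) 1) = K2_frac ('X - c%:P) 1 ^+ p &
      c = 0 -> (forall z, K2_regular None z -> K2_regular None (Phi z)) /\
               Phi (K2_frac 1 'X) = K2_frac 1 'X ^+ p].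
Proof.
have [Phi PhiE] := K2_map_exists (res_std_lift c).
exists Phi.
  have [q [qE qres]] := lift_gap p_ge3 c.
  exists (K2_frac q 1); last by rewrite K2_res_poly qres.
  rewrite PhiE ?res1_neq0 // rmorph1 /= std_liftX -K2_polyX K2_fracZ ?res1_neq0 //.
  by rewrite -K2_polyD -qE addrC subrK.
split.
- move=> z; have [a [b [b0 ->]]] := K2_fracP z.
  rewrite PhiE // !K2_res_frac ?res_std_lift ?expf_neq0 //.
  by rewrite expr_div_n !tofracXn.
- move=> x [_ xi] z [a [b [xb ->]]].
  have b0 : res b != 0 := ndvd_neq0 xb.
  exists (std_lift c a), (std_lift c b); split; last by rewrite PhiE.
  by rewrite res_std_lift; apply: contra xb; apply: irr_dvdp_exp.
- rewrite PhiE ?res1_neq0 // rmorph1 rmorphB /= std_liftX std_liftC /std_num addrK.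
  exact: K2_polyX.
- move=> c0; split.
    move=> z [a [b [lb ab ->]]].
    have b0 : res b != 0.
      by apply: contraNneq lb => e; rewrite lead_coefE -coef_poly_res e coef0.
    have szb : size (std_lift 0%R b) = ((size b).-1 * p).+1.
      apply/anti_leq; rewrite size_std_lift0 /= ltnNge; apply/negP => /leq_sizeP/(_ _ (leqnn _)).
      rewrite coef_std_lift0 => /(congr1 (@Wres _ _ _)); rewrite Wres_Frob rmorph0 => /eqP.
      by rewrite expf_eq0 (negbTE lb) andbF.
    exists (std_lift c a), (std_lift c b); split; last by rewrite PhiE.
      rewrite c0 lead_coefE szb /= coef_std_lift0 Wres_Frob.
      by rewrite expf_neq0.
    rewrite c0 szb (leq_trans (size_std_lift0 _)) // ltnS leq_mul2r.
    by rewrite -!subn1 leq_sub2r ?orbT.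
  have X0 : res 'X != 0 by rewrite poly_resX polyX_eq0.
  rewrite PhiE // rmorph1 /= std_liftX c0 std_num0.
  have -> n : K2_frac 1 'X ^+ n = K2_frac 1 'X^n :> K2; last by [].
  elim: n => [|n IH]; first by rewrite !expr0 K2_frac1.
  by rewrite !exprS IH K2_fracM ?rmorphXn ?expf_neq0 // mulr1.
Qed.

End StandardLift.

(** * The rational map *)

Definition proj_pt (k : fieldType) (x y : k) : option k :=
  if y == 0 then None else Some (x / y).

Lemma proj_ptZ (k : fieldType) (c x y : k) : c != 0 -> proj_pt (c * x) (c * y) = proj_pt x y.
Proof.
move=> c0; rewrite /proj_pt mulf_eq0 (negbTE c0) /=; case: eqP => // _.
by rewrite -mulf_div divff // mul1r.
Qed.

(** Evaluation of the minors at a = infinity: taking coefficients of maximal degree is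
    multiplicative, so it commutes with the Leibniz expansion. *)
Lemma size_det_coef (k : fieldType) n d (M : 'M[{poly k}]_n) :
  (forall i j, (size (M i j) <= d.+1)%N) ->
  (size (\det M) <= (n * d).+1)%N /\
  (\det M)`_(n * d) = \det (map_mx (fun q : {poly k} => q`_d) M).
Proof.
move=> Md.
have P (I : finType) (F : I -> {poly k}) : (forall i, (size (F i) <= d.+1)%N) ->
    (size (\prod_i F i)%R <= (#|I| * d).+1)%N /\
    (\prod_i F i)`_(#|I| * d) = \prod_i (F i)`_d.
  move=> Fd; rewrite cardE -!(big_enum _ _ _ F) -(big_enum _ _ _ (fun i => (F i)`_d)) /=.
  elim: (enum I) => [|i s [IHs IHc]]; first by rewrite !big_nil mul0n size_poly1 coef1.
  rewrite !big_cons /= mulSn; split; last by rewrite coefM_top // IHc.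
  have := size_polyMleq (F i) (\prod_(j <- s) F j); have := Fd i; nat_lia.
have P' (s : {perm 'I_n}) := P _ (fun i => M i (s i)) (fun i => Md i (s i)).
split.
  apply/leq_sizeP => j nj; rewrite coef_sum big1 // => s _.
  have [+ _] := P' s; rewrite card_ord => szs.
  rewrite mulr_sign; case: (odd_perm s); rewrite ?coefN nth_default ?oppr0 //; exact: leq_trans szs nj.
rewrite coef_sum; apply: eq_bigr => s _.
have [_] := P' s; rewrite card_ord => cs.
have -> : \prod_i map_mx (fun q : {poly k} => q`_d) M i (s i) = \prod_i (M i (s i))`_d.
  by apply: eq_bigr => i _; rewrite mxE.
by rewrite !mulr_sign; case: (odd_perm s); rewrite ?coefN cs.
Qed.

Section Phi.
Variables (p : nat) (k : fieldType) (charkp : p \in [pchar k]).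
Hypothesis p_ge3 : (3 <= p)%N.
Let pp : prime p := pcharf_prime charkp.
Variable l : k.
Hypotheses (l_neq0 : l != 0) (l_neq1 : l != 1).
Let m := p.-1./2.
Local Notation K := {fraction {poly k}}.


Definition delta_poly n : {poly k} := n%:R^-1 *:
  ((l ^+ p)%:P * (1 - 'X^p) - ((l ^+ p)%:P - 'X^p) * (l ^+ n)%:P).

Lemma deltaE n : delta p l n = tofrac (delta_poly n).
Proof.
rewrite /delta /delta_poly -mul_polyC mulrC tofracM; congr (_ * _).
  have -> : n%:R = tofrac n%:R%:P :> K by rewrite polyC_natr rmorph_nat.
  have [n0|n0] := eqVneq (n%:R : k) 0; first by rewrite n0 !invr0 polyC0 tofrac0.
  apply: (mulfI (x := tofrac n%:R%:P)); first by rewrite tofrac_eq0 polyC_eq0.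
  by rewrite divff ?tofrac_eq0 ?polyC_eq0 // -tofracM -polyCM divff // tofrac1.
by rewrite !(tofracB, tofracM, tofrac1, tofracXn, polyC_exp).
Qed.

Lemma horner_delta n c : (delta_poly n).[c] = Hdelta p l (c ^+ p) 1 n.
Proof.
rewrite /delta_poly /Hdelta hornerZ mulrC; congr (_ / _).
by rewrite !hornerE.
Qed.

(** The top coefficient is the value at infinity, with homogeneous coordinates (1, 0). *)
Lemma coef_delta n : (delta_poly n)`_p = Hdelta p l 1 0 n.
Proof.
have p0 : (0 < p)%N := prime_gt0 pp.
rewrite /delta_poly /Hdelta coefZ mulrC; congr (_ / _).
rewrite coefB coefCM coefMC !coefB coef1 coefXn coefC eqxx (gtn_eqF p0) /=; ring.
Qed.

Lemma size_delta n : (size (delta_poly n) <= p.+1)%N.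
Proof.
rewrite (leq_trans (size_scale_leq _ _)) //; apply/leq_sizeP => j pj.
rewrite coefB coefCM coefMC !coefB coef1 coefXn coefC.
have -> : (j == 0)%N = false by apply/negP => /eqP j0; rewrite j0 in pj.
by rewrite (gtn_eqF pj) !subr0 mulr0 mul0r subr0.
Qed.

Definition delta_mx_poly : 'M[{poly k}]_(m, m.+1) :=
  \matrix_(i < m, j < m.+1) delta_poly (m - i.+1 + j.+1).

Let N0 := \det (col' ord0 delta_mx_poly).
Let D0 := \det (col' ord_max delta_mx_poly).

Lemma horner_minor c j :
  (\det (col' j delta_mx_poly)).[c] = \det (col' j (Hmx p l (c ^+ p) 1)).
Proof.
rewrite -/(horner_eval c _) -det_map_mx; congr (\det _).
by apply/matrixP => r s; rewrite !mxE /= /horner_eval horner_delta.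
Qed.

Lemma size_minor j : (size (\det (col' j delta_mx_poly)) <= (m * p).+1)%N /\
  (\det (col' j delta_mx_poly))`_(m * p) = \det (col' j (Hmx p l 1 0)).
Proof.
have [r s|-> ->] := @size_det_coef k _ p (col' j delta_mx_poly).
  by rewrite !mxE size_delta.
by split=> //; congr (\det _); apply/matrixP => r s; rewrite !mxE coef_delta.
Qed.

Let A : 'M[K]_(m, m.+1) := \matrix_(i < m, j < m.+1) delta p l (m - i.+1 + j.+1).
Let phi : K :=
  tofrac 'X ^+ p / tofrac l%:P ^+ p.-1 * (\det (col' ord0 A) / \det (col' ord_max A)) ^+ 2.

Lemma det_minor j : \det (col' j A) = tofrac (\det (col' j delta_mx_poly)).
Proof.
rewrite -det_map_mx; congr (\det _); apply/matrixP => r s.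
by rewrite !mxE deltaE.
Qed.

Lemma phiE : phi = tofrac ('X^p * N0 ^+ 2) / tofrac ((l ^+ p.-1)%:P * D0 ^+ 2).
Proof.
rewrite /phi !det_minor !(tofracM, tofracXn) polyC_exp tofracXn expr_div_n.
by rewrite mulf_div.
Qed.

(** At a = 0 one has [al0 = 0], so [Hmx_ker_ends] makes the last coordinate of the kernel vector
    nonzero, and with it the minor without the last column. *)
Lemma D0_neq0 : D0 != 0.
Proof.
have [v v0 vK] := Hmx_ker_exists p l 0 1.
have al : (0 != 0 :> k) || (1 != 0 :> k) by rewrite oner_neq0 orbT.
(* [Hmx] is independent of the second Witt components, so the sections used as witnesses may be
   taken with [d1 = dl = 0]. *)
have vm := Hmx_ker_ends charkp p_ge3 0 0 l_neq0 l_neq1 al vK v0.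
rewrite mul0r eqxx orbF mul1r in vm.
have [nu nu0 dE] := Hmx_minors charkp p_ge3 0 0 l_neq0 l_neq1 al vK v0.
have p0 : (0 < p)%N := prime_gt0 pp.
have : D0.[0] != 0.
  have : D0.[0] ^+ 2 != 0.
    by rewrite horner_minor expr0n (gtn_eqF p0) dE mulf_neq0 ?expf_neq0.
  by rewrite expf_eq0.
by apply: contraNneq => ->; rewrite horner0.
Qed.

Lemma HmxZ c al0 al1 : Hmx p l (c * al0) (c * al1) = c *: Hmx p l al0 al1.
Proof. by apply/matrixP => r s; rewrite !mxE /Hdelta; ring. Qed.

(** Any kernel vector computes the squared minors up to a common [nu], which cancels in homogeneous
    coordinates. [Hmx_ker_ends] excludes a common zero of numerator and denominator, so that a can
    be substituted. At infinity the degrees decide: p + 2 m p for the numerator against at most 2 m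
    p. *)
Lemma ratmap_phi (a0 a1 : k) (v : 'cV[k]_m.+1) :
    (a0 != 0) || (a1 != 0) -> v != 0 -> Hmx p l (a0 ^+ p) (a1 ^+ p) *m v = 0 ->
  ratmap phi (proj_pt a0 a1) =
  proj_pt (a0 ^+ p * v 0 0 ^+ 2 / l ^+ p.-1) (a1 ^+ p * v ord_max 0 ^+ 2).
Proof.
move=> a01 v0 vK; have p0 : (0 < p)%N := prime_gt0 pp.
have lp0 : l ^+ p.-1 != 0 by rewrite expf_neq0.
have D'0 : (l ^+ p.-1)%:P * D0 ^+ 2 != 0.
  by rewrite mulf_neq0 ?polyC_eq0 ?expf_neq0 // D0_neq0.
rewrite phiE {1}/proj_pt; have [a1E|a1N] := eqVneq a1 0.
  rewrite a1E expr0n (gtn_eqF p0) mul0r /proj_pt eqxx ratmap_None //.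
  rewrite a1E eqxx orbF in a01.
  have al : (1 != 0 :> k) || (0 != 0 :> k) by rewrite oner_neq0.
  have vK' : Hmx p l 1 0 *m v = 0.
    have := vK; rewrite a1E expr0n (gtn_eqF p0) -[a0 ^+ p]mulr1 -[X in Hmx _ _ _ X](mulr0 (a0 ^+ p)).
    rewrite HmxZ -scalemxAl => /eqP; rewrite scaler_eq0 expf_eq0 (negbTE a01) andbF /=.
    by move/eqP.
  have := Hmx_ker_ends charkp p_ge3 0 0 l_neq0 l_neq1 al vK' v0.
  rewrite mul0r eqxx mul1r /= => v00.
  have [nu nu0 dE] := Hmx_minors charkp p_ge3 0 0 l_neq0 l_neq1 al vK' v0.
  have [szN cN] := size_minor ord0; have [szD _] := size_minor ord_max.
  have szN0 : size N0 = (m * p).+1.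
    apply/anti_leq; rewrite szN ltnNge; apply/negP => /leq_sizeP/(_ _ (leqnn _)).
    rewrite cN => e; have := dE ord0; rewrite e expr0n /= => /esym/eqP.
    by rewrite mulf_eq0 (negbTE nu0) expf_eq0 (negbTE v00) andbF.
  have N00 : N0 != 0 by rewrite -size_poly_eq0 szN0.
  rewrite mul_polyC size_scale // mulrC size_mulXn ?expf_neq0 // !expr2 (size_mul N00 N00) szN0.
  have := size_polyMleq D0 D0; rewrite -/D0 in szD; nat_lia.
have := vK; have -> : Hmx p l (a0 ^+ p) (a1 ^+ p) = a1 ^+ p *: Hmx p l ((a0 / a1) ^+ p) 1.
  by rewrite -HmxZ mulr1 expr_div_n mulrC divfK ?expf_neq0.
rewrite -scalemxAl => /eqP; rewrite scaler_eq0 expf_eq0 (negbTE a1N) andbF /= => /eqP vK'.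
set c := a0 / a1 in vK' *.
have al : (c ^+ p != 0) || (1 != 0 :> k) by rewrite oner_neq0 orbT.
have ends := Hmx_ker_ends charkp p_ge3 0 0 l_neq0 l_neq1 al vK' v0.
have [nu nu0 dE] := Hmx_minors charkp p_ge3 0 0 l_neq0 l_neq1 al vK' v0.
have nE : ('X^p * N0 ^+ 2).[c] = nu * (c ^+ p * v 0 0 ^+ 2).
  by rewrite hornerM hornerXn horner_exp horner_minor dE; ring.
have dE' : ((l ^+ p.-1)%:P * D0 ^+ 2).[c] = nu * (l ^+ p.-1 * v ord_max 0 ^+ 2).
  by rewrite hornerM hornerC horner_exp horner_minor dE; ring.
rewrite ratmap_Some //; last first.
  rewrite nE dE'; have [vm|v00] := orP ends; apply/orP; [right|left].
    by rewrite !mulf_neq0 ?expf_neq0 //; rewrite mul1r in vm.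
  by move: v00; rewrite mulf_eq0 negb_or => /andP[cN vN]; rewrite mulf_neq0 // mulf_neq0 // expf_neq0.
rewrite nE dE' -[LHS]/(proj_pt _ _) proj_ptZ //.
have -> : a0 ^+ p = a1 ^+ p * c ^+ p by rewrite /c expr_div_n mulrC divfK ?expf_neq0.
rewrite -[in RHS](proj_ptZ _ _ (c := l ^+ p.-1 / a1 ^+ p)).
  have u0 : a1 ^+ p != 0 by rewrite expf_neq0.
  congr proj_pt; move: (l ^+ p.-1) (a1 ^+ p) lp0 u0 => w u w0 u0.
    by field; rewrite w0 u0.
  by field; rewrite u0.
by rewrite mulf_neq0 ?invr_eq0 ?expf_neq0.
Qed.

End Phi.

(** * Logarithmic Higgs fields *)

Section HiggsFields.
Variables (p : nat) (k : fieldType) (charkp : p \in [pchar k]).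
Variable lam : W2 charkp.
Local Notation l := (Wres lam).
Hypotheses (l_neq0 : l != 0) (l_neq1 : l != 1).
Local Notation K := {fraction {poly k}}.
Local Notation "q %:F" := (tofrac q).
Local Notation tK := ('X%:F : K).
Implicit Types (q : {poly k}) (x : option {poly k}) (w th : K) (a : k).

Definition Delta : {poly k} := 'X * ('X - 1%:P) * ('X - l%:P).

Lemma D1E : D1 lam = [:: Some ('X - 0%:P); Some ('X - 1%:P); Some ('X - l%:P); None].
Proof. by []. Qed.

Lemma mem_D1 x : (x \in D1 lam) = [|| x == Some ('X - 0%:P), x == Some ('X - 1%:P),
  x == Some ('X - l%:P) | x == None].
Proof. by rewrite D1E !in_cons in_nil orbF. Qed.

Lemma XsubC_inj (c d : k) : 'X - c%:P = 'X - d%:P -> c = d.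
Proof. by move=> /addrI/oppr_inj/polyC_inj. Qed.

Lemma closed_dvdp_XsubC q c : closed_point (Some q) -> (q %| 'X - c%:P) = (q == 'X - c%:P).
Proof.
case=> qm qi; apply/idP/eqP => [qc|->]; last exact: dvdpp.
have q1 : size q != 1 by case: qi; case: (size q) => [|[]].
have := apply_irredp (irredp_XsubC c) q1 qc.
by rewrite eqp_monic ?monicXsubC // => /eqP.
Qed.

Lemma Delta_neq0 : Delta != 0.
Proof. by rewrite !mulf_neq0 ?polyX_eq0 ?polyXsubC_eq0. Qed.

Lemma size_Delta : size Delta = 4.
Proof.
rewrite /Delta size_Mmonic ?monicXsubC ?mulf_neq0 ?polyX_eq0 ?polyXsubC_eq0 //.
rewrite size_Mmonic ?monicXsubC ?polyX_eq0 //.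
by rewrite size_polyX !size_XsubC.
Qed.

Lemma regular_unit_mul q (u : {poly k}) w : closed_point (Some q) -> ~~ (q %| u) ->
  regular (Some q) (u%:F * w) <-> regular (Some q) w.
Proof.
move=> cq qu; have u0 := ndvd_neq0 qu; split=> [r|].
  have -> : w = 1%:F / u%:F * (u%:F * w).
    by rewrite tofrac1 mul1r mulKf ?tofrac_eq0.
  by apply: regularM r => //; apply: regular_frac.
by apply: regularM => //; apply: regular_poly; case: cq.
Qed.

(* Dt / D is a local generator of the logarithmic forms *)
Lemma Omega_logE x w : closed_point x -> Omega_log (D1 lam) x w <->
  regular x (if x is Some _ then Delta%:F * w else tK * w).
Proof.
rewrite /Omega_log mem_D1; case: x => [q|] cq; last first.
  rewrite eqxx !orbT /Omega; have -> : tK^-1 * w * tK ^+ 2 = tK * w; last by split.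
  by rewrite mulrAC expr2 mulrA mulVf ?mul1r // tofrac_eq0 polyX_eq0.
have dvd c := closed_dvdp_XsubC c cq.
have XE : 'X = 'X - 0%:P :> {poly k} by rewrite polyC0 subr0.
have ndvdM (u v : {poly k}) : ~~ (q %| u) -> ~~ (q %| v) -> ~~ (q %| u * v).
  by case: cq => _ qi ? ?; rewrite irr_dvdp_mul // negb_or; apply/andP.
have ne c d : c != d -> q = 'X - c%:P -> ~~ (q %| 'X - d%:P).
  by move=> cd qE; rewrite dvd qE; apply: contra cd => /eqP/XsubC_inj ->.
have -> : (Some q == None) = false by apply/eqP.
have key u : ~~ (q %| u) -> Delta = u * q ->
    regular (Some q) (q%:F * w) <-> regular (Some q) (Delta%:F * w).
  by move=> qu ->; rewrite tofracM -mulrA; symmetry; apply: regular_unit_mul.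
rewrite /Omega orbF; case: ifP.
  case/or3P => /eqP [qE].
  - apply: (key (('X - 1%:P) * ('X - l%:P))); last by rewrite qE /Delta {1}XE; ring.
    by apply: ndvdM; apply: (ne 0) => //; rewrite eq_sym ?oner_neq0.
  - apply: (key ('X * ('X - l%:P))); last by rewrite qE /Delta; ring.
    by rewrite {1}XE; apply: ndvdM; apply: (ne 1) => //; rewrite ?oner_neq0 // eq_sym.
  - apply: (key ('X * ('X - 1%:P))); last by rewrite qE.
    by rewrite {1}XE; apply: ndvdM; apply: (ne l).
move=> /negbT; rewrite !negb_or => /and3P[n0 n1 nl].
have ndvd c : Some q != Some ('X - c%:P) -> ~~ (q %| 'X - c%:P).
  by rewrite dvd; apply: contra => /eqP ->.
symmetry; apply: regular_unit_mul => //; apply: (ndvdM _ _ (ndvdM _ _ _ _)); try exact: ndvd.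
by rewrite XE; apply: ndvd.
Qed.

Definition Higgs_num (a0 a1 : k) : {poly k} := a1 *: 'X - a0%:P.
Definition Higgs_form (a0 a1 : k) : K := (Higgs_num a0 a1)%:F / Delta%:F.

Lemma coef_Higgs_num (a0 a1 : k) : (Higgs_num a0 a1)`_0 = - a0 /\ (Higgs_num a0 a1)`_1 = a1.
Proof. by rewrite !coefB !coefZ !coefX !coefC /= mulr0 sub0r mulr1 subr0. Qed.

Lemma Higgs_num_neq0 (a0 a1 : k) : (a0 != 0) || (a1 != 0) -> Higgs_num a0 a1 != 0.
Proof.
have [c0 c1] := coef_Higgs_num a0 a1; apply: contraTneq => e.
by move: c0 c1; rewrite e !coef0 => /eqP; rewrite eq_sym oppr_eq0 => /eqP -> <-; rewrite eqxx.
Qed.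

Lemma size_Higgs_num (a0 a1 : k) : (size (Higgs_num a0 a1) <= 2)%N.
Proof.
rewrite (leq_trans (size_polyD _ _)) // size_polyN geq_max (leq_trans (size_scale_leq _ _)) ?size_polyX //.
exact: leq_trans (size_polyC_leq1 _) _.
Qed.

Lemma Higgs_formP (a0 a1 : k) : (a0 != 0) || (a1 != 0) ->
  log_Higgs_field (D1 lam) (Higgs_form a0 a1) /\
  Higgs_zero (D1 lam) (Higgs_form a0 a1) (proj_pt a0 a1).
Proof.
move=> a01; have L0 := Higgs_num_neq0 a01; have D0 := Delta_neq0.
have DF0 : Delta%:F != 0 :> K by rewrite tofrac_eq0.
have LF0 : (Higgs_num a0 a1)%:F != 0 :> K by rewrite tofrac_eq0.
have tF0 : tK != 0 by rewrite tofrac_eq0 polyX_eq0.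
have DhE f : Delta%:F * (Higgs_form a0 a1 * f) = (Higgs_num a0 a1)%:F * f.
  have id0 (F : fieldType) (D L g : F) : D != 0 -> D * (L / D * g) = L * g by move=> ?; field.
  exact: (id0 K Delta%:F (Higgs_num a0 a1)%:F f DF0).
have h0 : Higgs_form a0 a1 != 0 by rewrite /Higgs_form; exact: (mulf_neq0 LF0 (invr_neq0 DF0)).
split.
  split; first exact: h0.
  move=> x f cx Of; apply/(Omega_logE _ cx); case: x cx Of => [q|] cq /= Of.
    by rewrite DhE; apply: (regularM cq _ Of); apply: regular_poly; case: cq.
  have id0 (F : fieldType) (t L D g : F) : t != 0 -> D != 0 ->
      t * (L / D * g) = L * t ^+ 2 / D * (g / t ^+ 1).
    by move=> t0 d0; field; rewrite t0 d0.
  rewrite /Higgs_form (id0 K tK (Higgs_num a0 a1)%:F Delta%:F f tF0 DF0) -tofracXn -tofracM.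
  apply: (regularM cq _ Of); apply/(regularNone_frac _ D0).
  have := size_polyMleq (Higgs_num a0 a1) ('X ^+ 2).
  by rewrite size_polyXn size_Delta; have := size_Higgs_num a0 a1; nat_lia.
have hf w f : w = Higgs_form a0 a1 * f -> f = w / Higgs_form a0 a1.
  by move=> ->; rewrite mulrC (mulKf h0).
case=> [q|] cx.
  apply: (@iff_trans _ (~~ (q %| Higgs_num a0 a1))).
    split=> [H|qL w /Omega_logE - /(_ cx) rw]; last first.
      exists (1%:F / (Higgs_num a0 a1)%:F * (Delta%:F * w)).
        by apply: (regularM cx _ rw); apply: regular_frac.
      have id0 (F : fieldType) (L D g : F) : L != 0 -> D != 0 -> g = L / D * (1 / L * (D * g)).
        by move=> ? ?; field; apply/andP.
      by rewrite tofrac1; exact: (id0 K (Higgs_num a0 a1)%:F Delta%:F w LF0 DF0).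
    (* The test form is the generator dt / [Delta]: a preimage f of it satisfies 1 = L f with L the
       numerator, impossible for regular f if q divides L. *)
    have [|f Of fE] := H (1%:F / Delta%:F).
      by apply/(Omega_logE _ cx); rewrite tofrac1 mul1r (divff DF0); apply: regular1.
    apply/negP => /dvdpP[u uE]; have [_ qi] := cx.
    have id0 (F : fieldType) (L D g : F) : D != 0 -> 1 / D = L / D * g -> 1 = L * g.
      by move=> d0 e; transitivity (1 / D * D); [field | rewrite e; field].
    have e : 1%:F = (q ^+ 1)%:F * (u%:F * f) :> K.
      rewrite mulrA -tofracM expr1 mulrC [q * u]mulrC -uE mulrC tofrac1.
      by apply: (id0 K (Higgs_num a0 a1)%:F Delta%:F f DF0); rewrite -tofrac1.
    have R := regularM cx (regular_poly qi u) Of.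
    by have := regular_dvdp qi R e; rewrite expr1 (negbTE (irr_ndvd1 qi)).
  rewrite /proj_pt; have [a10|a1N] := eqVneq a1 0.
    split=> // _; rewrite /Higgs_num a10 scale0r sub0r dvdpNr.
    rewrite a10 eqxx orbF in a01.
    rewrite -[a0]mulr1 polyCM mul_polyC dvdpZr // polyC1.
    by case: cx => _ /irr_ndvd1.
  have -> : Higgs_num a0 a1 = a1 *: ('X - (a0 / a1)%:P).
    by rewrite scalerBr -[_ *: (_)%:P]mul_polyC -polyCM [a1 * _]mulrC divfK.
  rewrite dvdpZr // closed_dvdp_XsubC //; split=> [/eqP h [e]|h]; first by apply: h.
  by apply/eqP => e; apply: h; rewrite e.
have szL : (size (Higgs_num a0 a1) == 2)%N = (a1 != 0).
  rewrite eqn_leq size_Higgs_num ltnNge; congr (~~ _).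
  have [_ c1] := coef_Higgs_num a0 a1; apply/idP/eqP => [/leq_sizeP/(_ 1%N)|a10].
    by rewrite c1 => ->.
  by rewrite /Higgs_num a10 scale0r sub0r size_polyN size_polyC_leq1.
apply: (@iff_trans _ (a1 != 0)); last first.
  by rewrite /proj_pt; case: eqP => _; split=> // H; case: H.
split=> [H|a1N w /Omega_logE - /(_ cx) rw].
  (* dt / t generates the logarithmic forms at infinity. That it is in the image forces the
     numerator to have degree 1. *)
  have [|f Of fE] := H tK^-1.
    by apply/(Omega_logE _ cx); rewrite (divff tF0); apply: regular1.
  have LX0 : Higgs_num a0 a1 * 'X^2 != 0 by rewrite mulf_neq0 // expf_neq0 // polyX_eq0.
  have : regular None (Delta%:F / (Higgs_num a0 a1 * 'X^2)%:F).
    have id0 (F : fieldType) (t L D : F) : t != 0 -> L != 0 -> D != 0 ->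
        D / (L * t ^+ 2) = t^-1 / (L / D) / t ^+ 1.
      by move=> ? ? ?; field; apply/and3P.
    rewrite (tofracM (Higgs_num a0 a1)) tofracXn (id0 K tK (Higgs_num a0 a1)%:F Delta%:F tF0 LF0 DF0).
    by rewrite -/(Higgs_form a0 a1) -(hf _ _ fE).
  move/(regularNone_frac _ LX0); rewrite size_Delta size_mulXn // -szL => s4.
  by have := size_Higgs_num a0 a1; nat_lia.
exists (w / Higgs_form a0 a1); last by rewrite mulrC (divfK h0).
have id0 (F : fieldType) (t L D g : F) : t != 0 -> L != 0 -> D != 0 ->
    g / (L / D) / t ^+ 1 = t * g * (D / (L * t ^+ 2)).
  by move=> ? ? ?; field; apply/and3P.
rewrite /O_ /Higgs_form (id0 K tK (Higgs_num a0 a1)%:F Delta%:F w tF0 LF0 DF0).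
rewrite -tofracXn -tofracM; apply: (regularM cx rw).
apply/regularNone_frac; first by rewrite mulf_neq0 // expf_neq0 // polyX_eq0.
by rewrite size_Delta size_mulXn //; move: a1N; rewrite -szL => /eqP ->.
Qed.

Lemma rat_point_inj : injective (@rat_point k).
Proof. by case=> [c|] [d|] //= [] /XsubC_inj ->. Qed.

Lemma Higgs_fieldP th (a : option k) : log_Higgs_field (D1 lam) th -> Higgs_zero (D1 lam) th a ->
  exists a0 a1, [/\ (a0 != 0) || (a1 != 0), th = Higgs_form a0 a1 & a = proj_pt a0 a1].
Proof.
move=> [th0 H] Hz; have DF0 : Delta%:F != 0 :> K by rewrite tofrac_eq0 Delta_neq0.
have tF0 : tK != 0 by rewrite tofrac_eq0 polyX_eq0.
have [P PE] : exists P, Delta%:F * th = P%:F.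
  apply: regular_finite_poly => q cq.
  have /Omega_logE - /(_ cq) := H (Some q) 1 cq (regular1 cq).
  by rewrite mulr1.
have thE : th = P%:F / Delta%:F by rewrite -PE mulrC (mulKf DF0).
have P0 : P != 0.
  by apply: contraNneq th0 => e; rewrite thE e tofrac0 mul0r.
have szP : (size P <= 2)%N.
  (* t generates O(1) at infinity and dt / t the logarithmic forms there, so the condition on
     degrees is deg P + 2 <= 3. *)
  have Ot : O_ 1 None tK by rewrite /O_ expr1 (divff tF0); apply: regular1.
  have /Omega_logE - /(_ I) := H None tK I Ot.
  have id0 (F : fieldType) (t L D : F) : D != 0 -> t * (L / D * t) = (L * t ^+ 2) / D.
    by move=> ?; field.
  rewrite thE (id0 K tK P%:F Delta%:F DF0) -tofracXn -tofracM => /(regularNone_frac _ Delta_neq0).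
  by rewrite size_Delta size_mulXn //; nat_lia.
have PH : P = Higgs_num (- P`_0) P`_1.
  apply/polyP => i; have [c0 c1] := coef_Higgs_num (- P`_0) P`_1.
  case: i => [|[|i]]; rewrite ?c0 ?c1 ?opprK //.
  have szH : (size (Higgs_num (- P`_0) P`_1) <= i.+2)%N by apply: leq_trans (size_Higgs_num _ _) _.
  by rewrite (nth_default _ szH) nth_default // (leq_trans szP).
have a01 : (- P`_0 != 0) || (P`_1 != 0).
  apply: contraNT P0; rewrite negb_or !negbK => /andP[/eqP e0 /eqP e1].
  by rewrite PH e0 e1 /Higgs_num scale0r subr0.
have thE' : th = Higgs_form (- P`_0) P`_1 by rewrite /Higgs_form -PH.
exists (- P`_0), P`_1; split=> //.
(* Both points are the only closed point at which [th] fails to be surjective, so they coincide. *)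
have [_ Hz'] := Higgs_formP a01; rewrite -thE' in Hz'.
apply: rat_point_inj; apply: contrapT => ne.
have ca := closed_rat_point a.
exact: (((Hz _ ca).1 ((Hz' _ ca).2 ne)) erefl).
Qed.

End HiggsFields.

(** * The inverse Cartier transform *)

Section Frame.
Variables (F : fieldType) (n : nat) (g : 'I_n -> F) (T : F).
Implicit Types (f h : F) (i j : 'I_n).

(* Coordinates [f, h] with respect to a common frame of the charts, in which the
   gluing is trivial; [g i] is the gap between the lift of the i-th chart and
   [t |-> t^p]. *)
Definition frame f h i : 'cV[F]_2 := \col_(r < 2) (if r == 0 then f else h - g i * T * f).

Lemma frame0 f h i : frame f h i 0 0 = f. Proof. by rewrite mxE. Qed.
Lemma frame1 f h i : frame f h i 1 0 = h - g i * T * f. Proof. by rewrite mxE. Qed.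

Lemma col2P (u v : 'cV[F]_2) : u 0 0 = v 0 0 -> u 1 0 = v 1 0 -> u = v.
Proof.
move=> e0 e1; apply/matrixP => r c; rewrite ord1.
have : r = 0 \/ r = 1 by case: r => [[|[|r]] //= rl]; [left | right]; apply: val_inj.
by case=> ->.
Qed.

Local Notation E10 := (delta_mx 1 0 : 'M[F]_2).

Lemma mul_glue (a : F) (u : 'cV[F]_2) :
  ((a *: E10) *m u) 0 0 = 0 /\ ((a *: E10) *m u) 1 0 = a * u 0 0.
Proof. by split; rewrite -scalemxAl !mxE !big_ord_recl big_ord0 !mxE /=; ring. Qed.

(** The gluing cocycle is the coboundary of the gaps: passing to the chart j changes the subtracted
    multiple of f from g_i T to g_j T. *)
Lemma glue_frame f h i j :
  frame f h j = (1%:M + (g i - g j) *: (T *: E10)) *m frame f h i.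
Proof.
rewrite mulmxDl mul1mx scalerA; have [e0 e1] := mul_glue ((g i - g j) * T) (frame f h i).
apply: col2P.
  by rewrite [RHS]mxE e0 !frame0 addr0.
by rewrite [RHS]mxE e1 !frame1 !frame0; ring.
Qed.

Lemma frame_glue (s : 'I_n -> 'cV[F]_2) i :
    (forall i j, s j = (1%:M + (g i - g j) *: (T *: E10)) *m s i) ->
  s =1 frame (s i 0 0) (s i 1 0 + g i * T * s i 0 0).
Proof.
move=> H j; rewrite [LHS](H i j) (glue_frame _ _ i j); congr (_ *m _).
by apply: col2P; rewrite ?frame0 // frame1 addrK.
Qed.

Lemma frame_comb a b f h f' h' i :
  a *: frame f h i + b *: frame f' h' i = frame (a * f + b * f') (a * h + b * h') i.
Proof. by apply: col2P; rewrite !mxE //=; ring. Qed.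

Lemma frame_inj f h f' h' i : frame f h i = frame f' h' i -> f = f' /\ h = h'.
Proof.
move=> e; have := congr1 (fun M : 'cV_2 => M 0 0) e; rewrite !frame0 => ef.
have := congr1 (fun M : 'cV_2 => M 1 0) e; rewrite !frame1 ef => /addIr eh.
by split.
Qed.

(** [T], being a p-th power, is a constant for [D]. Differentiating - g_i T f produces D(g_i), which
    cancels the part of the connection form depending on the chart; u T is common to all charts. *)
Lemma frame_nabla (D : F -> F) (u : F) f h i :
    (forall x y, D (x + y) = D x + D y) -> (forall x y, D (x * y) = D x * y + x * D y) ->
    (forall x, D (- x) = - D x) -> D T = 0 ->
  map_mx D (frame f h i) + (u + D (g i)) *: ((T *: E10) *m frame f h i) =
  frame (D f) (D h + u * T * f) i.
Proof.
move=> DD DM DN DT; have [e0 e1] := mul_glue T (frame f h i).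
apply: col2P.
  by rewrite mxE [X in _ + X]mxE e0 mxE !frame0 mulr0 addr0.
rewrite mxE [X in _ + X]mxE e1 mxE !frame0 !frame1.
by rewrite DD DN !DM DT; ring.
Qed.

Lemma cramer2 (e f h f' h' x y : F) : f * h' - f' * h = e -> e != 0 ->
  let a := (x * h' - f' * y) / e in let b := (f * y - x * h) / e in
  x = a * f + b * f' /\ y = a * h + b * h'.
Proof. by move=> <- e0 a b; rewrite /a /b; split; field. Qed.

(* Wedging with the frame does not see the gluing. *)
Lemma wedge_shift (c f h x y : F) : f * (y - c * x) - x * (h - c * f) = f * y - x * h.
Proof. by ring. Qed.

End Frame.

Section Stalks.
Variable k : fieldType.
Local Notation K := {fraction {poly k}}.
Local Notation "q %:F" := (tofrac q).
Local Notation tK := ('X%:F : K).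
Implicit Types (x : option {poly k}) (f g : K).

Lemma tX_neq0 (n : nat) : tK ^+ n != 0.
Proof. by rewrite expf_neq0 // tofrac_eq0 polyX_eq0. Qed.

Lemma O_0 x f : O_ 0 x f <-> regular x f.
Proof. by case: x => [q|]; rewrite /O_ ?expr0 ?divr1. Qed.

Lemma Frob_pull_O (p n : nat) x f : closed_point x -> Frob_pull p (@O_ k n) x f <-> O_ (n * p) x f.
Proof.
move=> cx; split.
  case=> c [u [rc Ou ->]]; case: x cx rc Ou => [q|] cx rc Ou /=.
    exact: (regularM cx rc (regularX p cx Ou)).
  rewrite /O_ in Ou *; rewrite exprM -mulrA -expr_div_n.
  exact: (regularM cx rc (regularX p cx Ou)).
case: x cx => [q|] cx Of.
  exists f, 1; split; [exact: Of | exact: (regular1 cx) | by rewrite expr1n mulr1].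
exists (f / tK ^+ (n * p)), (tK ^+ n); split; first exact: Of.
  by rewrite /O_ (divff (tX_neq0 n)); exact: (regular1 cx).
by rewrite -exprM (divfK (tX_neq0 _)).
Qed.

Lemma O_M (n n' : nat) x f g : closed_point x -> O_ n x f -> O_ n' x g -> O_ (n + n') x (f * g).
Proof.
move=> cx; case: x cx => [q|] cx; rewrite /O_ => Of Og; first exact: (regularM cx Of Og).
by rewrite exprD -mulf_div; exact: (regularM cx Of Og).
Qed.

Lemma O_D (n : nat) x f g : closed_point x -> O_ n x f -> O_ n x g -> O_ n x (f + g).
Proof.
move=> cx; case: x cx => [q|] cx; rewrite /O_ => Of Og; first exact: (regularD cx Of Og).
by rewrite mulrDl; exact: (regularD cx Of Og).
Qed.

Lemma O_B (n : nat) x f g : closed_point x -> O_ n x f -> O_ n x g -> O_ n x (f - g).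
Proof.
move=> cx; case: x cx => [q|] cx; rewrite /O_ => Of Og; first exact: (regularB cx Of Og).
by rewrite mulrBl; exact: (regularB cx Of Og).
Qed.

Lemma O_C (n : nat) x (c : k) f : closed_point x -> O_ n x f -> O_ n x (f / c%:P%:F).
Proof.
move=> cx Of; have [->|c0] := eqVneq c 0.
  rewrite polyC0 tofrac0 invr0 mulr0; case: x cx {Of} => [q|] cx; rewrite /O_ ?mul0r; exact: regular0.
have -> : (c%:P%:F)^-1 = (c^-1)%:P%:F :> K.
  apply: (mulfI (x := c%:P%:F)); first by rewrite tofrac_eq0 polyC_eq0.
  by rewrite divff ?tofrac_eq0 ?polyC_eq0 // -tofracM -polyCM divff // tofrac1.
case: x cx Of => [q|] cx; rewrite /O_ => Of; first exact: (regularM cx Of (regularC _ cx)).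
by rewrite mulrAC; exact: (regularM cx Of (regularC _ cx)).
Qed.

(* the stalk of O(-n) *)
Definition On (n : nat) x f := regular x (if x is Some _ then f else tK ^+ n * f).

Lemma On_M (a b n : nat) x f g : closed_point x -> (a = b + n)%N ->
  O_ a x f -> On n x g -> O_ b x (f * g).
Proof.
move=> cx ab; case: x cx => [q|] cx; rewrite /O_ /On => Of Og; first exact: (regularM cx Of Og).
have id0 (F : fieldType) (u v f' g' : F) : u != 0 -> v != 0 ->
   f' * g' / u = f' / (u * v) * (v * g') by move=> ? ?; field; apply/andP.
rewrite (id0 K _ _ f g (tX_neq0 b) (tX_neq0 n)) -exprD -ab.
exact: (regularM cx Of Og).
Qed.

End Stalks.

Section FieldIdentities.
Variable F : fieldType.
Implicit Types a b c d f h u v x y D : F.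

Lemma wedge_free a b f f' h h' c : f * h' - f' * h = c -> c != 0 ->
  a * f + b * f' = 0 -> a * h + b * h' = 0 -> a = 0 /\ b = 0.
Proof.
move=> cE c0 u0 u1; split; apply/eqP; rewrite -[_ == 0](mulIr_eq0 _ (mulIf c0)) -cE.
  have -> : a * (f * h' - f' * h) = h' * (a * f + b * f') - f' * (a * h + b * h') by ring.
  by rewrite u0 u1 !mulr0 subrr.
have -> : b * (f * h' - f' * h) = f * (a * h + b * h') - h * (a * f + b * f') by ring.
by rewrite u0 u1 !mulr0 subrr.
Qed.

Lemma shift_comb a b f f' h h' c : a * h + b * h' - c * (a * f + b * f') =
  a * (h - c * f) + b * (h' - c * f').
Proof. by ring. Qed.

Lemma leibniz_comb a a' f f' c d D : D = c * f + d * f' ->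
  a' * f + a * D = (a' + a * c) * f + d * a * f'.
Proof. by move=> ->; ring. Qed.

Lemma leibniz_comb_shift a a' f h h' c d D v : D + v * f = c * h + d * h' ->
  a' * h + a * D + v * (a * f) = (a' + a * c) * h + d * a * h'.
Proof.
move=> E; transitivity (a' * h + a * (D + v * f)); first by ring.
by rewrite E; ring.
Qed.

Lemma wedge_comb c b f h f' h' : c * (f * h' - f' * h) =
  f * (b * h + c * h') - (b * f + c * f') * h.
Proof. by ring. Qed.

End FieldIdentities.

Section Cover.
Variables (p : nat) (k : fieldType) (charkp : p \in [pchar k]).
Hypothesis p_ge3 : (3 <= p)%N.
Local Notation K := {fraction {poly k}}.
Local Notation K2 := (K2 charkp).
Local Notation "q %:F" := (tofrac q).
Local Notation tK := ('X%:F : K).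
Local Notation t2 := (K2_frac 'X 1 : K2).
Variables (n : nat) (Z : 'I_n -> seq (option {poly k})) (Phi : 'I_n -> {rmorphism K2 -> K2}).
Variable y : 'I_n -> K2.
Hypothesis PhiE : forall i, Phi i t2 = t2 ^+ p + y i *+ p.
Hypothesis Z_cover : forall x, closed_point x -> exists i, x \notin Z i.
Variable th : K.
Let T : K := th ^+ p.
Let g i : K := K2_res (y i).
Implicit Types (f h : K) (i j : 'I_n) (x : option {poly k}).

Lemma gluingE i j : gluing Phi th i j = 1%:M + (g i - g j) *: (T *: delta_mx 1 0).
Proof. by rewrite /gluing (Frob_diffE (PhiE i) (PhiE j)). Qed.

Definition frame_regular x f h := forall i, x \notin Z i ->
  O_ p x f /\ regular x (h - g i * T * f).

Lemma V_frameP x s : closed_point x -> V_ Z Phi th x s <->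
  exists f h, s =1 frame g T f h /\ frame_regular x f h.
Proof.
move=> cx; have FP i u : Frob_pull p (@O_ k 1) x u <-> O_ p x u.
  by have := @Frob_pull_O k p 1 x u cx; rewrite mul1n.
have FP0 u : Frob_pull p (@O_ k 0) x u <-> regular x u.
  by rewrite -O_0; have := @Frob_pull_O k p 0 x u cx; rewrite mul0n.
split=> [[G R]|[f [h [sE R]]]].
  have [i0 _] := Z_cover cx.
  have sE : s =1 frame g T (s i0 0 0) (s i0 1 0 + g i0 * T * s i0 0 0).
    by apply: frame_glue => i j; rewrite -gluingE; apply: G.
  exists (s i0 0 0), (s i0 1 0 + g i0 * T * s i0 0 0); split=> // i /R[R0 R1].
  move: R0 R1; rewrite (sE i) frame0 frame1 => R0 R1.
  by split; [apply/(FP i) | apply/FP0].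
split=> [i j|i /R[R0 R1]]; first by rewrite !sE gluingE; apply: glue_frame.
by rewrite !sE frame0 frame1; split; [apply/(FP i) | apply/FP0].
Qed.

Lemma nabla_frame s f h i : s =1 frame g T f h ->
  nabla Phi th s i = frame g T (fderiv f) (fderiv h + tK ^+ p.-1 * T * f) i.
Proof.
move=> sE; rewrite /nabla sE (div_deriv_lift (PhiE i)).
apply: frame_nabla; [exact: fderivD | exact: fderivM | exact: fderivN | exact: fderiv_expp].
Qed.

(* A frame of V made of a section of V(-m-1) and a section of V(-m) *)
Section Splitting.
Variables (f h f' h' : K) (e : k).
Let m := p.-1./2.
Hypothesis e_neq0 : e != 0.
Hypothesis wedgeE : f * h' - f' * h = e%:P%:F.
Hypothesis regular_v : forall x i, closed_point x -> x \notin Z i ->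
  O_ m x f /\ On m.+1 x (h - g i * T * f).
Hypothesis regular_w : forall x i, closed_point x -> x \notin Z i ->
  O_ m.+1 x f' /\ On m x (h' - g i * T * f').

Let eF_neq0 : e%:P%:F != 0 :> K.
Proof. by rewrite tofrac_eq0 polyC_eq0. Qed.

(** The coordinates of a section of V are its wedges with the two basis sections, divided by the
    constant e. By [wedge_shift] they can be computed in a chart at x, where the orders at infinity
    add up to p - m = m + 1 and p - (m + 1) = m. *)
Lemma splitting_frame : splitting Z Phi th m (frame g T f h) (frame g T f' h').
Proof.
have p2m : p = m.*2.+1 := pchar_half charkp p_ge3.
split.
  move=> a b ab0.
  have [i _] : exists i, None \notin Z i by exact: Z_cover.
  have := ab0 i; rewrite /comb frame_comb.
  have -> : 0 = frame g T 0 0 i by apply: col2P; rewrite ?frame0 ?frame1 !mxE // mulr0 subr0.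
  move=> /frame_inj[e0 e1].
  exact: (wedge_free wedgeE eF_neq0 e0 e1).
move=> x s cx; split=> [/(V_frameP _ cx)[u [w [sE R]]]|[a [b [Oa Ob sE]]]].
  have [xE yE] := @cramer2 K e%:P%:F f h f' h' u w wedgeE eF_neq0.
  exists ((u * h' - f' * w) / e%:P%:F), ((f * w - u * h) / e%:P%:F).
  have [i xi] := Z_cover cx; have [Ou rw] := R i xi.
  have [Of Oh] := regular_v cx xi; have [Of' Oh'] := regular_w cx xi.
  split.
  - apply: (O_C _ cx); have -> : u * h' - f' * w =
      u * (h' - g i * T * f') - f' * (w - g i * T * u).
      by rewrite (wedge_shift (g i * T) u w f' h').
    apply: (O_B cx).
      by apply: (On_M cx _ Ou Oh'); rewrite p2m; nat_lia.
    by have := O_M cx Of' (iffRL (O_0 _ _) rw); rewrite addn0.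
  - apply: (O_C _ cx); have -> : f * w - u * h =
      f * (w - g i * T * u) - u * (h - g i * T * f).
      by rewrite (wedge_shift (g i * T) f h u w).
    apply: (O_B cx).
      by have := O_M cx Of (iffRL (O_0 _ _) rw); rewrite addn0.
    by apply: (On_M cx _ Ou Oh); rewrite p2m; nat_lia.
  - by move=> j; rewrite sE /comb frame_comb -xE -yE.
apply/(V_frameP _ cx); exists (a * f + b * f'), (a * h + b * h'); split.
  by move=> j; rewrite sE /comb frame_comb.
move=> i xi; have [Of Oh] := regular_v cx xi; have [Of' Oh'] := regular_w cx xi.
split.
  apply: (O_D cx).
    by have := O_M cx Oa Of; have -> : (m.+1 + m = p)%N by rewrite [RHS]p2m; nat_lia.
  by have := O_M cx Ob Of'; have -> : (m + m.+1 = p)%N by rewrite [RHS]p2m; nat_lia.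
rewrite (shift_comb a b f f' h h' (g i * T)); apply/O_0; apply: (O_D cx).
  exact: (On_M cx _ Oa Oh).
exact: (On_M cx _ Ob Oh').
Qed.

(** By Cramer's rule, the component of the derivative of v along w is the wedge of v with its
    derivative, divided by e. The Leibniz term a' v dies in the quotient by the span of v. *)
Lemma graded_frame :
  graded_Higgs_field Z Phi th
    ((f * (fderiv h + tK ^+ p.-1 * T * f) - fderiv f * h) / e%:P%:F).
Proof.
exists (frame g T f h), (frame g T f' h'); split; first exact: splitting_frame.
move=> a; set A := fderiv f; set B := fderiv h + _.
have [AE BE] := @cramer2 K e%:P%:F f h f' h' A B wedgeE eF_neq0.
exists (fderiv a + a * ((A * h' - f' * B) / e%:P%:F)) => i.
have sE : comb (frame g T f h) (frame g T f' h') a 0 =1 frame g T (a * f) (a * h).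
  by move=> j; rewrite /comb frame_comb !mul0r !addr0.
rewrite (nabla_frame i sE) /comb frame_comb; congr (frame _ _ _ _ _).
  by rewrite fderivM -/A; exact: (leibniz_comb _ _ AE).
by rewrite fderivM; exact: (leibniz_comb_shift _ _ BE).
Qed.

End Splitting.

Section Converse.
Variables (m : nat) (v w : 'I_n -> 'cV[K]_2) (th' : K).
Hypothesis vw_split : splitting Z Phi th m v w.
Hypothesis th'E : forall a, exists b, nabla Phi th (comb v w a 0) =1 comb v w b (th' * a).

(** For an arbitrary splitting, the orders of v and w are read off from the generators 1 at finite
    points and t^(m+1), t^m at infinity. Wedging the relation for the derivative of v with v removes
    the unknown component along v. *)
Lemma splitting_frameE : exists f h f' h',
  [/\ (f == 0) && (h == 0) = false,
      forall q, closed_point (Some q) -> frame_regular (Some q) f h,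
      frame_regular None (tK ^+ m.+1 * f) (tK ^+ m.+1 * h),
      (forall q, closed_point (Some q) -> frame_regular (Some q) f' h') /\
      frame_regular None (tK ^+ m * f') (tK ^+ m * h')
    & th' * (f * h' - f' * h) = f * (fderiv h + tK ^+ p.-1 * T * f) - fderiv f * h].
Proof.
have [inj spl] := vw_split.
have [i0 _] : exists i, None \notin Z i by exact: Z_cover.
have Vc x a b : closed_point x -> O_ m.+1 x a -> O_ m x b -> V_ Z Phi th x (comb v w a b).
  by move=> cx Oa Ob; apply/(spl _ _ cx); exists a, b.
have comb_frame f h f' h' a b : v =1 frame g T f h -> w =1 frame g T f' h' ->
    comb v w a b =1 frame g T (a * f + b * f') (a * h + b * h').
  by move=> ve we i; rewrite /comb ve we frame_comb.
have regularE x s f h f' h' : s =1 frame g T f h -> s =1 frame g T f' h' ->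
    frame_regular x f h -> frame_regular x f' h'.
  by move=> e e'; have [-> ->] := frame_inj (etrans (esym (e i0)) (e' i0)).
have O1 (j : nat) (q : {poly k}) : closed_point (Some q) -> O_ j (Some q) 1 by move=> cq; exact: regular1.
have O0 (j : nat) x : closed_point x -> O_ j x 0.
  by case: x => [q|] cx; rewrite /O_ ?mul0r; exact: regular0.
have OX (j : nat) : O_ j None (tK ^+ j) by rewrite /O_ (divff (tX_neq0 k j)); exact: (@regular1 k None I).
have v1 : comb v w 1 0 =1 v by move=> i; rewrite /comb scale1r scale0r addr0.
have w1 : comb v w 0 1 =1 w by move=> i; rewrite /comb scale1r scale0r add0r.
have cX := closed_rat_point (Some (0 : k)).
have /(V_frameP _ cX)[f [h [ve _]]] := Vc _ 1 0 cX (O1 _ _ cX) (O0 _ _ cX).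
have /(V_frameP _ cX)[f' [h' [we _]]] := Vc _ 0 1 cX (O0 _ _ cX) (O1 _ _ cX).
have {}ve : v =1 frame g T f h by move=> i; rewrite -v1 ve.
have {}we : w =1 frame g T f' h' by move=> i; rewrite -w1 we.
have cE := comb_frame _ _ _ _ _ _ ve we.
have key x a b u u' : closed_point x -> O_ m.+1 x a -> O_ m x b ->
    a * f + b * f' = u -> a * h + b * h' = u' -> frame_regular x u u'.
  move=> cx Oa Ob <- <-; have /(V_frameP _ cx)[f1 [h1 [sE R]]] := Vc _ _ _ cx Oa Ob.
  exact: (regularE _ _ _ _ _ _ sE (cE a b)).
exists f, h, f', h'; split.
- apply/negP => /andP[/eqP f0 /eqP h0].
  have : comb v w 1 0 =1 (fun=> 0).
    move=> i; rewrite cE f0 h0 !mul0r !mulr0 !addr0.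
    by apply: col2P; rewrite ?frame0 ?frame1 !mxE // mulr0 subr0.
  by move/inj => -[/eqP]; rewrite (negbTE (oner_neq0 K)).
- by move=> q cq; apply: (key _ 1 0 _ _ cq (O1 _ _ cq) (O0 _ _ cq)); rewrite mul1r mul0r addr0.
- by apply: (key None (tK ^+ m.+1) 0 _ _ I (OX _) (O0 _ None I)); rewrite mul0r addr0.
- split.
    by move=> q cq; apply: (key _ 0 1 _ _ cq (O0 _ _ cq) (O1 _ _ cq)); rewrite mul1r mul0r add0r.
  by apply: (key None 0 (tK ^+ m) _ _ I (O0 _ None I) (OX _)); rewrite mul0r add0r.
have [b bE] := th'E 1; have := bE i0.
have sE : comb v w 1 0 =1 frame g T f h by move=> i; rewrite v1 ve.
rewrite (nabla_frame i0 sE) cE mulr1 => /frame_inj[-> ->].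
exact: wedge_comb.
Qed.

End Converse.

End Cover.

(** * A cover by three charts with explicit lifts *)

Section StandardCover.
Variables (p : nat) (k : fieldType) (charkp : p \in [pchar k]).
Hypothesis p_ge3 : (3 <= p)%N.
Variable lam : W2 charkp.
Local Notation l := (Wres lam).
Hypotheses (l_neq0 : l != 0) (l_neq1 : l != 1).
Local Notation W := (W2 charkp).
Local Notation K2 := (K2 charkp).
Local Notation "q %:F" := (tofrac q).
Local Notation t2 := (K2_frac 'X 1 : K2).
Implicit Types (c d : W) (i : 'I_3).

(* The lift t |-> (t - c)^p + sigma(c) respects the section c, and also
   infinity if c = 0; it is used away from the other points of D. *)
Definition centers : seq W := [:: 0; 1; lam].
Definition std_bad c : seq (option {poly k}) :=
  [seq x <- D1 lam | (x != reduction (Some c)) && ((x != None) || (c != 0))].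

Lemma mem_D2 c : (Some c \in D2 lam) = (c \in centers).
Proof. by rewrite !in_cons !in_nil. Qed.

Lemma Wres_centers_inj c d : c \in centers -> d \in centers -> Wres c = Wres d -> c = d.
Proof.
have n01 : (0 : k) <> 1 by apply/eqP; rewrite eq_sym oner_neq0.
have n0l : 0 <> l by apply/eqP; rewrite eq_sym.
have n1l : 1 <> l by apply/eqP; rewrite eq_sym.
rewrite !in_cons !in_nil !orbF.
by move=> /or3P[] /eqP -> /or3P[] /eqP -> e //; exfalso;
  first [exact: (n01 e) | exact: (n0l e) | exact: (n1l e) | exact: (n01 (esym e))
        | exact: (n0l (esym e)) | exact: (n1l (esym e))].
Qed.

Lemma mem_std_bad c x : x \in std_bad c =
  [&& x != reduction (Some c), (x != None) || (c != 0) & x \in D1 lam].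
Proof. by rewrite mem_filter andbA. Qed.

Lemma reduction_D1 c : c \in centers -> reduction (Some c) \in D1 lam.
Proof. by rewrite -mem_D2 => cD; apply/mapP; exists (Some c). Qed.

Lemma closed_D1 x : x \in D1 lam -> closed_point x.
Proof. by case/mapP => d _ ->; exact: closed_rat_point. Qed.

Lemma std_bad_None c : None \notin std_bad c -> c = 0.
Proof.
have N1 : (None : option {poly k}) \in D1 lam by rewrite D1E !inE.
rewrite mem_std_bad N1 /= andbT; by move=> /negPn/eqP.
Qed.

Lemma std_bad_reduction c d : c \in centers -> d \in centers ->
  reduction (Some d) \notin std_bad c -> d = c.
Proof.
move=> cC dC; rewrite mem_std_bad reduction_D1 //= andbT => /negPn/eqP[/XsubC_inj].
exact: Wres_centers_inj.
Qed.

Lemma std_bad_ndvd c d (q : {poly k}) : closed_point (Some q) -> c \in centers -> d \in centers ->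
  Some q \notin std_bad c -> d != c -> ~~ (q %| 'X - (Wres d)%:P).
Proof.
move=> cq cC dC qZ; apply: contra; rewrite (closed_dvdp_XsubC _ cq) => /eqP qE.
by apply/eqP; apply: std_bad_reduction => //; rewrite /reduction /= -qE.
Qed.

Lemma center_mem i : centers`_i \in centers.
Proof. exact: mem_nth. Qed.

Lemma std_lift_log c (Phi : {rmorphism K2 -> K2}) : c \in centers ->
    (forall z, K2_res (Phi z) = K2_res z ^+ p) ->
    (forall x : {poly k}, closed_point (Some x) -> forall z,
        K2_regular (Some x) z -> K2_regular (Some x) (Phi z)) ->
    Phi (K2_frac ('X - c%:P) 1) = K2_frac ('X - c%:P) 1 ^+ p ->
    (c = 0 -> (forall z, K2_regular None z -> K2_regular None (Phi z)) /\
               Phi (K2_frac 1 'X) = K2_frac 1 'X ^+ p) ->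
  log_Frobenius_lift lam (std_bad c) Phi.
Proof.
move=> cC PhiF Phireg Phic Phi0.
have reg1 x : closed_point x -> K2_regular x (1 : K2).
  case: x => [q [_ qi]|_]; exists 1, 1; rewrite K2_frac1; split=> //.
    by rewrite rmorph1 irr_ndvd1.
  by rewrite lead_coef1 rmorph1 oner_neq0.
split=> //.
  case=> [q|] f cq qZ rf; first exact: Phireg.
  by have [H _] := Phi0 (std_bad_None qZ); apply: H.
move=> d dD dZ; have cd : closed_point (reduction d) by exact: closed_rat_point.
exists 1, 1; split; [exact: reg1 | exact: reg1 | by rewrite mul1r | rewrite mul1r].
case: d dD dZ {cd} => [d|] dD dZ; last by have [_ H] := Phi0 (std_bad_None dZ); exact: H.
by have -> : d = c by apply: std_bad_reduction => //; rewrite -mem_D2.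
Qed.

Lemma std_cover_exists : exists (Phi : 'I_3 -> {rmorphism K2 -> K2}) (y : 'I_3 -> K2),
  [/\ log_Frobenius_cover lam (fun i : 'I_3 => std_bad centers`_i) Phi,
      forall i, Phi i t2 = t2 ^+ p + y i *+ p
    & forall i, K2_res (y i) = (Frob_gap p (Wres centers`_i) (centers`_i).2)%:F].
Proof.
have H i : exists Phiy : {rmorphism K2 -> K2} * K2,
    [/\ log_Frobenius_lift lam (std_bad centers`_i) Phiy.1,
        Phiy.1 t2 = t2 ^+ p + Phiy.2 *+ p
      & K2_res Phiy.2 = (Frob_gap p (Wres centers`_i) (centers`_i).2)%:F].
  have [Phi [y yE resy] [PhiF Phireg Phic Phi0]] := std_lift_exists p_ge3 centers`_i.
  by exists (Phi, y); split=> //; exact: (std_lift_log (center_mem i)).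
have [Phiy PhiyP] := boolp.choice H.
exists (fun i => (Phiy i).1), (fun i => (Phiy i).2); split=> [|i|i]; last 2 first.
- by case: (PhiyP i).
- by case: (PhiyP i).
split=> [i|x cx|i]; last by case: (PhiyP i).
  split=> [|x]; last by rewrite mem_std_bad => /and3P[_ _ /closed_D1].
  suff [x xZ] : exists x, x \in std_bad centers`_i by apply: contraTneq xZ => ->.
  have [c0|c0] := eqVneq centers`_i 0.
    exists (reduction (Some (1 : W))); rewrite mem_std_bad reduction_D1 ?inE ?eqxx ?orbT //.
    rewrite c0 /= andbT; apply/eqP => -[/XsubC_inj/eqP]; apply/negP; exact: oner_neq0.
  by exists None; rewrite mem_std_bad c0 orbT /= D1E !inE.
(* A finite point of D lies in the chart centered there, infinity in the one of t |-> t^p, centered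
   at 0, and a point off D in every chart. *)
have [i iE] : exists i, reduction (Some centers`_i) = x \/ x \notin D1 lam \/ x = None /\ centers`_i = 0.
  have [|xD] := boolP (x \in D1 lam); last by exists ord0; right; left.
  case/mapP => -[c cD ->|_ ->]; last by exists ord0; right; right.
  rewrite mem_D2 in cD; have ci : (index c centers < 3)%N by rewrite index_mem.
  by exists (Ordinal ci); left; rewrite /= nth_index.
exists i; rewrite mem_std_bad.
case: iE => [->|[xD|[-> ->]]]; first by rewrite eqxx.
  by rewrite (negbTE xD) !andbF.
by rewrite eqxx orbF andbF.
Qed.

End StandardCover.

(** * The graded Higgs field *)

Section SectionIdentities.
Variable F : fieldType.
Implicit Types a c f g h r t u v L M N X Y : F.

Lemma clear_poles h g f L M X : M != 0 -> X != 0 ->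
  M * h = M * (h - g * (L / (X * M)) * f) + g / X * (L * f).
Proof. by move=> ? ?; field; apply/andP. Qed.

Lemma clear_poles_at h c r f L M N X Y : X != 0 -> Y != 0 -> N != 0 -> M = Y * N ->
  X * (M * h) - L * c * f = Y * (X * N * (h - (c + Y * r) * (L / (X * M)) * f) + L * r * f).
Proof. by move=> ? ? ? ->; field; apply/and3P. Qed.

Lemma twist_infty u h g f L M X : M != 0 -> X != 0 ->
  u * h = (u * h - g * (L / (X * M)) * (u * f)) + g / X * (L * X / M) * (u * f / X).
Proof. by move=> ? ?; field; apply/andP. Qed.

Lemma chart_quotient h f c L M N X Y v : X != 0 -> Y != 0 -> N != 0 -> M = Y * N ->
  X * h - L * c * f = v * Y -> h / M - c * (L / (X * M)) * f = v / (X * N).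
Proof.
move=> ? ? ? -> E; transitivity ((X * h - L * c * f) / (X * (Y * N))).
  by field; apply/and3P.
by rewrite E; field; apply/and3P.
Qed.

Lemma second_form_quotient f f' h h' L M X u : M != 0 -> X != 0 -> u != 0 ->
  f * ((h' * M - h * 0) / M ^+ 2 + u * (L / (X * u * M)) * f) - f' * (h / M) =
  (X * (f * h' - f' * h) + L * f ^+ 2) / (X * M).
Proof. by move=> ? ? ?; field; apply/and3P. Qed.

End SectionIdentities.

Section HiggsDeRham.
Variables (p : nat) (k : fieldType) (charkp : p \in [pchar k]).
Hypothesis p_ge3 : (3 <= p)%N.
Hypothesis k_perfect : forall x : k, exists y : k, y ^+ p = x.
Variable lam : W2 charkp.
Local Notation l := (Wres lam).
Hypotheses (l_neq0 : l != 0) (l_neq1 : l != 1).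
Variables a0 a1 : k.
Hypothesis a_neq0 : (a0 != 0) || (a1 != 0).
Let m := p.-1./2.
Local Notation W := (W2 charkp).
Local Notation K := {fraction {poly k}}.
Local Notation K2 := (K2 charkp).
Local Notation "q %:F" := (tofrac q).
Local Notation tK := ('X%:F : K).
Local Notation t2 := (K2_frac 'X 1 : K2).
Let th : K := Higgs_form lam a0 a1.
Let M : {poly k} := ('X - 1%:P) ^+ p * ('X - l%:P) ^+ p.
Let L : {poly k} := Lp p (a0 ^+ p) (a1 ^+ p).
Let Vs := Vsect p l (1 : W).2 lam.2 (a0 ^+ p) (a1 ^+ p).

Let p0 : (0 < p)%N.
Proof. exact: leq_trans p_ge3. Qed.

Let al_neq0 : (a0 ^+ p != 0) || (a1 ^+ p != 0).
Proof. by rewrite !expf_eq0 p0. Qed.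

Let p2m : p = m.*2.+1 := pchar_half charkp p_ge3.

Let T1_neq0 : ('X - 1%:P) ^+ p != 0 :> {poly k}.
Proof. by rewrite expf_neq0 ?polyXsubC_eq0. Qed.
Let Tl_neq0 : ('X - l%:P) ^+ p != 0 :> {poly k}.
Proof. by rewrite expf_neq0 ?polyXsubC_eq0. Qed.
Let M_neq0 : M != 0.
Proof. by rewrite mulf_neq0. Qed.
Let MF_neq0 : M%:F != 0 :> K.
Proof. by rewrite tofrac_eq0. Qed.

Lemma size_poles : size M = p.*2.+1.
Proof.
rewrite /M size_Mmonic ?expf_neq0 ?polyXsubC_eq0 ?rpredX ?monicXsubC //.
by rewrite !size_exp_XsubC; nat_lia.
Qed.

Lemma Higgs_num_expp : Higgs_num a0 a1 ^+ p = L.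
Proof.
rewrite /Higgs_num exprDn_pchar ?(pchar_pnat charkp) // exprNn_pchar ?(pchar_pnat charkp) //.
by rewrite exprZn -polyC_exp.
Qed.

Lemma Higgs_form_expp : th ^+ p = L%:F / (tK ^+ p * M%:F).
Proof.
rewrite /th /Higgs_form expr_div_n -tofracXn Higgs_num_expp -tofracXn -tofracXn -tofracM.
by rewrite /Delta !exprMn mulrA.
Qed.

Section GlobalSections.
Variables (n : nat) (Z : 'I_n -> seq (option {poly k})) (y : 'I_n -> K2).
Hypothesis Z_cover : forall x, closed_point x -> exists i, x \notin Z i.
Hypothesis gapP : forall i, gap_conditions lam (Z i) (K2_res (y i)).

(** In the chart i the second coordinate is h - g_i T f, where [T = th^p] can have poles of order p
    at the finite points of D. So f is a polynomial, and h acquires at most the poles that [M]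
    clears. *)
Lemma global_section (e : nat) (f h : K) : (e <= p)%N ->
  (forall q, closed_point (Some q) -> frame_regular Z y th (Some q) f h) ->
  frame_regular Z y th None (tK ^+ e * f) (tK ^+ e * h) ->
  exists P H, [/\ f = P%:F, h = H%:F / M%:F & Vs e P H].
Proof.
move=> ep fin inf; have Tp := Higgs_form_expp.
have tp0 : tK ^+ p != 0 := tX_neq0 k p.
have [P fP] : exists P, f = P%:F.
  apply: regular_finite_poly => q cq; have [i qi] := Z_cover cq.
  by have [] := fin q cq i qi.
have [H hH] : exists H, M%:F * h = H%:F.
  apply: regular_finite_poly => q cq; have [i qi] := Z_cover cq.
  have [Of rh] := fin q cq i qi.
  rewrite (clear_poles h (K2_res (y i)) f L%:F MF_neq0 tp0).
  have rp (Q : {poly k}) : regular (Some q) Q%:F by apply: regular_poly; case: cq.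
  apply: (regularD cq); first by apply: (regularM cq (rp M)); rewrite -Tp.
  apply: (regularM cq); last exact: (regularM cq (rp L) Of).
  (* At t = 0 the gap is divisible by t^p, as [Frob_gap 0 0] vanishes. This cancels the pole of
     [th^p], and is why [M] contains no power of t. *)
  have [qX | qX] := eqVneq q 'X.
    have red0 : reduction (Some (0 : W)) = Some q by rewrite /reduction /= qX polyC0 subr0.
    have D0 : Some (0 : W) \in D2 lam by rewrite in_cons eqxx.
    have Z0 : reduction (Some (0 : W)) \notin Z i by rewrite red0.
    have [_ /(_ _ D0 Z0)[r rr ->] _] := gapP i.
    rewrite Frob_gap0 tofrac0 add0r polyC0 subr0 tofracXn mulrC (mulKf tp0) -red0; exact: rr.
  have [/(_ _ cq qi) rg _ _] := gapP i; apply: (regularM cq rg).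
  rewrite -tofracXn -[_^-1]mul1r -tofrac1; apply: regular_frac.
  apply: contra qX => /(irr_dvdp_exp (proj2 cq)).
  by rewrite -['X]subr0 -polyC0 (closed_dvdp_XsubC _ cq).
have hE : h = H%:F / M%:F by rewrite -hH mulrC (mulKf MF_neq0).
exists P, H; split=> //.
have [i iZ] := Z_cover (x := None) I.
have [Oinf hinf] := inf i iZ.
(* Writing the gap as G + (t - c)^p r, regularity of h - g T f at c, multiplied by t^p [M], turns
   into divisibility by (t - c)^p. *)
have cong (c : W) (N : {poly k}) : Some c \in D2 lam -> Wres c != 0 -> N != 0 ->
    M = ('X - (Wres c)%:P) ^+ p * N ->
    ('X - (Wres c)%:P) ^+ p %| 'X^p * H - L * Frob_gap p (Wres c) c.2 * P.
  move=> cD c0 N0 MN; have cx : closed_point (reduction (Some c)) := closed_rat_point (Some (Wres c)).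
  have [j cj] := Z_cover cx; have [_ rh] := fin _ cx j cj.
  have [_ /(_ _ cD cj)[r rr gE] _] := gapP j.
  have Y0 : (('X - (Wres c)%:P) ^+ p)%:F != 0 :> K by rewrite tofrac_eq0 expf_neq0 ?polyXsubC_eq0.
  have NF0 : N%:F != 0 :> K by rewrite tofrac_eq0.
  have MNF : M%:F = (('X - (Wres c)%:P) ^+ p)%:F * N%:F :> K by rewrite -tofracM -MN.
  rewrite gE Tp in rh.
  have rp (Q : {poly k}) : regular (reduction (Some c)) Q%:F by apply: regular_poly; case: cx.
  have := clear_poles_at h (Frob_gap p (Wres c) c.2)%:F r f L%:F tp0 Y0 NF0 MNF.
  rewrite hH -tofracXn fP -!tofracM -tofracB => E.
  apply: (regular_dvdp (proj2 cx) _ E).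
  apply: (regularD cx); last exact: (regularM cx (regularM cx (rp L) rr) (rp P)).
  by apply: (regularM cx (rp _)); move: rh; rewrite -tofracXn -tofracM fP.
split.
- have : regular None (('X^e * P)%:F / 'X^p%:F).
    by rewrite tofracM !tofracXn -fP; exact: Oinf.
  have Xp0 : 'X^p != 0 :> {poly k} by rewrite expf_neq0 ?polyX_eq0.
  move/(regularNone_frac _ Xp0); rewrite size_polyXn.
  have [->|P0] := eqVneq P 0; first by rewrite size_poly0 add0n => _; nat_lia.
  by rewrite mulrC size_mulXn // addnC.
- have : regular None (('X^e * H)%:F / M%:F).
    rewrite tofracM tofracXn -mulrA -hE.
    (* The correction g T t^e f is regular at infinity: g and t^e f have poles of order at most p,
       and T t^(2p) = L t^p / M is regular there. *)
    rewrite (twist_infty (tK ^+ e) h (K2_res (y i)) f L%:F MF_neq0 tp0).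
    apply: (@regularD _ None _ _ I); first by rewrite -Tp; exact: hinf.
    apply: (@regularM _ None _ _ I); last exact: Oinf.
    apply: (@regularM _ None _ _ I); first by have [_ _ /(_ iZ)] := gapP i.
    rewrite -tofracXn -tofracM; apply/(regularNone_frac _ M_neq0).
    rewrite size_poles.
    have szL : (size L <= p.+1)%N.
      rewrite (leq_trans (size_polyD _ _)) // geq_max size_polyN.
      by rewrite (leq_trans (size_scale_leq _ _)) ?size_polyXn // (leq_trans (size_polyC_leq1 _)).
    by have := size_polyMleq L 'X^p; rewrite size_polyXn; nat_lia.
  move/(regularNone_frac _ M_neq0); rewrite size_poles.
  have [->|H0] := eqVneq H 0; first by rewrite size_poly0 add0n => _; nat_lia.
  by rewrite mulrC size_mulXn // addnC.
- have D1 : Some (1 : W) \in D2 lam by rewrite !in_cons eqxx orbT.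
  exact: (cong 1 (('X - l%:P) ^+ p) D1 (oner_neq0 _) Tl_neq0 erefl).
- have Dl : Some lam \in D2 lam by rewrite !in_cons eqxx !orbT.
  exact: (cong lam (('X - 1%:P) ^+ p) Dl l_neq0 T1_neq0 (mulrC _ _)).
Qed.

End GlobalSections.

(** [M] is a p-th power, hence a constant for the derivation, and the wedge equals [Omega_num] over
    t [M]. The common factor ((t - 1) (t - l))^(p-1) cancels and leaves a linear form over
    [Delta]. *)
Lemma second_form P H : Vs m.+1 P H ->
  P%:F * (fderiv (H%:F / M%:F) + tK ^+ p.-1 * th ^+ p * P%:F) - fderiv P%:F * (H%:F / M%:F) =
  Higgs_form lam (a0 ^+ p * P`_0 ^+ 2 / l ^+ p.-1) (a1 ^+ p * P`_m ^+ 2).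
Proof.
move=> V; have M'0 : M^`() = 0.
  by rewrite derivM !(deriv_expp charkp) mulr0 mul0r addr0.
have tt : tK ^+ p = tK * tK ^+ p.-1 by rewrite -exprS prednK.
have t0 : tK != 0 := tX_neq0 k 1.
have E1 : fderiv (H%:F / M%:F) = (H^`()%:F * M%:F - H%:F * 0) / M%:F ^+ 2.
  by rewrite (fderiv_frac _ M_neq0) M'0 mulr0 subr0 tofracM tofracXn mulr0 subr0.
rewrite E1 Higgs_form_expp tt fderiv_poly.
rewrite (second_form_quotient P%:F P^`()%:F H%:F H^`()%:F L%:F MF_neq0 t0 (tX_neq0 k p.-1)).
have E2 : tK * (P%:F * H^`()%:F - P^`()%:F * H%:F) + L%:F * P%:F ^+ 2 =
    (Omega_num p (a0 ^+ p) (a1 ^+ p) P H)%:F.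
  by rewrite -tofracXn -!tofracM -tofracB -tofracM -tofracD.
rewrite E2 (Omega_numE charkp p_ge3 l_neq0 l_neq1 V) -tofracM; apply/eqP.
have XM0 : 'X * M != 0 by rewrite mulf_neq0 ?polyX_eq0.
rewrite (eq_frac _ _ XM0 (Delta_neq0 lam)); apply/eqP.
have -> : M = (('X - 1%:P) * ('X - l%:P)) ^+ p.-1 * (('X - 1%:P) * ('X - l%:P)).
  by rewrite -exprSr prednK // exprMn.
by rewrite /Delta /Higgs_num; ring.
Qed.

Lemma Vsect_wedge P H P' H' : Vs m.+1 P H -> Vs m P' H' ->
  exists e, P%:F * (H'%:F / M%:F) - P'%:F * (H%:F / M%:F) = e%:P%:F /\
            P * H' - P' * H = e *: M.
Proof.
move=> V V'; have mm : (m.+1 + m = p)%N by rewrite p2m; nat_lia.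
have [e eE] := wedge_const charkp p_ge3 l_neq0 l_neq1 V V' mm.
exists e; split=> //.
by rewrite !mulrA -mulrBl -!tofracM -tofracB eE -mul_polyC tofracM (mulfK MF_neq0).
Qed.

(** Sections with f = 0 lie in the subbundle F^*O = O of V, and a negative twist of O has no nonzero
    global section. *)
Lemma Vsect0 e H : Vs e.+1 0 H -> H = 0.
Proof.
case=> _ szH; rewrite !mulr0 !subr0 => d1 dl; apply/eqP; apply: contraT => H0.
have /dvdpP[u uE] := dvdp_TT l_neq0 l_neq1 d1 dl.
have u0 : u != 0 by apply: contraNneq H0 => u0; rewrite uE u0 mul0r.
move: szH; rewrite uE (size_TTM charkp p_ge3 l_neq0 l_neq1 u0).
have : (0 < size u)%N by rewrite size_poly_gt0.
nat_lia.
Qed.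

Let N : 'M[k]_(m, m.+1) := Hmx p l (a0 ^+ p) (a1 ^+ p).
Let num (v : 'cV[k]_m.+1) : K :=
  Higgs_form lam (a0 ^+ p * v 0 0 ^+ 2 / l ^+ p.-1) (a1 ^+ p * v ord_max 0 ^+ 2).

Lemma second_form_col (v : 'cV[k]_m.+1) H : Vs m.+1 (rVpoly v^T) H ->
  (rVpoly v^T)%:F * (fderiv (H%:F / M%:F) + tK ^+ p.-1 * th ^+ p * (rVpoly v^T)%:F)
    - fderiv (rVpoly v^T)%:F * (H%:F / M%:F) = num v.
Proof. by move=> V; rewrite (second_form V) coef_rVpoly_max coef_rVpoly_0. Qed.

(** The generator of O(m+1) in any splitting, over any cover, is a section of V(-m-1), hence a
    kernel vector. The wedge e may still be 0 at this stage; it is seen to be nonzero once [num v]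
    is. *)
Lemma graded_Higgs_unique n (Z : 'I_n -> seq (option {poly k})) Phi th' :
    log_Frobenius_cover lam Z Phi -> graded_Higgs_field Z Phi th th' ->
  exists v e, [/\ v != 0, N *m v = 0 & th' * e%:P%:F = num v].
Proof.
case=> _ Z_cover lifts [v [w [vw th'E]]].
have [y yP] := boolp.choice (fun i => lift_gapP p_ge3 k_perfect (lifts i)).
have [yE gapP] := all_and2 yP.
have [f [h [f' [h' [fh0 R1 R2 [R1' R2'] E]]]]] := splitting_frameE yE Z_cover vw th'E.
have mp : (m.+1 <= p)%N by rewrite p2m; nat_lia.
have [P [H [fE hE V]]] := global_section Z_cover gapP mp R1 R2.
have [P' [H' [fE' hE' V']]] := global_section Z_cover gapP (ltnW mp) R1' R2'.
pose u : 'cV[k]_m.+1 := (poly_rV P)^T.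
have PE : P = rVpoly u^T.
  by rewrite trmxK poly_rV_K //; case: V => szP _ _ _; nat_lia.
have [e [eE _]] := Vsect_wedge V V'.
rewrite -hE -hE' -fE -fE' in eE.
rewrite PE in V; exists u, e; split.
- apply: contraFneq fh0 => u0; move: V; rewrite u0 trmx0 raddf0 => /Vsect0 H0.
  by rewrite fE hE PE u0 trmx0 raddf0 H0 tofrac0 mul0r eqxx.
- exact: (proj2 (@Vsect_kerP p k charkp p_ge3 l (1:W).2 lam.2 (a0^+p) (a1^+p) l_neq0 l_neq1 u) (ex_intro _ H V)).
- by rewrite -eE E fE hE PE (second_form_col V).
Qed.

Lemma chart_regular (q : {poly k}) c d (Q P H : {poly k}) : closed_point (Some q) ->
    Q != 0 -> M = ('X - c%:P) ^+ p * Q -> ~~ (q %| 'X) -> ~~ (q %| Q) ->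
    ('X - c%:P) ^+ p %| 'X^p * H - L * Frob_gap p c d * P ->
  regular (Some q) (H%:F / M%:F - (Frob_gap p c d)%:F * th ^+ p * P%:F).
Proof.
move=> cq Q0 MQ qX qQ /dvdpP[u uE].
have Y0 : ('X - c%:P) ^+ p != 0 by rewrite expf_neq0 ?polyXsubC_eq0.
have YF0 : (('X - c%:P) ^+ p)%:F != 0 :> K by rewrite tofrac_eq0.
have QF0 : Q%:F != 0 :> K by rewrite tofrac_eq0.
have MF : M%:F = (('X - c%:P) ^+ p)%:F * Q%:F :> K by rewrite MQ tofracM.
have E : tK ^+ p * H%:F - L%:F * (Frob_gap p c d)%:F * P%:F = u%:F * (('X - c%:P) ^+ p)%:F :> K.
  by rewrite -tofracXn -!tofracM -tofracB uE.
rewrite Higgs_form_expp (chart_quotient (tX_neq0 k p) YF0 QF0 MF E) -tofracXn -tofracM.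
apply: regular_frac; rewrite (irr_dvdp_mul (proj2 cq)) negb_or qQ andbT.
by apply: contra qX; exact: (irr_dvdp_exp (proj2 cq)).
Qed.

(** A converse to [global_section] for the explicit cover. The gap of the chart is exactly
    [Frob_gap], the other centers are removed from the chart, and the congruence at c clears the
    pole that remains. Infinity occurs only in the chart with gap 0. *)
Lemma Vsect_regular (n n' : nat) P H (c : W) x : (n + n' = p)%N -> Vs n P H ->
    c \in centers lam -> closed_point x -> x \notin std_bad lam c ->
  O_ n' x P%:F /\
  On n x (H%:F / M%:F - (Frob_gap p (Wres c) c.2)%:F * th ^+ p * P%:F).
Proof.
move=> nn [szP szH d1 dl] cC; case: x => [q|] cx xc; split.
- by apply: regular_poly; case: cx.
- have ndvd d : d \in centers lam -> d != c -> ~~ (q %| 'X - (Wres d)%:P).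
    by move=> dC; exact: (std_bad_ndvd l_neq0 l_neq1 cx cC dC xc).
  have C0 : (0 : W) \in centers lam by rewrite in_cons eqxx.
  have C1 : (1 : W) \in centers lam by rewrite !in_cons eqxx orbT.
  have Cl : lam \in centers lam by rewrite !in_cons eqxx !orbT.
  have n10 : (1 : W) != 0 by apply: oner_neq0.
  have nl0 : lam != 0 by apply: contraNneq l_neq0 => ->.
  have nl1 : lam != 1 by apply: contraNneq l_neq1 => ->.
  have Xq : c != 0 -> ~~ (q %| 'X).
    by move=> c0; have := ndvd 0 C0; rewrite eq_sym c0 => /(_ isT); rewrite polyC0 subr0.
  have ndvdX d : ~~ (q %| 'X - d%:P) -> ~~ (q %| ('X - d%:P) ^+ p).
    by apply: contra; exact: (irr_dvdp_exp (proj2 cx)).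
  move: cC; rewrite /On !in_cons in_nil orbF => /or3P[] /eqP cE; rewrite cE.
  + rewrite Frob_gap0 tofrac0 !mul0r subr0; apply: regular_frac.
    rewrite (irr_dvdp_mul (proj2 cx)) negb_or; apply/andP; split; apply: ndvdX.
      by apply: (ndvd 1 C1); rewrite cE.
    by apply: (ndvd lam Cl); rewrite cE.
  + apply: (chart_regular cx Tl_neq0 erefl _ _ d1); first by apply: Xq; rewrite cE.
    by apply/ndvdX/(ndvd lam Cl); rewrite cE.
  + apply: (chart_regular cx T1_neq0 (mulrC _ _) _ _ dl); first by apply: Xq; rewrite cE.
    by apply/ndvdX/(ndvd 1 C1); rewrite cE eq_sym.
- rewrite /O_ -tofracXn; apply/regularNone_frac; first by rewrite expf_neq0 ?polyX_eq0.
  by rewrite size_polyXn; nat_lia.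
- rewrite /On (std_bad_None xc) Frob_gap0 tofrac0 !mul0r subr0.
  rewrite -tofracXn mulrA -tofracM; apply/(regularNone_frac _ M_neq0); rewrite size_poles.
  have := size_polyMleq 'X^n H; rewrite size_polyXn; nat_lia.
Qed.

Lemma graded_Higgs_exists : exists n (Z : 'I_n -> seq (option {poly k})) Phi v (e : k),
  [/\ log_Frobenius_cover lam Z Phi, e != 0, v != 0, N *m v = 0
    & graded_Higgs_field Z Phi th (num v / e%:P%:F)].
Proof.
have [v v0 vK] := Hmx_ker_exists p l (a0 ^+ p) (a1 ^+ p).
have [H V] := proj1 (@Vsect_kerP p k charkp p_ge3 l (1 : W).2 lam.2 (a0 ^+ p) (a1 ^+ p) l_neq0 l_neq1 v) vK.
have P0 : rVpoly v^T != 0 by rewrite rVpoly_col_eq0.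
have [P' [H' [e [V' e0 eE]]]] := Vsect_complement charkp p_ge3 l_neq0 l_neq1 al_neq0 V P0.
have [Phi [y [cov PhiE yE]]] := std_cover_exists p_ge3 l_neq0 l_neq1.
exists 3, (fun i : 'I_3 => std_bad lam (centers lam)`_i), Phi, v, e; split=> //.
have [_ Z_cover _] := cov.
have wedgeE : (rVpoly v^T)%:F * (H'%:F / M%:F) - P'%:F * (H%:F / M%:F) = e%:P%:F.
  by rewrite !mulrA -mulrBl -!tofracM -tofracB eE -mul_polyC tofracM (mulfK MF_neq0).
rewrite -(second_form_col V).
have m1p : (m.+1 + m = p)%N by rewrite [RHS]p2m; nat_lia.
have mp1 : (m + m.+1 = p)%N by rewrite addnC.
apply: (graded_frame p_ge3 PhiE Z_cover e0 wedgeE) => x i cx xi; rewrite yE.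
  exact: (Vsect_regular m1p V (center_mem lam i) cx xi).
exact: (Vsect_regular mp1 V' (center_mem lam i) cx xi).
Qed.

End HiggsDeRham.

(** * Comparison of the self-map with the quotient of minors *)

Lemma Higgs_form_eqZ (p : nat) (k : fieldType) (charkp : p \in [pchar k]) (lam : W2 charkp)
    (b0 b1 c0 c1 e : k) :
  Higgs_form lam b0 b1 * tofrac e%:P = Higgs_form lam c0 c1 <-> c0 = e * b0 /\ c1 = e * b1.
Proof.
have D0 := Delta_neq0 lam.
have -> : Higgs_form lam b0 b1 * tofrac e%:P = Higgs_form lam (e * b0) (e * b1).
  rewrite /Higgs_form mulrAC -tofracM; congr (tofrac _ / _).
  by rewrite mulrC /Higgs_num mulrBr -!mul_polyC !polyCM -mulrA.
split=> [/eqP|[-> ->] //]; rewrite /Higgs_form (eq_frac _ _ D0 D0) => /eqP/(mulIf D0) E.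
have [e0 e1] := coef_Higgs_num (e * b0) (e * b1); have [d0 d1] := coef_Higgs_num c0 c1.
by rewrite E in e0 e1; split; [apply: oppr_inj; rewrite -d0 -e0 | rewrite -d1 -e1].
Qed.

Lemma proj_pt_surj (k : fieldType) (a : option k) :
  exists a0 a1, (a0 != 0) || (a1 != 0) /\ a = proj_pt a0 a1.
Proof.
case: a => [c|]; [exists c, 1 | exists 1, 0]; rewrite oner_neq0 ?orbT; split=> //.
  by rewrite /proj_pt oner_eq0 divr1.
by rewrite /proj_pt eqxx.
Qed.

Theorem theorem7p5 (p : nat) (k : fieldType) (charkp : p \in [pchar k])
    (p_ge3 : (3 <= p)%N) (k_perfect : forall x : k, exists y : k, y ^+ p = x)
    (lam : W2 charkp) (lam_neq0 : Wres lam != 0) (lam_neq1 : Wres lam != 1)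
    (a b : option k) :
  let K := {fraction {poly k}} in
  let m := p.-1./2 in
  let A : 'M[K]_(m, m.+1) :=
    \matrix_(i < m, j < m.+1) delta p (Wres lam) (m - i.+1 + j.+1) in
  let A_m1 : 'M[K]_m := col' ord0 A in
  let A_p : 'M[K]_m := col' ord_max A in
  let phi : K :=
    tofrac 'X ^+ p / tofrac (Wres lam)%:P ^+ p.-1 * (\det A_m1 / \det A_p) ^+ 2 in
  HdR_selfmap lam a b <-> b = ratmap phi a.
Proof.
move=> K m A A_m1 A_p phi.
have lp0 : (Wres lam ^+ p.-1)^-1 != 0 by rewrite invr_eq0 expf_neq0.
pose N (a0 a1 : k) := Hmx p (Wres lam) (a0 ^+ p) (a1 ^+ p).
have num_neq0 (a0 a1 : k) (v : 'cV_m.+1) :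
    (a0 != 0) || (a1 != 0) -> v != 0 -> N a0 a1 *m v = 0 ->
  (a0 ^+ p * v 0 0 ^+ 2 / Wres lam ^+ p.-1 != 0) || (a1 ^+ p * v ord_max 0 ^+ 2 != 0).
  move=> a01 v0 vK; have p0 : (0 < p)%N := ltnW (ltnW p_ge3).
  have al : (a0 ^+ p != 0) || (a1 ^+ p != 0) by rewrite !expf_eq0 p0.
  have := Hmx_ker_ends charkp p_ge3 0 0 lam_neq0 lam_neq1 al vK v0.
  by rewrite orbC !mulf_eq0 (negbTE lp0) orbF !orbb.
split.
  case=> th [th' [n [Z [Phi [[H1 H2] cov gr [H1' H2']]]]]].
  have [a0 [a1 [a01 thE ->]]] := Higgs_fieldP lam_neq0 lam_neq1 H1 H2.
  have [b0 [b1 [b01 th'E ->]]] := Higgs_fieldP lam_neq0 lam_neq1 H1' H2'.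
  rewrite thE in gr.
  have [v [e [v0 vK E]]] :=
    graded_Higgs_unique p_ge3 k_perfect lam_neq0 lam_neq1 cov gr.
  rewrite th'E in E; have [c0E c1E] := (Higgs_form_eqZ _ _ _ _ _ _).1 E.
  rewrite (ratmap_phi charkp p_ge3 lam_neq0 lam_neq1 a01 v0 vK) c0E c1E proj_ptZ //.
  (* The wedge e of the splitting is nonzero, since otherwise both homogeneous coordinates of the
     new zero would vanish. *)
  have := num_neq0 _ _ _ a01 v0 vK; rewrite c0E c1E; apply: contraTneq => ->.
  by rewrite !mul0r eqxx.
have [a0 [a1 [a01 ->]]] := proj_pt_surj a => ->.
have [n [Z [Phi [v [e [cov e0 v0 vK gr]]]]]] :=
  graded_Higgs_exists p_ge3 lam_neq0 lam_neq1 a01.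
rewrite (ratmap_phi charkp p_ge3 lam_neq0 lam_neq1 a01 v0 vK).
move: gr (num_neq0 _ _ _ a01 v0 vK).
set c0 := (_ / Wres lam ^+ p.-1); set c1 := (_ * v ord_max 0 ^+ 2) => gr c01.
(* Dividing both coordinates by e absorbs the normalization of the splitting without moving the
   point. *)
have ce : (e^-1 * c0 != 0) || (e^-1 * c1 != 0).
  by rewrite !(mulf_eq0 e^-1) invr_eq0 (negbTE e0).
exists (Higgs_form lam a0 a1), (Higgs_form lam (e^-1 * c0) (e^-1 * c1)), n, Z, Phi.
split; [exact: Higgs_formP | exact: cov | | ]; last first.
  by rewrite -(@proj_ptZ k e^-1) ?invr_eq0 //; exact: Higgs_formP.
have eF : tofrac e%:P != 0 :> K by rewrite tofrac_eq0 polyC_eq0.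
have <- : Higgs_form lam c0 c1 / tofrac e%:P = Higgs_form lam (e^-1 * c0) (e^-1 * c1); last exact: gr.
have E : Higgs_form lam (e^-1 * c0) (e^-1 * c1) * tofrac e%:P = Higgs_form lam c0 c1.
  by apply/Higgs_form_eqZ; rewrite !mulVKf.
by rewrite -E (mulfK eF).
Qed.
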